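(* Let $\sigma_1,\sigma_2$ be a pair of Riemannian metrics on the open unit disk $\mathbb{D}\subset\mathbb{C}$. Then any minimal diffeomorphism $f:(\mathbb{D},\sigma_1)\to(\mathbb{D},\sigma_2)$ is stable.
   Context: A diffeomorphism $f:(\mathbb{D},\sigma_1)\to(\mathbb{D},\sigma_2)$ is a minimal diffeomorphism if its graph in the Riemannian product $4$-manifold $(\mathbb{D}^2,\sigma_1\oplus\sigma_2)$ is a minimal surface. For a diffeomorphism $f$ of $\mathbb{D}$ and a relatively compact open subset $U\subset\mathbb{D}$, let $A(f|_U)$ denote the area of the graph of $f|_U$ in $(\mathbb{D}^2,\sigma_1\oplus\sigma_2)$. A minimal diffeomorphism $f:(\mathbb{D},\sigma_1)\to(\mathbb{D},\sigma_2)$ is stable if for every relatively compact open subset $U$ of $\mathbb{D}$ and every $C^\infty$ path of diffeomorphisms $f_t:(\mathbb{D},\sigma_1)\to(\mathbb{D},\sigma_2)$ such that $f_0=f$ and $f_t=f$ on the complement of $U$, $$\frac{d^2}{dt^2}\Big|_{t=0}A(f_t|_U)\geq 0.$$ *)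

(* Defs.v *)
From HB Require Import structures.
From mathcomp Require Import all_boot all_order all_algebra.
From mathcomp Require Import all_classical all_reals all_analysis.

Set Implicit Arguments.
Unset Strict Implicit.
Unset Printing Implicit Defensive.

Import Order.TTheory GRing.Theory Num.Theory.
Import numFieldNormedType.Exports.

Local Open Scope classical_set_scope.
Local Open Scope ring_scope.

(* C^infty on D: every iterated directional derivative is (Frechet)
   differentiable at every point of D. Meant for open D, where it only depends
   on the values of f on D. *)
Definition smooth_on (R : realType) (V W : normedModType R) (D : set V)
    (f : V -> W) : Prop :=
  forall (s : seq V) (x : V), D x ->
    differentiable (foldr (fun v g => 'D_v g) f s) x.

Definition diffeomorphism (R : realType) (n : nat) (D E : set 'rV[R]_n)
    (f : 'rV[R]_n -> 'rV[R]_n) : Prop :=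
  [/\ smooth_on D f, forall x, D x -> E (f x) &
    exists g : 'rV[R]_n -> 'rV[R]_n,
      [/\ smooth_on E g, forall y, E y -> D (g y),
          forall x, D x -> g (f x) = x & forall y, E y -> f (g y) = y]].

(* A metric on an open subset of R^n is given by its Gram matrix in the
   standard coordinates; the value at (v, w) is v *m g x *m w^T. *)
Definition riemannian_metric (R : realType) (n : nat) (D : set 'rV[R]_n)
    (g : 'rV[R]_n -> 'M[R]_n) : Prop :=
  [/\ smooth_on D g, forall x, D x -> (g x)^T = g x &
    forall x (v : 'rV[R]_n), D x -> v != 0 -> 0 < (v *m g x *m v^T) 0 0].

Definition product_metric (R : realType) (m n : nat)
    (g : 'rV[R]_m -> 'M[R]_m) (h : 'rV[R]_n -> 'M[R]_n)
    (p : 'rV[R]_(m + n)) : 'M[R]_(m + n) :=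
  block_mx (g (lsubmx p)) 0 0 (h (rsubmx p)).

Definition partial (R : realType) (n : nat) (W : normedModType R) (i : 'I_n)
    (F : 'rV[R]_n -> W) : 'rV[R]_n -> W :=
  'D_(delta_mx 0 i) F.

(* Gamma^k_ij = 1/2 sum_l g^kl (d_i g_jl + d_j g_il - d_l g_ij) *)
Definition christoffel (R : realType) (n : nat) (g : 'rV[R]_n -> 'M[R]_n)
    (p : 'rV[R]_n) (i j k : 'I_n) : R :=
  2^-1 * \sum_(l < n) invmx (g p) k l *
    (partial i (fun q => g q j l : R^o) p
     + partial j (fun q => g q i l : R^o) p
     - partial l (fun q => g q i j : R^o) p).

(* The i-th row of 'J F x is d_i F x. *)
Definition induced_metric (R : realType) (m n : nat) (g : 'rV[R]_n -> 'M[R]_n)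
    (F : 'rV[R]_m -> 'rV[R]_n) (x : 'rV[R]_m) : 'M[R]_m :=
  'J F x *m g (F x) *m ('J F x)^T.

(* The covariant derivative, for the Levi-Civita connection of g, of the vector
   field d_j F along F in the direction d_i. *)
Definition covariant_hessian (R : realType) (m n : nat)
    (g : 'rV[R]_n -> 'M[R]_n) (F : 'rV[R]_m -> 'rV[R]_n) (x : 'rV[R]_m)
    (i j : 'I_m) : 'rV[R]_n :=
  partial i (partial j F) x +
  \row_(c < n) \sum_(a < n) \sum_(b < n)
    christoffel g (F x) a b c * partial i F x 0 a * partial j F x 0 b.

(* g-orthogonal projection of w onto the span of the d_i F x:
   sum_kl <w, d_k F> h^kl d_l F, with h the induced metric. *)
Definition tangent_part (R : realType) (m n : nat) (g : 'rV[R]_n -> 'M[R]_n)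
    (F : 'rV[R]_m -> 'rV[R]_n) (x : 'rV[R]_m) (w : 'rV[R]_n) : 'rV[R]_n :=
  w *m g (F x) *m ('J F x)^T *m invmx (induced_metric g F x) *m 'J F x.

Definition second_fundamental_form (R : realType) (m n : nat)
    (g : 'rV[R]_n -> 'M[R]_n) (F : 'rV[R]_m -> 'rV[R]_n) (x : 'rV[R]_m)
    (i j : 'I_m) : 'rV[R]_n :=
  covariant_hessian g F x i j - tangent_part g F x (covariant_hessian g F x i j).

Definition mean_curvature (R : realType) (m n : nat)
    (g : 'rV[R]_n -> 'M[R]_n) (F : 'rV[R]_m -> 'rV[R]_n) (x : 'rV[R]_m) :
    'rV[R]_n :=
  \sum_(i < m) \sum_(j < m)
    invmx (induced_metric g F x) i j *: second_fundamental_form g F x i j.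

Definition minimal_immersion (R : realType) (m n : nat) (D : set 'rV[R]_m)
    (g : 'rV[R]_n -> 'M[R]_n) (F : 'rV[R]_m -> 'rV[R]_n) : Prop :=
  forall x, D x -> mean_curvature g F x = 0.

(* The open unit disk of the complex plane, in the real coordinates (Re, Im). *)
Definition disk (R : realType) : set 'rV[R]_2 :=
  [set x | x 0 0 ^+ 2 + x 0 1 ^+ 2 < 1].

(* The graph of f, parametrized by its projection to the first factor. *)
Definition graph_map (R : realType) (m n : nat) (f : 'rV[R]_m -> 'rV[R]_n)
    (x : 'rV[R]_m) : 'rV[R]_(m + n) :=
  row_mx x (f x).

Definition minimal_diffeomorphism (R : realType) (s1 s2 : 'rV[R]_2 -> 'M[R]_2)
    (f : 'rV[R]_2 -> 'rV[R]_2) : Prop :=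
  diffeomorphism (@disk R) (@disk R) f /\
  minimal_immersion (@disk R) (product_metric s1 s2) (graph_map f).

(* Identifies R * R, which carries the planar Lebesgue measure, with 'rV_2. *)
Definition plane_point (R : realType) (z : R * R) : 'rV[R]_2 :=
  \row_(j < 2) (if j == 0 then z.1 else z.2).

Definition graph_area (R : realType) (s1 s2 : 'rV[R]_2 -> 'M[R]_2)
    (f : 'rV[R]_2 -> 'rV[R]_2) (U : set 'rV[R]_2) : R :=
  Rintegral (lebesgue_measure \x lebesgue_measure)%E (@plane_point R @^-1` U)
    (fun z => Num.sqrt (\det (induced_metric (product_metric s1 s2)
                                (graph_map f) (plane_point z)))).

Definition relatively_compact_open (R : realType) (n : nat)
    (D U : set 'rV[R]_n) : Prop :=
  [/\ open U, compact (closure U) & closure U `<=` D].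

(* A C^infty path (f_t), |t| < e, of diffeomorphisms of the disk, smooth
   jointly in (t, x). *)
Definition smooth_diffeo_path (R : realType) (e : R)
    (ft : R -> 'rV[R]_2 -> 'rV[R]_2) : Prop :=
  (forall t, `|t| < e -> diffeomorphism (@disk R) (@disk R) (ft t)) /\
  smooth_on [set p : R^o * 'rV[R]_2 | `|p.1| < e /\ disk p.2]
    (fun p : R^o * 'rV[R]_2 => ft p.1 p.2).

(* As derivatives are total functions, the existence of the second derivative
   of the area at 0 is part of the definition. *)
Definition stable (R : realType) (s1 s2 : 'rV[R]_2 -> 'M[R]_2)
    (f : 'rV[R]_2 -> 'rV[R]_2) : Prop :=
  forall (U : set 'rV[R]_2) (e : R) (ft : R -> 'rV[R]_2 -> 'rV[R]_2),
    relatively_compact_open (@disk R) U ->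
    0 < e ->
    smooth_diffeo_path e ft ->
    (forall x, disk x -> ft 0 x = f x) ->
    (forall t x, `|t| < e -> disk x -> ~ U x -> ft t x = f x) ->
    let A := (fun t => graph_area s1 s2 (ft t) U) : R -> R^o in
    [/\ \forall t \near (0 : R), derivable A t 1,
        derivable (derive1 A) 0 1 &
        0 <= derive1n 2 A 0].

(* Main.v *)
(* Pull the target metric back by f, so that the competitor f o psi_t becomes a
   variation psi_t of the identity of (D, s1), (D, g) with g = f^* s2, and let
   G = s1 + g be the induced metric of the graph.  The two tangential equations
   contained in the vanishing of the mean curvature say that g is balanced for
   the conformal structure of G: its stress tensor is divergence free, i.e. the
   Hopf differential Phi = a + i b is holomorphic for G.  After an integration
   by parts the second variation of the area becomes a first order quadratic
   form in the vector field X = d psi_t / dt.  Where Phi does not vanish, this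
   form differs from a nonnegative one by the exterior derivative of a 1-form
   built from Phi / |Phi| and X.  Regularising |Phi| to sqrt(|Phi|^2 + eps^2)
   makes the 1-form smooth and compactly supported, so that it integrates to 0,
   at the price of an error whose integral tends to 0 with eps.  The form
   is nonnegative because det g > 0 and det s1 > 0 bound |Phi| by the energy
   densities of g and of s1 for the conformal structure of G. *)
Require Import Defs.
From mathcomp Require Import all_boot all_order all_algebra.
From mathcomp Require Import all_classical all_reals all_analysis.
From mathcomp Require Import measurable_realfun ring lra.

Set Implicit Arguments.
Unset Strict Implicit.
Unset Printing Implicit Defensive.

Import Order.TTheory GRing.Theory Num.Theory.
Import numFieldNormedType.Exports.

Local Open Scope classical_set_scope.
Local Open Scope ring_scope.

(** * Smooth functions *)

(** The conformal class of G is carried by a complex function m = m1 + i m2, with G proportional to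
    |dx + m dy|^2, so every equation stays in the given coordinates of the disk. Holomorphy of the
    quadratic differential Phi (dx + m dy)^2 then reads d_1 Phi = m d_0 Phi + 2 Phi d_0 m. Origin of
    the 1-form: let x be the value of dx + m dy on X and w = sqrt(Phi) x, that is X read in the flat
    coordinate with differential sqrt(Phi) (dx + m dy). Then Im(w^* dw) does not depend on the
    choice of the root, and its exterior derivative is twice the Jacobian of w, a difference of two
    squared moduli in the first derivatives of X. The obstacle is the zero set of Phi. With r =
    sqrt(|Phi|^2 + eps^2), the regularisation costs a term with the factor eps^2 / r^3, which equals
    1 / eps at a zero. Holomorphy tames it: the Jacobian of Phi is nonnegative up to terms
    containing Phi, so the cost is bounded by a multiple of eps^2 |Phi| / r^3. This weight is at
    most 1 and tends to 0 at every point, zeros of Phi included. *)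

Section Smooth.
Context {R : realType}.
Implicit Types V W : normedModType R.

Lemma near_eq_differentiable V W (f g : V -> W) x :
  (\near x, f x = g x) -> differentiable f x -> differentiable g x.
Proof.
move=> fg /diff_locallyP[dfc fE].
have gE : g \o shift x = cst (g x) + 'd f x +o_ 0 id.
  apply/eqaddoP => eps eps0.
  move/eqaddoP : fE => /(_ _ eps0).
  have fg0 : \forall h \near (0 : V), f (h + x) = g (h + x).
    by have := fg; rewrite (near_shift 0 x) /=; apply: filterS => h /=; rewrite subr0.
  apply: filter_app; near=> h.
  rewrite /= !fctE /=.
  have -> : f (h + x) = g (h + x) by near: h.
  by rewrite (nbhs_singleton fg).
have gd : 'd g x = 'd f x :> (V -> W) by exact: diff_unique.
by apply/diff_locallyP; rewrite gd.
Unshelve. all: by end_near. Qed.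

Lemma smooth_onE V W (D : set V) (f : V -> W) :
  smooth_on D f <-> (forall x, D x -> differentiable f x) /\
                    (forall v, smooth_on D ('D_v f)).
Proof.
split=> [sf|[f0 fv]].
  split=> [x Dx|v s x Dx]; first exact: (sf [::]).
  by have := sf (rcons s v) x Dx; rewrite foldr_rcons.
by elim/last_ind => [|s v _] x Dx; [exact: f0|rewrite foldr_rcons; exact: fv].
Qed.

(* smooth_on as an intersection of classes C^n, which allows induction. *)
Fixpoint class_C V W (n : nat) (D : set V) (f : V -> W) : Prop :=
  (forall x, D x -> differentiable f x) /\
  (if n is n'.+1 then forall v, class_C n' D ('D_v f) else True).

Lemma class_CP V W (D : set V) (f : V -> W) :
  smooth_on D f <-> forall n, class_C n D f.
Proof.
split=> [sf n|].
  elim: n f sf => [|n ih] f /smooth_onE[f0 fv]; split => // v.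
  exact/ih.
move=> cf s; elim/last_ind: s f cf => [|s v ih] f cf x Dx.
  by have [/(_ x Dx)] := cf 0%N.
by rewrite foldr_rcons; apply: ih => // n; have [_ /(_ v)] := cf n.+1.
Qed.

Lemma class_CW V W n (D : set V) (f : V -> W) :
  class_C n.+1 D f -> class_C n D f.
Proof.
elim: n f => [|n ih] f [f0 fv]; split => // v.
exact: ih.
Qed.

Lemma class_C_D V W n (D : set V) (f : V -> W) v :
  class_C n.+1 D f -> class_C n D ('D_v f).
Proof. by case=> _ /(_ v). Qed.

Lemma class_C_diff V W n (D : set V) (f : V -> W) x :
  class_C n D f -> D x -> differentiable f x.
Proof. by case: n => [|n] [+ _] => /[apply]. Qed.

Lemma near_open V (D : set V) (P : V -> Prop) x : open D -> D x ->
  (forall y, D y -> P y) -> \forall y \near x, P y.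
Proof.
move=> oD Dx DP; have : nbhs x D by exact: open_nbhs_nbhs.
by apply: filterS.
Qed.

Lemma class_C_eq V W n (D : set V) (f g : V -> W) : open D ->
  (forall x, D x -> f x = g x) -> class_C n D f -> class_C n D g.
Proof.
move=> oD; elim: n f g => [|n ih] f g fg [f0 fv]; split => //.
- move=> x Dx; apply: near_eq_differentiable (f0 _ Dx).
  exact: near_open oD Dx fg.
- move=> x Dx; apply: near_eq_differentiable (f0 _ Dx).
  exact: near_open oD Dx fg.
move=> v; apply: ih (fv v) => x Dx.
by apply: near_eq_derive; exact: near_open oD Dx fg.
Qed.

Lemma class_C_cst V W n (D : set V) (c : W) : class_C n D (cst c : V -> W).
Proof.
elim: n c => [|n ih] c; split => // v.
by rewrite (_ : 'D_v (cst c) = cst 0) //; apply/funext => x; exact: derive_cst.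
Qed.

Lemma class_CD V W n (D : set V) (f g : V -> W) : open D ->
  class_C n D f -> class_C n D g -> class_C n D (fun x => f x + g x).
Proof.
move=> oD; elim: n f g => [|n ih] f g [f0 fv] [g0 gv].
  by split => // x Dx; apply: differentiableD; [exact: f0|exact: g0].
split => [x Dx|v]; first by apply: differentiableD; [exact: f0|exact: g0].
apply: (@class_C_eq _ _ _ _ (fun x => 'D_v f x + 'D_v g x)) => //; last by apply: ih; [exact: fv|exact: gv].
by move=> x Dx; rewrite deriveD//; apply: diff_derivable; [exact: f0|exact: g0].
Qed.

Lemma class_CN V W n (D : set V) (f : V -> W) : open D ->
  class_C n D f -> class_C n D (fun x => - f x).
Proof.
move=> oD; elim: n f => [|n ih] f [f0 fv].
  by split => // x Dx; apply: differentiableN; exact: f0.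
split => [x Dx|v]; first by apply: differentiableN; exact: f0.
apply: (@class_C_eq _ _ _ _ (fun x => - 'D_v f x)) => //; last exact: ih (fv v).
by move=> x Dx; rewrite deriveN//; apply: diff_derivable; exact: f0.
Qed.

Lemma class_CM V n (D : set V) (f g : V -> R^o) : open D ->
  class_C n D f -> class_C n D g -> class_C n D (fun x => f x * g x : R^o).
Proof.
move=> oD; elim: n f g => [|n ih] f g Cf Cg.
  by split => // x Dx; apply: differentiableM;
    [exact: class_C_diff Cf Dx|exact: class_C_diff Cg Dx].
split => [x Dx|v].
  by apply: differentiableM; [exact: class_C_diff Cf Dx|exact: class_C_diff Cg Dx].
apply: (@class_C_eq _ _ _ _ (fun x => f x * 'D_v g x + g x * 'D_v f x)) => //.
  move=> x Dx; rewrite deriveM//; apply: diff_derivable.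
    exact: class_C_diff Cf Dx.
  exact: class_C_diff Cg Dx.
have [[_ fv] [_ gv]] := (Cf, Cg).
apply: class_CD => //; apply: ih; first exact: class_CW Cf.
- exact: gv.
- exact: class_CW Cg.
- exact: fv.
Qed.

Lemma class_CV V n (D : set V) (f : V -> R^o) : open D ->
  (forall x, D x -> f x != 0) ->
  class_C n D f -> class_C n D (fun x => (f x)^-1 : R^o).
Proof.
move=> oD fn0; elim: n => [|n ih] Cf.
  split => // x Dx; apply: differentiableV; last exact: fn0.
  exact: class_C_diff Cf Dx.
have CfV := ih (class_CW Cf); split => [x Dx|v].
  by apply: differentiableV; [exact: class_C_diff Cf Dx|exact: fn0].
apply: (@class_C_eq _ _ _ _ (fun x => - ((f x)^-1 * (f x)^-1 * 'D_v f x))) => //.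
  move=> x Dx; rewrite deriveV ?fn0//; last first.
    by apply: diff_derivable; exact: class_C_diff Cf Dx.
  by rewrite expr2 invfM scaleNr.
apply: class_CN => //; apply: class_CM => //; last exact: class_C_D Cf.
exact: class_CM.
Qed.

Lemma derive_coord V m n (M : V -> 'M[R]_(m, n)) i j x v :
  differentiable M x -> 'D_v (fun y => M y i j : R^o) x = 'D_v M x i j.
Proof. by move=> dM; rewrite derive_mx ?mxE//; exact: diff_derivable. Qed.

Lemma class_C_coord V k (D : set V) m n (M : V -> 'M[R]_(m, n)) i j : open D ->
  class_C k D M -> class_C k D (fun y => M y i j : R^o).
Proof.
move=> oD; elim: k M => [|k ih] M CM.
  split => // x Dx; apply: (@differentiable_comp _ _ _ _ M (fun N => N i j)).
    exact: class_C_diff CM Dx.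
  exact: differentiable_coord.
split => [x Dx|v].
  apply: (@differentiable_comp _ _ _ _ M (fun N => N i j)).
    exact: class_C_diff CM Dx.
  exact: differentiable_coord.
apply: (@class_C_eq _ _ _ _ (fun x => 'D_v M x i j)) => //.
  by move=> x Dx; rewrite derive_coord//; exact: class_C_diff CM Dx.
exact: ih (class_C_D _ CM).
Qed.

Lemma derive_comp_rV V n (h : 'rV[R]_n -> R^o) (phi : V -> 'rV[R]_n) x v :
  differentiable phi x -> differentiable h (phi x) ->
  'D_v (h \o phi) x =
  \sum_(i < n) 'D_(delta_mx 0 i) h (phi x) * ('D_v phi x) 0 i.
Proof.
move=> dphi dh; rewrite deriveE; last exact: differentiable_comp.
rewrite diff_comp//= -(deriveE _ dphi) [X in 'd h _ X]row_sum_delta linear_sum/=.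
by apply: eq_bigr => i _; rewrite linearZ/= -deriveE// mulrC.
Qed.

Lemma class_C_sum V k (D : set V) n (f : 'I_n -> V -> R^o) : open D ->
  (forall i, class_C k D (f i)) -> class_C k D (fun x => \sum_(i < n) f i x : R^o).
Proof.
move=> oD; elim: n f => [|n ih] f Cf.
  apply: (@class_C_eq _ _ _ _ (cst 0)) => //; last exact: class_C_cst.
  by move=> x _; rewrite big_ord0.
apply: (@class_C_eq _ _ _ _
  (fun x => (\sum_(i < n) f (widen_ord (leqnSn n) i) x : R^o) + f ord_max x)) => //.
  by move=> x _; rewrite big_ord_recr.
by apply: class_CD => //; exact: ih.
Qed.

Lemma class_C_comp V k (D : set V) n (E : set 'rV[R]_n) (h : 'rV[R]_n -> R^o)
    (phi : V -> 'rV[R]_n) : open D -> (forall x, D x -> E (phi x)) ->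
  class_C k D phi -> class_C k E h -> class_C k D (fun x => h (phi x)).
Proof.
move=> oD DE; elim: k h => [|k ih] h Cphi Ch.
  split => // x Dx; apply: differentiable_comp; first exact: class_C_diff Cphi Dx.
  exact: class_C_diff Ch (DE _ Dx).
split => [x Dx|v].
  apply: differentiable_comp; first exact: class_C_diff Cphi Dx.
  exact: class_C_diff Ch (DE _ Dx).
apply: (@class_C_eq _ _ _ _ (fun x =>
  \sum_(i < n) 'D_(delta_mx 0 i) h (phi x) * ('D_v phi x) 0 i)) => //.
  move=> x Dx; rewrite -derive_comp_rV//; first exact: class_C_diff Cphi Dx.
  exact: class_C_diff Ch (DE _ Dx).
apply: class_C_sum => // i; apply: class_CM => //.
  exact: (ih ('D_(delta_mx 0 i) h) (class_CW Cphi) (class_C_D _ Ch)).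
by apply: class_C_coord => //; exact: class_C_D Cphi.
Qed.

Lemma derive_sqrt_comp V (f : V -> R^o) x v : 0 < f x -> differentiable f x ->
  differentiable (fun y => Num.sqrt (f y) : R^o) x /\
  'D_v (fun y => Num.sqrt (f y) : R^o) x = (2 * Num.sqrt (f x))^-1 * 'D_v f x.
Proof.
move=> fx0 df; have ds : differentiable (Num.sqrt : R -> R^o) (f x).
  by apply/derivable1_diffP; have [] := is_derive1_sqrt fx0.
have dc : differentiable (fun y => Num.sqrt (f y) : R^o) x.
  exact: (@differentiable_comp _ _ _ _ f (Num.sqrt : R^o -> R^o)).
split=> //; rewrite deriveE//.
rewrite (@diff_comp _ _ _ _ f (Num.sqrt : R^o -> R^o))//= -(deriveE _ df).
rewrite -[X in 'd _ _ X]mulr1 [LHS]linearZ/= -deriveE//.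
by rewrite (derive_sqrt fx0); exact: mulrC.
Qed.

Lemma class_C_sqrt V n (D : set V) (f : V -> R^o) : open D ->
  (forall x, D x -> 0 < f x) ->
  class_C n D f -> class_C n D (fun x => Num.sqrt (f x) : R^o).
Proof.
move=> oD f0; elim: n => [|n ih] Cf.
  split => // x Dx.
  by have [] := derive_sqrt_comp 0 (f0 _ Dx) (class_C_diff Cf Dx).
split => [x Dx|v].
  by have [] := derive_sqrt_comp 0 (f0 _ Dx) (class_C_diff Cf Dx).
apply: (@class_C_eq _ _ _ _ (fun x => (2 * Num.sqrt (f x))^-1 * 'D_v f x)) => //.
  by move=> x Dx; have [_ ->] := derive_sqrt_comp v (f0 _ Dx) (class_C_diff Cf Dx).
apply: class_CM => //; last exact: class_C_D Cf.
apply: class_CV => // [x Dx|].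
  by rewrite mulf_neq0// gt_eqF// sqrtr_gt0 f0.
apply: class_CM => //; first exact: class_C_cst.
exact: ih (class_CW Cf).
Qed.

Lemma is_derive_line V W (f : V -> W) (x u : V) (s : R) :
  derivable f (x + s *: u) u ->
  is_derive s (1 : R^o) (fun t : R^o => f (x + t *: u)) ('D_u f (x + s *: u)).
Proof.
have E : (fun h : R => h^-1 *: (f (x + (h *: (1 : R^o) + s) *: u) - f (x + s *: u)))
    = (fun h => h^-1 *: (f (h *: u + (x + s *: u)) - f (x + s *: u))).
  apply/funext => h; congr (_ *: (f _ - _)).
  by rewrite [h *: (1 : R^o)]mulr1 scalerDl addrCA.
by move=> df; apply: DeriveDef; rewrite /derivable /derive E.
Qed.

Lemma MVT_line V (f : V -> R^o) (x u : V) (h : R) : 0 < h ->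
  (forall s : R, 0 <= s <= h -> differentiable f (x + s *: u)) ->
  exists2 s, 0 <= s <= h & f (x + h *: u) - f x = h * 'D_u f (x + s *: u).
Proof.
move=> h0 df.
have dl s : s \in `[0, h] ->
    is_derive s (1 : R^o) (fun t : R^o => f (x + t *: u)) ('D_u f (x + s *: u)).
  rewrite in_itv/= => sh.
  by apply: is_derive_line; apply: diff_derivable; exact: df.
pose g : R -> R := fun t => f (x + t *: u).
pose dg : R -> R := fun t => 'D_u f (x + t *: u).
have dl' s : s \in `]0, h[ -> is_derive s 1 g (dg s).
  by move=> /subset_itv_oo_cc; exact: dl.
have cg : {within `[0, h], continuous g}.
  by apply: derivable_within_continuous => s sh; have [] := dl _ sh.
have [s sh E] := MVT h0 dl' cg.
move: sh; rewrite in_itv/= => /andP[s0 sh]; exists s; first by rewrite !ltW.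
by move: E; rewrite /g scale0r addr0 subr0 mulrC.
Qed.

(** The mean value theorem is applied along [u] to the increment of [f] by [h *: v], then along [v]
    to ['D_u f]. The second difference on the left is symmetric in [u] and [v], which is what
    [derive_comm] exploits. *)
Lemma MVT_square V (D : set V) (f : V -> R^o) (x u v : V) (h : R) :
  class_C 2 D f -> 0 < h ->
  (forall y, `|y - x| <= h * (`|u| + `|v|) -> D y) ->
  exists2 p, `|p - x| <= h * (`|u| + `|v|) &
    f (x + h *: u + h *: v) - f (x + h *: u) - f (x + h *: v) + f x =
    h * (h * 'D_v ('D_u f) p).
Proof.
move=> Cf h0 HD.
have nrm s t : 0 <= s <= h -> 0 <= t <= h ->
    `|x + s *: u + t *: v - x| <= h * (`|u| + `|v|).
  move=> /andP[s0 sh] /andP[t0 th].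
  rewrite -(addrA x) [x + (_ + _)]addrC addrK mulrDr (le_trans (ler_normD _ _))// !normrZ.
  by rewrite !ger0_norm// lerD// ler_wpM2r.
have hh : 0 <= h <= h by rewrite lexx ltW.
have h00 : 0 <= (0 : R) <= h by apply/andP; split => //; exact: ltW.
have dg (s : R) : 0 <= s <= h -> differentiable (fun y => f (y + h *: v) - f y : R^o) (x + s *: u)
    /\ 'D_u (fun y => f (y + h *: v) - f y : R^o) (x + s *: u) =
      'D_u f (x + s *: u + h *: v) - 'D_u f (x + s *: u).
  move=> sh.
  have d1 : differentiable f (x + s *: u + h *: v).
    by apply: class_C_diff Cf (HD _ _); exact: nrm.
  have d2 : differentiable f (x + s *: u).
    by apply: class_C_diff Cf (HD _ _); have := nrm s 0 sh h00; rewrite scale0r addr0.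
  have dsh : is_diff (x + s *: u) (fun y : V => y + h *: v) id.
    by apply: is_diff_eq; rewrite addr0.
  have d3 : differentiable (fun y => f (y + h *: v) : R^o) (x + s *: u).
    exact: (@differentiable_comp _ _ _ _ (fun y => y + h *: v) f).
  split; first exact: differentiableB.
  rewrite (@deriveB _ _ _ (fun y => f (y + h *: v) : R^o) f _ _ (diff_derivable d3) (diff_derivable d2)); congr (_ - _).
  rewrite (deriveE _ d3) (@diff_comp _ _ _ _ (fun y => y + h *: v) f)//=.
  by rewrite (diff_val (is_diff_def := dsh)) deriveE.
have [s sh E] := MVT_line h0 (fun s sh => (dg s sh).1).
have C1 : class_C 1 D ('D_u f) by exact: class_C_D.
have [t th E2] : exists2 t, 0 <= t <= h &
    'D_u f (x + s *: u + h *: v) - 'D_u f (x + s *: u) =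
    h * 'D_v ('D_u f) (x + s *: u + t *: v).
  apply: (@MVT_line V ('D_u f) (x + s *: u) v h h0) => t th.
  exact: class_C_diff C1 (HD _ (nrm _ _ sh th)).
exists (x + s *: u + t *: v); first exact: nrm.
by rewrite -E2 -(dg s sh).2 -E !opprD opprK addrA.
Qed.

Lemma near_normP V (P : set V) (x : V) : (\forall y \near x, P y) ->
  exists2 r : R, 0 < r & forall y, `|y - x| < r -> P y.
Proof.
move=> /nbhs_ballP[r /= r0 Hb]; exists r => // y yx.
by apply: Hb; rewrite -ball_normE /ball_ /= distrC.
Qed.

(** The two values may be taken at different points near [x]: the mean value theorem in the two
    orders yields two unrelated intermediate points, and continuity brings both back to [x]. *)
Lemma eq_of_near_values V (F G : V -> R^o) (x : V) :
  {for x, continuous F} -> {for x, continuous G} ->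
  (\forall r \near 0^'+, exists p q : V,
     [/\ `|p - x| < r, `|q - x| < r & F p = G q]) ->
  F x = G x.
Proof.
move=> cF cG /near_normP[r0 r00 H].
apply/eqP; rewrite -subr_eq0 -normr_le0; apply/ler_addgt0Pl => e e0.
have e2 : 0 < e / 2 by rewrite divr_gt0.
rewrite addr0.
have [r1 r10 H1] := near_normP ((cvgrPdist_lt _ _).1 cF _ e2).
have [r2 r20 H2] := near_normP ((cvgrPdist_lt _ _).1 cG _ e2).
pose r := Num.min (r0 / 2) (Num.min r1 r2).
have rp : 0 < r by rewrite !lt_min r10 r20 divr_gt0.
have [|p [q [px qx E]]] := H r _ rp.
  rewrite /= subr0 gtr0_norm// /r gt_min.
  by rewrite ltr_pdivrMr// ltr_pMr// ltr1n.
rewrite [e]splitr (le_trans (ler_distD (F p) _ _))// lerD//.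
  by apply/ltW/H1; rewrite (lt_le_trans px)// /r !ge_min lexx orbT.
by rewrite E distrC; apply/ltW/H2; rewrite (lt_le_trans qx)// /r !ge_min lexx !orbT.
Qed.

Lemma derive_comm V (D : set V) (f : V -> R^o) (x u v : V) :
  open D -> D x -> class_C 2 D f -> 'D_u ('D_v f) x = 'D_v ('D_u f) x.
Proof.
move=> oD Dx Cf; apply: (@eq_of_near_values V ('D_u ('D_v f)) ('D_v ('D_u f)) x).
- apply: differentiable_continuous.
  exact: class_C_diff (class_C_D _ (class_C_D _ Cf)) Dx.
- apply: differentiable_continuous.
  exact: class_C_diff (class_C_D _ (class_C_D _ Cf)) Dx.
have [r0 r00 Hr0] := near_normP (near_open oD Dx (fun y Dy => Dy)).
near=> r.
have r_gt0 : 0 < r by near: r; exact: nbhs_right_gt.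
have rr0 : r < r0 by near: r; exact: nbhs_right_lt.
(* The [+ 1] keeps the denominator positive when [u] and [v] vanish and makes the inequality [hr]
   strict. *)
pose h := r / (`|u| + `|v| + 1).
have uv0 : 0 <= `|u| + `|v| by rewrite addr_ge0.
have uv1 : 0 < `|u| + `|v| + 1 by rewrite ltr_wpDl.
have h0 : 0 < h by rewrite divr_gt0.
have hr : h * (`|u| + `|v|) < r.
  by rewrite /h mulrAC ltr_pdivrMr// ltr_pM2l// ltrDl.
have HD y : `|y - x| <= h * (`|u| + `|v|) -> D y.
  by move=> yx; apply: Hr0; rewrite (le_lt_trans yx)// (lt_trans hr).
have HD' y : `|y - x| <= h * (`|v| + `|u|) -> D y by rewrite [`|v| + _]addrC; exact: HD.
have [p px E1] := MVT_square Cf h0 HD.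
have [q qx E2] := MVT_square Cf h0 HD'.
exists q, p; split; first by rewrite (le_lt_trans qx)// [`|v| + _]addrC.
  by rewrite (le_lt_trans px).
have E : h * (h * 'D_v ('D_u f) p) = h * (h * 'D_u ('D_v f) q).
  apply: etrans (esym E1) _; apply: etrans _ E2.
  have -> : x + h *: v + h *: u = x + h *: u + h *: v by exact: addrAC.
  by congr (_ + _); exact: addrAC.
move: E; generalize ('D_v ('D_u f) p : R) ('D_u ('D_v f) q : R) => a b.
by move=> /(mulfI (lt0r_neq0 h0))/(mulfI (lt0r_neq0 h0)).
Unshelve. all: by end_near. Qed.

End Smooth.

(** * Calculus of real-valued functions *)

Section Scalar.
Context {R : realType} {V : normedModType R}.
Implicit Types (D : set V) (f g : V -> R) (v x : V).

Definition pd v f x : R := 'D_v (f : V -> R^o) x.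

Definition sm D f : Prop := smooth_on D (f : V -> R^o).

(** Differentiability and the value of the derivative travel together, so that a derivative can be
    built up along the syntax of the function. *)
Definition isder x v f (d : R) : Prop :=
  differentiable (f : V -> R^o) x /\ pd v f x = d.

Lemma sm_diff D f x : sm D f -> D x -> differentiable (f : V -> R^o) x.
Proof. by move=> /smooth_onE[+ _] => /[apply]. Qed.

Lemma sm_cst D c : sm D (fun=> c).
Proof. by apply/class_CP => n; exact: class_C_cst. Qed.

Lemma sm_pd D f v : sm D f -> sm D (pd v f).
Proof. by move=> /smooth_onE[_ /(_ v)]. Qed.

Lemma sm_eq D f g : open D -> (forall x, D x -> f x = g x) -> sm D f -> sm D g.
Proof.
by move=> oD fg /class_CP sf; apply/class_CP => n; exact: class_C_eq fg (sf n).
Qed.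

Lemma smD D f g : open D -> sm D f -> sm D g -> sm D (fun x => f x + g x).
Proof.
move=> oD /class_CP sf /class_CP sg; apply/class_CP => n.
exact: (@class_CD _ _ _ n D (f : V -> R^o) g oD).
Qed.

Lemma smN D f : open D -> sm D f -> sm D (fun x => - f x).
Proof.
move=> oD /class_CP sf; apply/class_CP => n.
exact: (@class_CN _ _ _ n D (f : V -> R^o) oD).
Qed.

Lemma smB D f g : open D -> sm D f -> sm D g -> sm D (fun x => f x - g x).
Proof. by move=> oD sf sg; apply: (smD oD sf (smN oD sg)). Qed.

Lemma smM D f g : open D -> sm D f -> sm D g -> sm D (fun x => f x * g x).
Proof.
move=> oD /class_CP sf /class_CP sg; apply/class_CP => n.
exact: (@class_CM _ _ n D (f : V -> R^o) g oD).
Qed.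

Lemma smX D f n : open D -> sm D f -> sm D (fun x => f x ^+ n).
Proof.
move=> oD sf; elim: n => [|n ih]; first exact: (@sm_cst D 1).
apply: (@sm_eq _ (fun x => f x * f x ^+ n)) => //; last exact: smM.
by move=> x _; rewrite exprS.
Qed.

Lemma smV D f : open D -> (forall x, D x -> f x != 0) -> sm D f ->
  sm D (fun x => (f x)^-1).
Proof.
move=> oD f0 /class_CP sf; apply/class_CP => n.
exact: (@class_CV _ _ n D (f : V -> R^o) oD).
Qed.

Lemma sm_sqrt D f : open D -> (forall x, D x -> 0 < f x) -> sm D f ->
  sm D (fun x => Num.sqrt (f x)).
Proof.
move=> oD f0 /class_CP sf; apply/class_CP => n.
exact: (@class_C_sqrt _ _ n D (f : V -> R^o) oD).
Qed.

Lemma pd_eq D f g v x : open D -> D x -> (forall x, D x -> f x = g x) ->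
  pd v f x = pd v g x.
Proof. by move=> oD Dx fg; apply: near_eq_derive; exact: near_open fg. Qed.

Lemma pd_comm D f u v x : open D -> D x -> sm D f ->
  pd u (pd v f) x = pd v (pd u f) x.
Proof. by move=> oD Dx /class_CP sf; exact: derive_comm (sf 2%N). Qed.

Lemma isder_sm D f v x : sm D f -> D x -> isder x v f (pd v f x).
Proof. by move=> sf Dx; split => //; exact: sm_diff sf Dx. Qed.

Lemma isder_eq f v x d d' : isder x v f d -> d = d' -> isder x v f d'.
Proof. by move=> ? <-. Qed.

Lemma isder_cst v x c : isder x v (fun=> c) 0.
Proof. by split; [exact: differentiable_cst|exact: derive_cst]. Qed.

Lemma isderD f g v x df dg : isder x v f df -> isder x v g dg ->
  isder x v (fun y => f y + g y) (df + dg).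
Proof.
move=> [f1 <-] [g1 <-]; split.
  exact: (@differentiableD _ _ _ (f : V -> R^o) g).
by apply: (@deriveD _ _ _ (f : V -> R^o) g); exact: diff_derivable.
Qed.

Lemma isderN f v x df : isder x v f df -> isder x v (fun y => - f y) (- df).
Proof.
move=> [f1 <-]; split.
  exact: (@differentiableN _ _ _ (f : V -> R^o)).
by apply: (@deriveN _ _ _ (f : V -> R^o)); exact: diff_derivable.
Qed.

Lemma isderB f g v x df dg : isder x v f df -> isder x v g dg ->
  isder x v (fun y => f y - g y) (df - dg).
Proof. by move=> f1 g1; exact: isderD f1 (isderN g1). Qed.

Lemma isderM f g v x df dg : isder x v f df -> isder x v g dg ->
  isder x v (fun y => f y * g y) (df * g x + f x * dg).
Proof.
move=> [f1 <-] [g1 <-]; split.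
  exact: (@differentiableM _ _ f g).
rewrite addrC [_ * g x]mulrC.
by apply: (@deriveM _ _ f g); exact: diff_derivable.
Qed.

Lemma isderV f v x df : f x != 0 -> isder x v f df ->
  isder x v (fun y => (f y)^-1) (- (df / f x ^+ 2)).
Proof.
move=> fx0 [f1 <-]; split; first exact: (@differentiableV _ _ f).
rewrite [_ / _]mulrC -mulNr.
by apply: (@deriveV _ _ f) => //; exact: diff_derivable.
Qed.

Lemma isder_sqrt f v x df : 0 < f x -> isder x v f df ->
  isder x v (fun y => Num.sqrt (f y)) (df / (2 * Num.sqrt (f x))).
Proof.
move=> fx0 [f1 <-]; have [? E] := @derive_sqrt_comp _ _ (f : V -> R^o) _ v fx0 f1.
by split => //; rewrite mulrC; exact: E.
Qed.

End Scalar.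

Section Composition.
Context {R : realType} {V : normedModType R}.

Lemma sm_coord (D : set V) m n (M : V -> 'M[R]_(m, n)) i j : open D ->
  smooth_on D M -> sm D (fun y => M y i j).
Proof.
move=> oD /class_CP sM; apply/class_CP => k.
exact: (@class_C_coord _ _ k D m n M i j oD).
Qed.

Lemma smooth_coordP (D : set V) m n (M : V -> 'M[R]_(m, n)) i j v x : open D -> D x ->
  smooth_on D M -> pd v (fun y => M y i j) x = 'D_v M x i j.
Proof.
move=> oD Dx /smooth_onE[sM _]; exact: (@derive_coord _ _ _ _ M i j x v (sM _ Dx)).
Qed.

Lemma sm_comp (D : set V) n (E : set 'rV[R]_n) (h : 'rV[R]_n -> R)
    (phi : V -> 'rV[R]_n) : open D -> (forall x, D x -> E (phi x)) ->
  smooth_on D phi -> sm E h -> sm D (fun x => h (phi x)).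
Proof.
move=> oD DE /class_CP sp /class_CP sh; apply/class_CP => k.
exact: (@class_C_comp _ _ k D n E (h : _ -> R^o) phi oD).
Qed.

Lemma isder_comp (D : set V) n (E : set 'rV[R]_n) (h : 'rV[R]_n -> R)
    (phi : V -> 'rV[R]_n) x v : open D -> D x -> E (phi x) ->
  smooth_on D phi -> sm E h ->
  isder x v (fun x => h (phi x))
    (\sum_(i < n) pd (delta_mx 0 i) h (phi x) * pd v (fun y => phi y 0 i) x).
Proof.
move=> oD Dx Ex sp sh.
have dp : differentiable phi x by move/smooth_onE: sp => [+ _]; apply.
have dh := sm_diff sh Ex; split.
  exact: (@differentiable_comp _ _ _ _ phi (h : _ -> R^o)).
apply: etrans (@derive_comp_rV _ _ n (h : _ -> R^o) phi x v dp dh) _.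
by apply: eq_bigr => i _; rewrite (smooth_coordP _ _ _ oD Dx sp).
Qed.

End Composition.

Section Vector.
Context {R : realType} {V : normedModType R}.

Lemma class_C_scale (W : normedModType R) k (D : set V) (f : V -> R^o) (w : W) : open D ->
  class_C k D f -> class_C k D (fun y => f y *: w).
Proof.
move=> oD.
have df (h : V -> R^o) x : differentiable h x -> differentiable (fun y => h y *: w) x.
  by move=> dh; exact: differentiableZl.
elim: k f => [|k ih] f [f0 fv].
  by split => // x Dx; apply: df; exact: f0.
split => [x Dx|v]; first by apply: df; exact: f0.
apply: (@class_C_eq _ _ _ _ _ (fun x => 'D_v f x *: w)) => //; last exact: ih (fv v).
move=> x Dx; rewrite !deriveE; [|exact: df (f0 _ Dx)|exact: f0].
by rewrite diffZl//; exact: f0.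
Qed.

Lemma smooth_on_mx (D : set V) m n (phi : V -> 'M[R]_(m, n)) : open D ->
  (forall i j, sm D (fun y => phi y i j)) -> smooth_on D phi.
Proof.
move=> oD sp; apply/class_CP => k.
pose F y (p : 'I_m * 'I_n) := phi y p.1 p.2 *: (delta_mx p.1 p.2 : 'M[R]_(m, n)).
apply: (@class_C_eq _ _ _ _ _ (fun y => \sum_p F y p)) => //.
  by move=> y _; rewrite [RHS]matrix_sum_delta pair_bigA.
elim: (index_enum _) => [|p r ih].
  apply: (@class_C_eq _ _ _ _ _ (cst 0)) => //; last exact: class_C_cst.
  by move=> x _; rewrite big_nil.
apply: (@class_C_eq _ _ _ _ _ (fun y => F y p + \sum_(i <- r) F y i)) => //.
  by move=> x _; rewrite big_cons.
apply: class_CD => //; apply: class_C_scale => //.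
by have /class_CP := sp p.1 p.2; exact.
Qed.
End Vector.

(** * Integrals over the plane *)

Section OneDim.
Context {R : realType}.
Let mu := (@lebesgue_measure R).

(** Each point is the only point of [A] in some interval with rational ends, and there are countably
    many such intervals. *)
Lemma isolated_countable (A : set R) :
  (forall x, A x -> exists2 e, 0 < e & forall y, A y -> `|y - x| < e -> y = x) ->
  countable A.
Proof.
move=> HA.
pose F (q : rat * rat) : set R := [set x | [/\ A x, ratr q.1 < x < ratr q.2 &
  forall y, A y -> ratr q.1 < y < ratr q.2 -> y = x]].
have AF : A `<=` \bigcup_(q in [set: rat * rat]) F q.
  move=> x Ax; have [e e0 He] := HA _ Ax.
  have [p] := @rat_in_itvoo R (x - e) x ltac:(by rewrite ltrBlDr ltrDl).
  have [q] := @rat_in_itvoo R x (x + e) ltac:(by rewrite ltrDl).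
  rewrite !in_itv/= => /andP[q1 q2] /andP[p1 p2].
  exists (p, q) => //; split => //=; first by rewrite p2.
  move=> y Ay /andP[py yq]; apply: He => //.
  by rewrite ltr_distl (lt_trans p1)//= (lt_trans yq).
apply: (sub_countable (subset_card_le AF)).
apply: bigcup_countable; first exact: countableP.
move=> q _; have [->|/set0P[x [Ax xq Hx]]] := eqVneq (F q) set0.
  exact: countable0.
apply: (@sub_countable _ _ _ [set x]); last exact: countable1.
by apply: subset_card_le => y [Ay yq Hy] /=; exact: Hx.
Qed.

(** [O] will be a slice of an arbitrary open set, whose boundary may have positive measure. The
    fundamental theorem of calculus gives 0 on all of [[a, b]]. Off [O], where [g] vanishes, a point
    with [g'] nonzero is an isolated zero of [g]; such points are countable and do not
    contribute. *)
Lemma integral_derive_supp (O : set R) (g g' : R -> R) (a b : R) :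
  a < b -> measurable O -> O `<=` `]a, b[ ->
  (forall x, is_derive x (1 : R) g (g' x)) -> continuous g' ->
  (forall x, ~ O x -> g x = 0) ->
  (\int[mu]_(x in O) (g' x)%:E = 0)%E.
Proof.
move=> ab mO Oab dg cg' g0.
have cg : continuous g.
  by move=> x; apply: differentiable_continuous; apply/derivable1_diffP; have [] := dg x.
have nO x : x = a \/ x = b -> ~ O x.
  by move=> xab /Oab /=; rewrite in_itv/= => /andP[]; case: xab => ->; rewrite ltxx.
have FTC : (\int[mu]_(x in `[a, b]) (g' x)%:E = 0)%E.
  rewrite (@continuous_FTC2 _ g' g)//.
  - by rewrite (g0 a (nO a (or_introl erefl))) (g0 b (nO b (or_intror erefl))) subee.
  - by apply: continuous_subspaceT => x; exact: cg'.
  - split; first by move=> x _; have [] := dg x.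
    + by apply: cvg_at_right_filter; exact: cg.
    + by apply: cvg_at_left_filter; exact: cg.
  - by move=> x _; rewrite derive1E; have [_ ->] := dg x.
pose N := [set x | ~ O x /\ g' x != 0].
have cN : countable N.
  apply: isolated_countable => x [Ox g'x].
  have [dx Ex] := dg x.
  have : \forall h \near 0^', h^-1 *: (g (h *: (1 : R) + x) - g x) != 0.
    have [l ll] := (cvg_ex _).1 dx.
    have E : l = g' x by rewrite -Ex; apply/esym/cvg_lim.
    by apply: (cvgr_neq0 _ ll); rewrite E.
  move=> /near_normP[e e0 He].
  exists e => // y [Oy _] yx; have [//|yNx] := eqVneq y x.
  have := He (y - x); rewrite subr0 /= => /(_ yx); rewrite subr_eq0 => /(_ yNx).
  by rewrite [_ *: (1 : R)]mulr1 subrK !g0// subrr scaler0 eqxx.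
have mN : measurable N by exact: countable_measurable.
rewrite -FTC -[in LHS](setIidr (A := `[a, b]%classic) (B := O)); last first.
  by move=> x /Oab; exact: subset_itv_oo_cc.
have mg' := continuous_measurable_fun cg'.
have mg : measurable_fun `[a, b] (fun x => (g' x)%:E).
  by apply/measurable_EFinP; exact: measurable_funTS.
rewrite integral_mkcondr; apply: ae_eq_integral => //.
  apply/measurable_restrict => //.
  by apply: measurable_funS mg => //; exact: subIsetl.
exists N; split => //; first exact: countable_lebesgue_measure0.
move=> x /= /not_implyP[xab]; rewrite patchE; case: ifPn => // xO g'x.
split; first by move/mem_set; apply/negP.
by apply/eqP => g'0; apply: g'x; rewrite g'0.
Qed.

End OneDim.

Lemma countable_bigcup_measurable d (T : measurableType d) (I : countType)
    (Q : set I) (F : I -> set T) :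
  (forall i, measurable (F i)) -> measurable (\bigcup_(i in Q) F i).
Proof.
move=> mF.
pose G n := if unpickle n is Some q then (if `[< Q q >] then F q else set0) else set0.
have -> : \bigcup_(q in Q) F q = \bigcup_n G n.
  apply/seteqP; split => [z [q Qq qz]|z [n _]].
    by exists (pickle q) => //; rewrite /G pickleK asboolT.
  by rewrite /G; case: unpickle => [q|//]; case: asboolP => // Qq qz; exists q.
apply: bigcupT_measurable => n; rewrite /G; case: unpickle => [q|//].
by case: asboolP.
Qed.

Section Plane.
Context {R : realType}.
Notation pp := (@plane_point R).
Local Notation mu2 := (@lebesgue_measure R \x @lebesgue_measure R)%E.

Lemma plane_point_ltP (z w : R * R) r : 0 < r ->
  `|z.1 - w.1| < r -> `|z.2 - w.2| < r -> `|pp z - pp w| < r.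
Proof.
move=> r0 h1 h2; rewrite [ltLHS]/Num.Def.normr/= mx_normrE.
apply/bigmax_ltP; split => // -[i j] _; rewrite !mxE /=.
by case: ifP.
Qed.

(** Bridges the norm topology of ['rV_2] and the product sigma-algebra of [R * R]: [U] corresponds
    to the union of the rational rectangles that it contains. *)
Lemma measurable_plane_open (U : set 'rV[R]_2) : open U -> measurable (pp @^-1` U).
Proof.
move=> oU.
pose rect (q : (rat * rat) * (rat * rat)) : set (R * R) :=
  `]ratr q.1.1, ratr q.1.2[%classic `*` `]ratr q.2.1, ratr q.2.2[%classic.
pose Q := [set q | rect q `<=` pp @^-1` U].
have -> : pp @^-1` U = \bigcup_(q in Q) rect q.
  apply/seteqP; split => [z Uz|z [q Qq] /Qq //].
  have [r r0 Hr] := near_normP (near_open oU Uz (fun y Uy => Uy)).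
  have h (a : R) : exists q : rat * rat, [/\ ratr q.1 < a < ratr q.2,
      a - r < ratr q.1 & ratr q.2 < a + r].
    have [p] := @rat_in_itvoo R (a - r) a ltac:(by rewrite ltrBlDr ltrDl).
    have [q] := @rat_in_itvoo R a (a + r) ltac:(by rewrite ltrDl).
    rewrite !in_itv/= => /andP[q1 q2] /andP[p1 p2].
    by exists (p, q); rewrite q1 p2.
  have [q1 [q11 q12 q13]] := h z.1.
  have [q2 [q21 q22 q23]] := h z.2.
  exists (q1, q2); last by split; rewrite /= in_itv.
  move=> w []; rewrite /= !in_itv/= => /andP[a1 a2] /andP[b1 b2].
  apply: Hr; apply: plane_point_ltP => //.
    by rewrite ltr_distl (lt_trans q12)//= (lt_trans a2).
  by rewrite ltr_distl (lt_trans q22)//= (lt_trans b2).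
by apply: countable_bigcup_measurable => q; exact: measurableX.
Qed.

Lemma measurable_plane_fun (U : set 'rV[R]_2) (f : 'rV[R]_2 -> R) : open U ->
  (forall x, U x -> {for x, continuous f}) ->
  measurable_fun (pp @^-1` U) (f \o pp).
Proof.
move=> oU cf; apply: (measurability _ (RGenOInfty.measurableE R)).
move=> /= _ [_ [a ->]] <-.
have -> : pp @^-1` U `&` (f \o pp) @^-1` `]a, +oo[%classic =
    pp @^-1` [set x | U x /\ a < f x].
  by apply/seteqP; split=> z /=; rewrite in_itv/= andbT.
apply: measurable_plane_open; rewrite openE => x [Ux ax].
near=> y; split; near: y; first exact: near_open oU Ux (fun y Uy => Uy).
exact: (cvgr_gt _ (cf _ Ux)).
Unshelve. all: by end_near. Qed.

Lemma compact_cont_bounded (T : topologicalType) (K : set T) (f : T -> R) :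
  compact K -> (forall x, K x -> {for x, continuous f}) ->
  exists2 C, 0 < C & forall x, K x -> `|f x| <= C.
Proof.
move=> cK cf.
have : compact (f @` K).
  apply: continuous_compact => //; apply: continuous_in_subspaceT => x.
  by rewrite inE => /cf.
move=> /compact_bounded[M [_ HM]].
exists (`|M| + 1); first by rewrite ltr_wpDl.
move=> x Kx; apply: HM; last by exists x.
by rewrite (le_lt_trans (ler_norm _))// ltrDl.
Qed.

Lemma compact_coord_bounded (K : set 'rV[R]_2) : compact K ->
  exists2 C : R, 0 < C & forall x, K x -> forall i, `|x 0 i| < C.
Proof.
move=> cK.
have h i : exists2 C, 0 < C & forall x : 'rV[R]_2, K x -> `|x 0 i| <= C.
  by apply: compact_cont_bounded => // x _; exact: coord_continuous.
have [C0 C00 H0] := h 0; have [C1 C10 H1] := h 1.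
exists (C0 + C1 + 1); first by rewrite !addr_gt0.
move=> x Kx; case => -[|[|//]] j.
  rewrite (_ : Ordinal j = 0); last exact: val_inj.
  by rewrite (le_lt_trans (H0 _ Kx))// -addrA ltrDl addr_gt0.
rewrite (_ : Ordinal j = 1); last exact: val_inj.
by rewrite (le_lt_trans (H1 _ Kx))// addrAC addrC ltrDl addr_gt0.
Qed.

Lemma plane_finite (D U : set 'rV[R]_2) : relatively_compact_open D U ->
  (mu2 (pp @^-1` U) < +oo)%E.
Proof.
move=> [oU cU _]; have [C C0 HC] := compact_coord_bounded cU.
have sub : pp @^-1` U `<=` `]-C, C[%classic `*` `]-C, C[%classic.
  move=> z Uz; have Hz := HC (pp z) (@subset_closure _ U _ Uz).
  split; rewrite /= in_itv/= -ltr_norml.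
    by have := Hz 0; rewrite mxE.
  by have := Hz 1; rewrite mxE.
have mR : measurable (`]-C, C[%classic `*` `]-C, C[%classic) by exact: measurableX.
have := @le_measure _ _ _ mu2 _ _ (mem_set (measurable_plane_open oU)) (mem_set mR) sub.
move=> /le_lt_trans; apply.
have E := @product_measure1E _ _ _ _ R (@lebesgue_measure R) (@lebesgue_measure R)
  `]-C, C[%classic `]-C, C[%classic (measurable_itv _) (measurable_itv _).
rewrite [ltLHS]E.
have mI : lebesgue_measure (`]-C, C[%classic : set R) = (C - - C)%:E.
  by rewrite lebesgue_measure_itv/= lte_fin gtrN// EFinB.
have : ((C - - C)%:E * (C - - C)%:E < +oo)%E by rewrite -EFinM ltry.
by rewrite -mI.
Qed.

Lemma plane_integrable (D U : set 'rV[R]_2) (f : 'rV[R]_2 -> R) :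
  relatively_compact_open D U -> (forall x, D x -> {for x, continuous f}) ->
  mu2.-integrable (pp @^-1` U) (EFin \o (f \o pp)).
Proof.
move=> rU cf; have [oU cU UD] := rU.
apply: measurable_bounded_integrable; first exact: measurable_plane_open.
- exact: plane_finite rU.
- by apply: measurable_plane_fun => // x /subset_closure/UD/cf.
have [C C0 HC] := compact_cont_bounded cU (fun x Ux => cf x (UD x Ux)).
exists C; split; first exact: num_real.
move=> M CM z Uz /=; rewrite (le_trans (HC _ _)) ?ltW//.
exact: (@subset_closure _ U).
Qed.

End Plane.

Lemma smU (R : realType) (V : normedModType R) (D E : set V) (f : V -> R) :
  sm D f -> sm E f -> sm (D `|` E) f.
Proof.
move=> /class_CP sD /class_CP sE; apply/class_CP => n.
elim: n (f : V -> R^o) (sD n) (sE n) => [|n ih] g cD cE.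
  by split => // x [Dx|Ex]; [exact: class_C_diff cD Dx|exact: class_C_diff cE Ex].
split => [x [Dx|Ex]|v].
- exact: class_C_diff cD Dx.
- exact: class_C_diff cE Ex.
exact: ih (class_C_D v cD) (class_C_D v cE).
Qed.

Section PlaneDivergence.
Context {R : realType}.
Notation pp := (@plane_point R).
Local Notation mu := (@lebesgue_measure R).
Local Notation mu2 := (mu \x mu)%E.

(** Extension by zero is smooth on [D], where it agrees with [phi], and on the complement of
    [closure U], where it is constant; these two open sets cover the plane since [closure U] lies in
    [D]. *)
Lemma zero_extension (D U : set 'rV[R]_2) (phi : 'rV[R]_2 -> R) :
  open D -> relatively_compact_open D U -> sm D phi ->
  (forall x, D x -> ~ U x -> phi x = 0) ->
  exists f : 'rV[R]_2 -> R, [/\ sm setT f, forall x, D x -> f x = phi x &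
    forall x, ~ U x -> f x = 0].
Proof.
move=> oD [oU cU UD] sphi phi0.
pose f x := if `[< U x >] then phi x else 0.
have fD x : D x -> f x = phi x.
  by move=> Dx; rewrite /f; case: asboolP => // Ux; rewrite phi0.
have fU x : ~ U x -> f x = 0 by move=> Ux; rewrite /f asboolF.
have oC : open (~` closure U) by apply: closed_openC; exact: closed_closure.
exists f; split => //.
rewrite (_ : setT = D `|` ~` closure U); last first.
  apply/seteqP; split => // x _.
  by have [/UD|] := EM (closure U x); [left|right].
apply: smU; first by apply: (sm_eq oD _ sphi) => x Dx; rewrite fD.
apply: (@sm_eq _ _ _ (fun=> 0) _ oC); last exact: sm_cst.
by move=> x Cx; rewrite fU// => Ux; apply: Cx; exact: subset_closure.
Qed.

Lemma plane_point_line (x y : R) :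
  pp (x, y) = pp (0, y) + x *: delta_mx 0 0 /\
  pp (x, y) = pp (x, 0) + y *: delta_mx 0 1.
Proof.
split; apply/rowP => -[[|[|//]] j]; rewrite !mxE /= ?(mulr1, mulr0, addr0, add0r)//.
Qed.

Lemma line_continuous (a b : 'rV[R]_2) : continuous (fun t : R => a + t *: b).
Proof.
move=> t; apply: cvgD; first exact: cvg_cst.
exact: scalel_continuous.
Qed.

Lemma integral_line0 (U : set 'rV[R]_2) (f : 'rV[R]_2 -> R) (a e : 'rV[R]_2)
  (C : R) : 0 < C -> open U -> sm setT f -> (forall x, ~ U x -> f x = 0) ->
  (forall t : R, U (a + t *: e) -> `|t| < C) ->
  (\int[mu]_(t in [set t : R | U (a + t *: e)%R]) (pd e f (a + t *: e)%R)%:E = 0)%E.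
Proof.
move=> C0 oU sf f0 HC.
apply: (@integral_derive_supp _ _ (fun t => f (a + t *: e)) _ (- C) C).
- by rewrite gtrN.
- apply: open_measurable; apply: (@open_comp _ _ (fun t : R => a + t *: e)) => //.
  by move=> t _; exact: line_continuous.
- by move=> t /= /HC; rewrite in_itv/= -ltr_norml.
- move=> t; apply: (@is_derive_line R _ _ (f : _ -> R^o)).
  exact/diff_derivable/(sm_diff sf).
- move=> t; apply: (@continuous_comp _ _ _ (fun t : R => a + t *: e) (pd e f)).
    exact: line_continuous.
  exact/differentiable_continuous/(sm_diff (sm_pd e sf)).
- by move=> t /=; exact: f0.
Qed.

(** Fubini with the integration along axis [i] done first, then [integral_line0] on each line. This
    is the divergence theorem for fields that vanish off [U]. *)
Lemma integral_pd0 (D U : set 'rV[R]_2) (phi : 'rV[R]_2 -> R) (i : 'I_2) :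
  open D -> relatively_compact_open D U -> sm D phi ->
  (forall x, D x -> ~ U x -> phi x = 0) ->
  \int[mu2]_(z in pp @^-1` U) pd (delta_mx 0 i) phi (pp z) = 0.
Proof.
move=> oD rU sphi phi0; have [oU cU UD] := rU.
have [f [sf fD fU]] := zero_extension oD rU sphi phi0.
pose e : 'rV[R]_2 := delta_mx 0 i.
have -> : \int[mu2]_(z in pp @^-1` U) pd e phi (pp z) =
          \int[mu2]_(z in pp @^-1` U) pd e f (pp z).
  apply: eq_Rintegral => z; rewrite inE => /= Uz.
  apply: (pd_eq _ oD); first exact/UD/(@subset_closure _ U).
  by move=> x Dx; rewrite fD.
rewrite /Rintegral.
suff -> : (\int[mu2]_(z in pp @^-1` U) (pd e f (pp z))%:E = 0)%E by [].
have [C C0 HC] := compact_coord_bounded cU.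
pose F := (fun z => (pd e f (pp z))%:E) \_ (pp @^-1` U).
have iF : mu2.-integrable setT F.
  have iU : mu2.-integrable (pp @^-1` U) (EFin \o (pd e f \o pp)).
    apply: (@plane_integrable _ _ _ (pd e f) rU) => x _.
    exact/differentiable_continuous/(sm_diff (sm_pd e sf)).
  have := @integrable_mkcond _ _ R mu2 (pp @^-1` U) (EFin \o (pd e f \o pp))
    (measurable_plane_open oU).
  by case=> + _; apply.
rewrite integral_mkcond -/F.
have HU x j : U x -> `|x 0 j| < C by move=> Ux; apply: HC; exact: subset_closure.
have [i0|i1] : i = 0 \/ i = 1.
  by case: (i) => -[|[|//]] j; [left|right]; exact: val_inj.
- rewrite -(integral21_prod_meas1 iF) /fubini_G.
  rewrite integral0_eq// => y _.
  have E : forall x, pp (x, y) = pp (0, y) + x *: e.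
    by move=> x; rewrite /e i0; have [] := plane_point_line x y.
  rewrite -[RHS](@integral_line0 U f (pp (0, y)) e C)//; last first.
    by move=> t; rewrite -E => /HU -/(_ 0); rewrite mxE.
  rewrite [RHS]integral_mkcond; apply: eq_integral => x _.
  rewrite /F !patchE -(E x) /=; congr (if _ then _ else _);
    by apply/idP/idP; rewrite !inE /= -(E x).
- rewrite -(integral12_prod_meas1 iF) /fubini_F.
  rewrite integral0_eq// => x _.
  have E : forall y, pp (x, y) = pp (x, 0) + y *: e.
    by move=> y; rewrite /e i1; have [] := plane_point_line x y.
  rewrite -[RHS](@integral_line0 U f (pp (x, 0)) e C)//; last first.
    by move=> t; rewrite -E => /HU -/(_ 1); rewrite mxE.
  rewrite [RHS]integral_mkcond; apply: eq_integral => y _.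
  rewrite /F !patchE -(E y) /=; congr (if _ then _ else _);
    by apply/idP/idP; rewrite !inE /= -(E y).
Qed.

End PlaneDivergence.

(** * Differentiation under the integral sign *)

Section TimeDerivative.
Context {R : realType}.
Notation pp := (@plane_point R).
Local Notation mu := (@lebesgue_measure R).
Local Notation mu2 := (mu \x mu)%E.
Local Notation V := (R^o * 'rV[R]_2)%type.

Definition tau : V := (1, 0).

Definition spacetime (e : R) (D : set 'rV[R]_2) : set V :=
  [set p | `|p.1| < e /\ D p.2].

Lemma near_norm_lt (t e : R) : `|t| < e -> \forall s \near t, `|s| < e.
Proof.
move=> te; have : t \in `]- e, e[ by rewrite in_itv/= -ltr_norml.
by move=> /near_in_itvoo; apply: filterS => s; rewrite in_itv/= -ltr_norml.
Qed.

Lemma open_spacetime e D : open D -> open (spacetime e D).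
Proof.
move=> oD; rewrite openE => -[t x] [/= te Dx].
exists ([set s : R^o | `|s| < e], D) => //=; split.
  exact: near_norm_lt te.
exact: near_open oD Dx (fun y Dy => Dy).
Qed.

Lemma slice_is_derive (e : R) D (J : V -> R) (t : R) (x : 'rV[R]_2) :
  sm (spacetime e D) J -> `|t| < e -> D x ->
  is_derive t (1 : R) (fun s => J (s, x)) (pd tau J (t, x)).
Proof.
move=> sJ te Dx.
have E s : (s, x) = ((0, x) : V) + s *: tau.
  by rewrite /tau /=; congr (_, _) => /=; rewrite ?add0r ?scaler0 ?addr0 // [_ *: _]mulr1.
have -> : (fun s => J (s, x)) = (fun s => J (((0, x) : V) + s *: tau)).
  by apply/funext => s; rewrite E.
rewrite (E t); apply: (@is_derive_line R _ _ (J : V -> R^o)); rewrite -(E t).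
by apply/diff_derivable/(sm_diff sJ).
Qed.

Lemma slice_continuous (e : R) D (J : V -> R) (t : R) (x : 'rV[R]_2) :
  sm (spacetime e D) J -> `|t| < e -> D x -> {for x, continuous (fun y => J (t, y))}.
Proof.
move=> sJ te Dx; apply: (@continuous_comp _ _ _ (fun y : 'rV[R]_2 => (t, y) : V) J).
  have : differentiable (fun y : 'rV[R]_2 => (cst (t : R^o) y, id y) : V) x.
    by apply: differentiable_pair; [exact: differentiable_cst|exact: ex_diff].
  exact: differentiable_continuous.
by apply: differentiable_continuous; apply: (sm_diff sJ).
Qed.

Lemma derive_integral (D U : set 'rV[R]_2) (e : R) (J : V -> R) :
  relatively_compact_open D U -> sm (spacetime e D) J ->
  let B := fun t : R => \int[mu2]_(z in pp @^-1` U) J (t, pp z) in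
  forall t, `|t| < e -> derivable B t 1 /\
    B^`()%classic t = \int[mu2]_(z in pp @^-1` U) pd tau J (t, pp z).
Proof.
move=> rU sJ B t te; have [oU cU UD] := rU.
(* A smaller time interval around 0 that still contains [t]: the time derivative is bounded on the
   compact set [K], and its bound [C] serves as the dominating function. *)
pose e' := (`|t| + e) / 2.
have te' : `|t| < e' by rewrite /e' midf_lt.
have e'e : e' < e by rewrite /e' midf_lt.
have e'0 : 0 < e' by rewrite (le_lt_trans _ te').
pose K : set V := `[- e', e']%classic `*` closure U.
have cK : compact K by apply: compact_setX => //; exact: segment_compact.
have KS : K `<=` spacetime e D.
  move=> p [/=]; rewrite in_itv/= -ler_norml => p1 p2; split; last exact: UD.
  exact: le_lt_trans e'e.
have [C C0 HC] := compact_cont_bounded cK (fun p Kp =>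
  differentiable_continuous (sm_diff (sm_pd tau sJ) (KS p Kp))).
pose f (s : R) (z : R * R) := J (s, pp z).
have Dz z : (pp @^-1` U) z -> D (pp z) by move=> Uz; apply/UD/(@subset_closure _ U).
have It : `]- e', e'[%classic t by rewrite /= in_itv/= -ltr_norml.
have intf s : `]- e', e'[%classic s -> mu2.-integrable (pp @^-1` U) (EFin \o f s).
  rewrite /= in_itv/= -ltr_norml => se'.
  apply: (@plane_integrable _ D U (fun x => J (s, x)) rU) => x Dx.
  exact: slice_continuous sJ (lt_trans se' e'e) Dx.
have sd s z : `]- e', e'[%classic s -> (pp @^-1` U) z ->
    is_derive s (1 : R) (f ^~ z) (pd tau J (s, pp z)).
  rewrite /= in_itv/= -ltr_norml => se' Uz.
  exact: slice_is_derive sJ (lt_trans se' e'e) (Dz _ Uz).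
have df s z : `]- e', e'[%classic s -> (pp @^-1` U) z -> derivable (f ^~ z) s 1.
  by move=> Is Uz; have [] := sd s z Is Uz.
have d1E s z : `]- e', e'[%classic s -> (pp @^-1` U) z ->
    partial1of2 f s z = pd tau J (s, pp z).
  by move=> Is Uz; rewrite partial1of2E; have [_ ->] := sd s z Is Uz.
have mU := measurable_plane_open oU.
have iC : mu2.-integrable (pp @^-1` U) (EFin \o (fun=> C)).
  by apply: (@plane_integrable _ D U (fun=> C) rU) => x Dx; exact: cst_continuous.
have bd s z : `]- e', e'[%classic s -> (pp @^-1` U) z -> `|partial1of2 f s z| <= C.
  move=> Is Uz; rewrite d1E//; apply: HC; split; last exact: (@subset_closure _ U).
  exact: subset_itv_oo_cc Is.
have C0' : (R * R)%type -> 0 <= C by move=> _; exact: ltW.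
split.
  exact: (@derivable_under_integral R _ _ mu2 f _ mU t (- e') e' It intf df _ C0' iC bd).
rewrite (@differentiation_under_integral R _ _ mu2 f _ mU t (- e') e' It intf df _ C0' iC bd).
by apply: eq_Rintegral => z; rewrite inE => Uz; rewrite d1E.
Qed.

(** [A] is only known for [|t| < e], so each derivative is transferred through equality near the
    point. *)
Lemma derive2_integral (D U : set 'rV[R]_2) (e : R) (J : V -> R) (A : R -> R^o) :
  0 < e -> relatively_compact_open D U -> sm (spacetime e D) J ->
  (forall t, `|t| < e -> A t = \int[mu2]_(z in pp @^-1` U) J (t, pp z)) ->
  [/\ \forall t \near (0 : R), derivable A t 1, derivable (derive1 A) 0 1 &
    derive1n 2 A 0 = \int[mu2]_(z in pp @^-1` U) pd tau (pd tau J) (0, pp z)].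
Proof.
move=> e0 rU sJ AE.
pose B t : R^o := \int[mu2]_(z in pp @^-1` U) J (t, pp z).
pose B1 t : R^o := \int[mu2]_(z in pp @^-1` U) pd tau J (t, pp z).
have BD := derive_integral rU sJ; have B1D := derive_integral rU (sm_pd tau sJ).
have nr t : `|t| < e -> \forall s \near t, `|s| < e := @near_norm_lt t e.
have AB t : `|t| < e -> \near t, B t = A t.
  by move=> te; apply: filterS (nr t te) => s se; rewrite AE.
have AD t : `|t| < e -> derivable A t 1 /\ A^`()%classic t = B1 t.
  move=> te; have [d1 d2] := BD t te; split.
    exact: near_eq_derivable (AB t te) d1.
  by rewrite derive1E -(near_eq_derive _ (AB t te)) -derive1E.
have n0 : `|0 : R| < e by rewrite normr0.
split.
- by apply: filterS (nr 0 n0) => s /AD[].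
- have nA : \forall s \near (0 : R), B1 s = A^`()%classic s.
    by apply: filterS (nr 0 n0) => s /AD[_ ->].
  by apply: near_eq_derivable nA _; have [] := B1D 0 n0.
- have nA : \forall s \near (0 : R), B1 s = A^`()%classic s.
    by apply: filterS (nr 0 n0) => s /AD[_ ->].
  rewrite derive1Sn derive1n1 derive1E -(near_eq_derive _ nA) -derive1E.
  by have [] := B1D 0 n0.
Qed.

End TimeDerivative.

Section Slice.
Context {R : realType}.
Local Notation V2 := 'rV[R]_2.
Local Notation V := (R^o * V2)%type.

Definition space_dir (v : V2) : V := (0, v).

Lemma pd_slice (J : V -> R) t x (v : V2) :
  pd v (fun y => J (t, y)) x = pd (space_dir v) J (t, x).
Proof.
rewrite /pd /derive.
rewrite (_ : (fun h : R => h^-1 *: (((J : V -> R^o) \o shift ((t, x) : V)) (h *: space_dir v) -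
      (J (t, x) : R^o))) =
    (fun h : R => h^-1 *: (((fun y => J (t, y) : R^o) \o shift x) (h *: v) - (J (t, x) : R^o)))) //.
apply/funext => h /=; congr (_ *: (J _ - _)); rewrite /space_dir; congr (_, _) => /=.
by rewrite scaler0 add0r.
Qed.

End Slice.

(** * The regularisation error and its limit *)

Section Weight.
Context {R : realType}.
Notation pp := (@plane_point R).
Local Notation mu := (@lebesgue_measure R).
Local Notation mu2 := (mu \x mu)%E.

(* The price of replacing |Phi| = sqrt s by sqrt (s + eps^2). *)
Definition weight (eps s : R) : R :=
  eps ^+ 2 * Num.sqrt s / Num.sqrt (s + eps ^+ 2) ^+ 3.

Lemma weight_ge0 eps s : 0 <= weight eps s.
Proof.
apply: divr_ge0; last by rewrite exprn_ge0 ?sqrtr_ge0.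
by apply: mulr_ge0; rewrite ?sqr_ge0 ?sqrtr_ge0.
Qed.

Lemma weight_le1 eps s : 0 < eps -> 0 <= s -> weight eps s <= 1.
Proof.
move=> e0 s0; have r0 : 0 < s + eps ^+ 2 by rewrite ltr_wpDl// exprn_gt0.
rewrite /weight ler_pdivrMr ?exprn_gt0 ?sqrtr_gt0// mul1r [_ ^+ 3]exprSr.
rewrite sqr_sqrtr ?(ltW r0)//; apply: ler_pM; [exact: sqr_ge0|exact: sqrtr_ge0|by rewrite lerDr|].
by apply: ler_wsqrtr; rewrite lerDl sqr_ge0.
Qed.

Lemma weight_le eps s : 0 < eps -> 0 < s -> weight eps s <= eps ^+ 2 / s.
Proof.
move=> e0 s0; have r0 : 0 < s + eps ^+ 2 by rewrite ltr_wpDl ?exprn_gt0 ?ltW.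
rewrite /weight ler_pdivrMr ?exprn_gt0 ?sqrtr_gt0// -[leRHS]mulrA ler_wpM2l ?sqr_ge0//.
rewrite ler_pdivlMl// [_ ^+ 3]exprSr sqr_sqrtr ?(ltW r0)//.
apply: ler_pM; [exact: ltW|exact: sqrtr_ge0|by rewrite lerDl sqr_ge0|].
by apply: ler_wsqrtr; rewrite lerDl sqr_ge0.
Qed.

Lemma weight_cvg0 s : 0 <= s -> weight n.+1%:R^-1 s @[n --> \oo] --> 0.
Proof.
(* At [s = 0] the weight vanishes for every [n], thanks to the factor [Num.sqrt s]; for [s > 0] it
   is squeezed by [eps ^+ 2 / s]. *)
rewrite le_eqVlt => /predU1P[<-|s0].
  by rewrite /weight sqrtr0; under eq_fun do rewrite mulr0 mul0r; exact: cvg_cst.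
have c2 : (n.+1%:R^-1 ^+ 2 / s) @[n --> \oo] --> (0 : R).
  have h := @cvg_harmonic R; have := cvgM (cvgM h h) (cvg_cst s^-1).
  by rewrite !mul0r; apply.
apply: (@squeeze_cvgr _ _ _ _ (cst 0) _ _ _ _ _ c2); last exact: cvg_cst.
by apply: nearW => n; rewrite weight_ge0 weight_le// invr_gt0.
Qed.

Lemma weight_continuous eps (s : 'rV[R]_2 -> R) x : 0 < eps -> 0 <= s x ->
  {for x, continuous s} -> {for x, continuous (fun y => weight eps (s y))}.
Proof.
move=> e0 sx cs; have r0 : 0 < s x + eps ^+ 2 by rewrite ltr_wpDl// exprn_gt0.
have c1 : {for x, continuous (fun y => Num.sqrt (s y))}.
  by apply: (continuous_comp cs); exact: sqrt_continuous.
have c2 : {for x, continuous (fun y => Num.sqrt (s y + eps ^+ 2))}.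
  have c0 : {for x, continuous (fun y => s y + eps ^+ 2)}.
    by apply: (@continuousD _ _ _ s (cst (eps ^+ 2))) => //; exact: cst_continuous.
  by apply: (continuous_comp c0); exact: sqrt_continuous.
have c3 : {for x, continuous (fun y => (Num.sqrt (s y + eps ^+ 2) ^+ 3)^-1)}.
  apply: continuousV; first by rewrite expf_neq0// gt_eqF// sqrtr_gt0.
  apply: (@continuous_comp _ _ _ _ (fun r : R => r ^+ 3) _ c2).
  exact: exprn_continuous.
have c4 : {for x, continuous (fun y => eps ^+ 2 * Num.sqrt (s y))}.
  by apply: (@continuousM _ _ (cst (eps ^+ 2))) => //; exact: cst_continuous.
exact: continuousM c4 c3.
Qed.

Lemma integral_weight_cvg0 (D U : set 'rV[R]_2) (s : 'rV[R]_2 -> R) :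
  relatively_compact_open D U -> (forall x, D x -> 0 <= s x) ->
  (forall x, D x -> {for x, continuous s}) ->
  \int[mu2]_(z in pp @^-1` U) weight n.+1%:R^-1 (s (pp z)) @[n --> \oo] --> 0.
Proof.
move=> rU s0 cs; have [oU cU UD] := rU.
have Dz z : (pp @^-1` U) z -> D (pp z) by move=> Uz; apply/UD/(@subset_closure _ U).
have e0 n : 0 < n.+1%:R^-1 :> R by rewrite invr_gt0.
have iw n : mu2.-integrable (pp @^-1` U) (EFin \o (fun z => weight n.+1%:R^-1 (s (pp z)))).
  apply: (@plane_integrable _ D U (fun x => weight n.+1%:R^-1 (s x)) rU) => x Dx.
  by apply: weight_continuous => //; [exact: s0|exact: cs].
have i1 : mu2.-integrable (pp @^-1` U) (EFin \o (fun=> 1 : R)).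
  by apply: (@plane_integrable _ D U (fun=> 1) rU) => x Dx; exact: cst_continuous.
pose w n (z : R * R) := (weight n.+1%:R^-1 (s (pp z)))%:E.
have wc : {ae mu2, forall z, (pp @^-1` U) z -> w n z @[n --> \oo] --> 0%E}.
  apply: aeW => z Uz; apply/fine_cvgP; split; first exact: nearW.
  exact/weight_cvg0/s0/Dz.
have wb : {ae mu2, forall z n, (pp @^-1` U) z -> (`|w n z| <= 1)%E}.
  apply: aeW => z n Uz /=; rewrite lee_fin ger0_norm ?weight_ge0//.
  exact: weight_le1 (e0 n) (s0 _ (Dz _ Uz)).
have [_ _] := @dominated_convergence _ _ R mu2 _ (measurable_plane_open oU)
  w (cst 0%E) (EFin \o (fun=> 1)) (fun n => measurable_int mu2 (iw n))
  (measurable_cst _) wc i1 wb.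
rewrite integral_cst ?mul0e; last exact: measurable_plane_open.
exact: fine_cvg.
Qed.

End Weight.

(** * The second variation of the area as a quadratic form *)

Lemma isder_sqr (R : realType) (V : normedModType R) (f : V -> R) v x df :
  isder x v f df -> isder x v (fun y => f y ^+ 2) (2 * f x * df).
Proof.
move=> fd; have := isderM fd fd; have -> : df * f x + f x * df = 2 * f x * df by ring.
by [].
Qed.

(* Unification would otherwise compare the limits defining derivatives. *)
Opaque pd.

Ltac sm_solve :=
  repeat lazymatch goal with
    | |- sm _ (fun _ => ?c) => apply: sm_cst
    | |- sm _ (fun y => _ ^+ _) => apply: smX; first assumption
    | |- sm _ (fun y => _ + - _) => apply: smB; first assumption
    | |- sm _ (fun y => _ + _) => apply: smD; first assumption
    | |- sm _ (fun y => - _) => apply: smN; first assumption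
    | |- sm _ (fun y => _ * _) => apply: smM; first assumption
    | |- sm _ (pd _ _) => apply: sm_pd
    | |- sm _ (fun y => pd _ _ y) => apply: sm_pd
    | |- sm _ _ => assumption
    end.

(** The derivative may be an existential variable, which the rules fill in; [field] or [ring]
    compares it afterwards with the expected expression. *)
Ltac isder_solve :=
  repeat lazymatch goal with
    | |- isder _ _ (fun _ => ?c) _ => apply: isder_cst
    | |- isder _ _ (fun y => _ ^+ 2) _ => apply: isder_sqr
    | |- isder _ _ (fun y => _ + - _) _ => apply: isderB
    | |- isder _ _ (fun y => _ + _) _ => apply: isderD
    | |- isder _ _ (fun y => - _) _ => apply: isderN
    | |- isder _ _ (fun y => _ * _) _ => apply: isderM
    | |- isder _ _ (fun y => (_)^-1) _ => apply: isderV; first assumption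
    | |- isder _ _ (fun y => ?f y) _ =>
        apply: (isder_sm (f := f)); [sm_solve|eassumption]
    | |- isder _ _ ?f _ => apply: (isder_sm (f := f)); [sm_solve|eassumption]
    end.

(** Certificate for an identity that holds modulo [A = 0] and [B = 0]: the multipliers [z1], [z2]
    are supplied by hand, and what remains is a matter for [field]. *)
Lemma lin_comb2 (R : realType) (z1 z2 T A B : R) :
  A = 0 -> B = 0 -> T = z1 * A + z2 * B -> T = 0.
Proof. by move=> -> -> ->; rewrite !mulr0 addr0. Qed.

Ltac subst_lhs H :=
  let t := type of H in
  match t with ?l = _ => revert H; generalize l; intros ? -> end.

Ltac subst_by H := let E := fresh in pose proof H as E; subst_lhs E.

Ltac gen_pd :=
  repeat match goal with |- context [pd ?v ?f ?x] => generalize (pd v f x); intro end.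
Ltac gen_at f x := generalize (f x); intro.

Section SecondVariation.
Context {R : realType}.
Local Notation V2 := 'rV[R]_2.
Definition d0 (f : V2 -> R) := pd (delta_mx 0 0) f.
Definition d1 (f : V2 -> R) := pd (delta_mx 0 1) f.

Variables (D : set V2) (g11 g12 g22 P11 P12 P22 X1 X2 Y1 Y2 : V2 -> R).

Definition lie11 x := X1 x * d0 g11 x + X2 x * d1 g11 x +
  2 * (d0 X1 x * g11 x + d0 X2 x * g12 x).
Definition lie12 x := X1 x * d0 g12 x + X2 x * d1 g12 x +
  (d0 X1 x * g12 x + d0 X2 x * g22 x) + (d1 X1 x * g11 x + d1 X2 x * g12 x).
Definition lie22 x := X1 x * d0 g22 x + X2 x * d1 g22 x +
  2 * (d1 X1 x * g12 x + d1 X2 x * g22 x).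

(** Half the trace of the Lie derivative of g against P. For P = sqrt(det G) G^-1 this is the first
    derivative of the area density. *)
Definition trace_lie x := 2^-1 * (P11 x * lie11 x + 2 * (P12 x * lie12 x) + P22 x * lie22 x).

(** The flow of X has acceleration X . grad X, and Z is the excess of Y over it. The second
    derivative of the pullback is then the Lie derivative of g along Z plus its twice iterated Lie
    derivative along X. *)
Definition Z1 x := Y1 x - (X1 x * d0 X1 x + X2 x * d1 X1 x).
Definition Z2 x := Y2 x - (X1 x * d0 X2 x + X2 x * d1 X2 x).

Definition flux1 x := (P11 x * g11 x + P12 x * g12 x) * Z1 x +
  (P11 x * g12 x + P12 x * g22 x) * Z2 x + X1 x * trace_lie x.
Definition flux2 x := (P12 x * g11 x + P22 x * g12 x) * Z1 x +
  (P12 x * g12 x + P22 x * g22 x) * Z2 x + X2 x * trace_lie x.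

(* Second derivative at t = 0 of the pullback of g by x + t X + t^2/2 Y. *)
Definition pull2_11 x := Y1 x * d0 g11 x + Y2 x * d1 g11 x +
  2 * (d0 Y1 x * g11 x + d0 Y2 x * g12 x) +
  (X1 x * X1 x * d0 (d0 g11) x + 2 * (X1 x * X2 x * d0 (d1 g11) x) + X2 x * X2 x * d1 (d1 g11) x) +
  4 * (d0 X1 x * (X1 x * d0 g11 x + X2 x * d1 g11 x) + d0 X2 x * (X1 x * d0 g12 x + X2 x * d1 g12 x)) +
  2 * (d0 X1 x * d0 X1 x * g11 x + 2 * (d0 X1 x * d0 X2 x * g12 x) + d0 X2 x * d0 X2 x * g22 x).
Definition pull2_22 x := Y1 x * d0 g22 x + Y2 x * d1 g22 x +
  2 * (d1 Y1 x * g12 x + d1 Y2 x * g22 x) +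
  (X1 x * X1 x * d0 (d0 g22) x + 2 * (X1 x * X2 x * d0 (d1 g22) x) + X2 x * X2 x * d1 (d1 g22) x) +
  4 * (d1 X1 x * (X1 x * d0 g12 x + X2 x * d1 g12 x) + d1 X2 x * (X1 x * d0 g22 x + X2 x * d1 g22 x)) +
  2 * (d1 X1 x * d1 X1 x * g11 x + 2 * (d1 X1 x * d1 X2 x * g12 x) + d1 X2 x * d1 X2 x * g22 x).
Definition pull2_12 x := Y1 x * d0 g12 x + Y2 x * d1 g12 x +
  (d0 Y1 x * g12 x + d0 Y2 x * g22 x) + (d1 Y1 x * g11 x + d1 Y2 x * g12 x) +
  (X1 x * X1 x * d0 (d0 g12) x + 2 * (X1 x * X2 x * d0 (d1 g12) x) + X2 x * X2 x * d1 (d1 g12) x) +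
  2 * (d0 X1 x * (X1 x * d0 g12 x + X2 x * d1 g12 x) + d0 X2 x * (X1 x * d0 g22 x + X2 x * d1 g22 x)) +
  2 * (d1 X1 x * (X1 x * d0 g11 x + X2 x * d1 g11 x) + d1 X2 x * (X1 x * d0 g12 x + X2 x * d1 g12 x)) +
  2 * (d0 X1 x * d1 X1 x * g11 x + (d0 X1 x * d1 X2 x + d0 X2 x * d1 X1 x) * g12 x
       + d0 X2 x * d1 X2 x * g22 x).

(* The Lie derivative of the contravariant tensor density P along X. *)
Definition lieP11 x := X1 x * d0 P11 x + X2 x * d1 P11 x -
  2 * (d0 X1 x * P11 x + d1 X1 x * P12 x) + (d0 X1 x + d1 X2 x) * P11 x.
Definition lieP12 x := X1 x * d0 P12 x + X2 x * d1 P12 x -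
  (d0 X1 x * P12 x + d1 X1 x * P22 x) - (d0 X2 x * P11 x + d1 X2 x * P12 x) +
  (d0 X1 x + d1 X2 x) * P12 x.
Definition lieP22 x := X1 x * d0 P22 x + X2 x * d1 P22 x -
  2 * (d0 X2 x * P12 x + d1 X2 x * P22 x) + (d0 X1 x + d1 X2 x) * P22 x.

(* The divergence of the stress tensor of the metric g with respect to the
   conformal structure P vanishes: d_i(P^ik g_kl) = 1/2 P^ij d_l g_ij. *)
Definition stress_free x :=
  d0 P11 x * g11 x + P11 x * d0 g11 x + d0 P12 x * g12 x + P12 x * d0 g12 x +
  (d1 P12 x * g11 x + P12 x * d1 g11 x + d1 P22 x * g12 x + P22 x * d1 g12 x) =
  2^-1 * (P11 x * d0 g11 x + 2 * (P12 x * d0 g12 x) + P22 x * d0 g22 x) /\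
  d0 P11 x * g12 x + P11 x * d0 g12 x + d0 P12 x * g22 x + P12 x * d0 g22 x +
  (d1 P12 x * g12 x + P12 x * d1 g12 x + d1 P22 x * g22 x + P22 x * d1 g22 x) =
  2^-1 * (P11 x * d1 g11 x + 2 * (P12 x * d1 g12 x) + P22 x * d1 g22 x).

Hypotheses (oD : open D) (sg11 : sm D g11) (sg12 : sm D g12) (sg22 : sm D g22)
  (sP11 : sm D P11) (sP12 : sm D P12) (sP22 : sm D P22)
  (sX1 : sm D X1) (sX2 : sm D X2) (sY1 : sm D Y1) (sY2 : sm D Y2).

(** Write the second derivative of the pullback as L_Z g + L_X L_X g. By [stress_free], half of P :
    L_Z g is the divergence of P g Z. Since P is a density, P : L_X g transforms like a 2-form, so
    half of P : L_X L_X g is the divergence of X times [trace_lie], minus half of (L_X P) : L_X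
    g. *)
Lemma half_trace_pull2 x : D x -> stress_free x ->
  2^-1 * (P11 x * pull2_11 x + 2 * (P12 x * pull2_12 x) + P22 x * pull2_22 x) =
  d0 flux1 x + d1 flux2 x -
  2^-1 * (lieP11 x * lie11 x + 2 * (lieP12 x * lie12 x) + lieP22 x * lie22 x).
Proof.
move=> Dx [E1 E2].
have C f : sm D f -> pd (delta_mx 0 1) (pd (delta_mx 0 0) f) x =
    pd (delta_mx 0 0) (pd (delta_mx 0 1) f) x by exact: pd_comm.
have: exists2 d, isder x (delta_mx 0 0) flux1 d &
      exists2 d', isder x (delta_mx 0 1) flux2 d' &
  2^-1 * (P11 x * pull2_11 x + 2 * (P12 x * pull2_12 x) + P22 x * pull2_22 x) =
  d + d' -
  2^-1 * (lieP11 x * lie11 x + 2 * (lieP12 x * lie12 x) + lieP22 x * lie22 x).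
  eexists.
    rewrite /flux1 /Z1 /Z2 /trace_lie /lie11 /lie12 /lie22 /d0 /d1.
    by isder_solve.
  eexists.
    rewrite /flux2 /Z1 /Z2 /trace_lie /lie11 /lie12 /lie22 /d0 /d1.
    by isder_solve.
  move: E1 E2; rewrite /pull2_11 /pull2_12 /pull2_22 /lieP11 /lieP12 /lieP22.
  rewrite /lie11 /lie12 /lie22 /d0 /d1.
  have C1 := C _ sg11; have C2 := C _ sg12; have C3 := C _ sg22.
  have C4 := C _ sX1; have C5 := C _ sX2.
  subst_lhs C1; subst_lhs C2; subst_lhs C3; subst_lhs C4; subst_lhs C5.
  set e0 := delta_mx 0 0; set e1 := delta_mx 0 1.
  move=> /eqP; rewrite -subr_eq0 => /eqP E1 /eqP; rewrite -subr_eq0 => /eqP E2.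
  apply/eqP; rewrite -subr_eq0; apply/eqP.
  (* The multipliers are the components of - Z, because the stress equations are only used on the
     divergence of P g Z. *)
  apply: (@lin_comb2 R (- (Y1 x - (X1 x * pd e0 X1 x + X2 x * pd e1 X1 x)))
    (- (Y2 x - (X1 x * pd e0 X2 x + X2 x * pd e1 X2 x))) _ _ _ E1 E2).
  clear; gen_pd; gen_at g11 x; gen_at g12 x; gen_at g22 x; gen_at P11 x; gen_at P12 x.
  gen_at P22 x; gen_at X1 x; gen_at X2 x; gen_at Y1 x; gen_at Y2 x.
  by clear; intros; field.
by move=> [d [_ <-] [d' [_ <-] ->]].
Qed.
End SecondVariation.

(* A final 0 or 1 denotes a partial derivative: a0 stands for d_0 a, m10 for
   d_0 m1, X21 for d_1 X2. *)
Section Jets.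
Variables (R : realType) (m1 m2 u e a b m10 m11 m20 m21 e0 e1 a0 a1 b0 b1
  X1 X2 X10 X11 X20 X21 : R).
Hypotheses (m2n : m2 != 0) (un : u != 0).

(** With m = m1 + i m2, Phi = a + i b and dz = dx + m dy, this is g = (e / m2) |dz|^2 - Re(Phi
    dz^2). Below, [P11], [P12], [P22] form the inverse of |dz|^2 times the square root of its
    determinant. *)
Let g11 := e / m2 - a.
Let g12 := e * m1 / m2 - (a * m1 - b * m2).
Let g22 := e * (m1 ^+ 2 + m2 ^+ 2) / m2 - (a * (m1 ^+ 2 - m2 ^+ 2) - 2 * b * m1 * m2).
Let dg11 de dm2 da := de / m2 - e * dm2 / m2 ^+ 2 - da.
Let dg12 de dm1 dm2 da db := (de * m1 + e * dm1) / m2 - e * m1 * dm2 / m2 ^+ 2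
  - (da * m1 + a * dm1 - db * m2 - b * dm2).
Let dg22 de dm1 dm2 da db := (de * (m1 ^+ 2 + m2 ^+ 2) + e * (2 * m1 * dm1 + 2 * m2 * dm2)) / m2
  - e * (m1 ^+ 2 + m2 ^+ 2) * dm2 / m2 ^+ 2
  - (da * (m1 ^+ 2 - m2 ^+ 2) + a * (2 * m1 * dm1 - 2 * m2 * dm2)
     - 2 * (db * m1 * m2 + b * dm1 * m2 + b * m1 * dm2)).
Let P11 := (m1 ^+ 2 + m2 ^+ 2) / m2.
Let P12 := - (m1 / m2).
Let P22 := m2^-1.
Let dP11 dm1 dm2 := (2 * m1 * dm1 + 2 * m2 * dm2) / m2 - (m1 ^+ 2 + m2 ^+ 2) * dm2 / m2 ^+ 2.
Let dP12 dm1 dm2 := - (dm1 / m2) + m1 * dm2 / m2 ^+ 2.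
Let dP22 dm2 := - (dm2 / m2 ^+ 2).
Let g110 := dg11 e0 m20 a0.
Let g111 := dg11 e1 m21 a1.
Let g120 := dg12 e0 m10 m20 a0 b0.
Let g121 := dg12 e1 m11 m21 a1 b1.
Let g220 := dg22 e0 m10 m20 a0 b0.
Let g221 := dg22 e1 m11 m21 a1 b1.
Let P110 := dP11 m10 m20.
Let P111 := dP11 m11 m21.
Let P120 := dP12 m10 m20.
Let P121 := dP12 m11 m21.
Let P220 := dP22 m20.
Let P221 := dP22 m21.

(** The conclusions are the real and imaginary parts of d_1 Phi = m d_0 Phi + 2 Phi d_0 m, the
    Cauchy-Riemann equation of Phi dz^2. The part (e / m2) |dz|^2 of g is pure trace for P; in
    dimension two it satisfies the stress equations identically and drops out. *)
Lemma stress_free_jets :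
  P110 * g11 + P11 * g110 + P120 * g12 + P12 * g120 +
  (P121 * g11 + P12 * g111 + P221 * g12 + P22 * g121) =
  2^-1 * (P11 * g110 + 2 * (P12 * g120) + P22 * g220) ->
  P110 * g12 + P11 * g120 + P120 * g22 + P12 * g220 +
  (P121 * g12 + P12 * g121 + P221 * g22 + P22 * g221) =
  2^-1 * (P11 * g111 + 2 * (P12 * g121) + P22 * g221) ->
  a1 = m1 * a0 - m2 * b0 + 2 * (m10 * a - m20 * b) /\
  b1 = m1 * b0 + m2 * a0 + 2 * (m10 * b + m20 * a).
Proof.
move=> /eqP; rewrite -subr_eq0 => /eqP E1 /eqP; rewrite -subr_eq0 => /eqP E2.
have B : b1 - (m1 * b0 + m2 * a0 + 2 * (m10 * b + m20 * a)) = 0.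
  rewrite -[RHS]E1 /P11 /P12 /P22 /P110 /P111 /P120 /P121 /P220 /P221 /g11 /g12 /g22
    /g110 /g111 /g120 /g121 /g220 /g221 /dP11 /dP12 /dP22 /dg11 /dg12 /dg22.
  by clear E1 E2; field.
split; apply/eqP; rewrite -subr_eq0; apply/eqP => //.
(* [E2] is m2 times the equation for [a1] plus m1 times the one for [b1]. *)
apply: (@lin_comb2 R m2^-1 (- (m1 / m2)) _ _ _ E2 B).
rewrite /P11 /P12 /P22 /P110 /P111 /P120 /P121 /P220 /P221 /g11 /g12 /g22
    /g110 /g111 /g120 /g121 /g220 /g221 /dP11 /dP12 /dP22 /dg11 /dg12 /dg22.
by clear E1 E2 B; field.
Qed.

Let h11 := X1 * g110 + X2 * g111 + 2 * (X10 * g11 + X20 * g12).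
Let h12 := X1 * g120 + X2 * g121 + (X10 * g12 + X20 * g22) + (X11 * g11 + X21 * g12).
Let h22 := X1 * g220 + X2 * g221 + 2 * (X11 * g12 + X21 * g22).
Let H := 2^-1 * (P11 * h11 + 2 * (P12 * h12) + P22 * h22).
Let B11 := X1 * P110 + X2 * P111 - 2 * (X10 * P11 + X11 * P12) + (X10 + X21) * P11.
Let B12 := X1 * P120 + X2 * P121 - (X10 * P12 + X11 * P22) - (X20 * P11 + X21 * P12)
  + (X10 + X21) * P12.
Let B22 := X1 * P220 + X2 * P221 - 2 * (X20 * P12 + X21 * P22) + (X10 + X21) * P22.

(* x = X1 + m X2 = p + i q, om = m x_0 - x_1 - m_0 x and
   t = i m2 (x Phi_0 + 2 Phi x_0) - Phi om with Phi = a + i b. *)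
Let p := X1 + m1 * X2.
Let q := m2 * X2.
Let p0 := X10 + m10 * X2 + m1 * X20.
Let p1 := X11 + m11 * X2 + m1 * X21.
Let q0 := m20 * X2 + m2 * X20.
Let q1 := m21 * X2 + m2 * X21.
Let omr := m1 * p0 - m2 * q0 - p1 - (m10 * p - m20 * q).
Let omi := m1 * q0 + m2 * p0 - q1 - (m10 * q + m20 * p).
Let tr := - m2 * (p * b0 + q * a0 + 2 * (a * q0 + b * p0)) - (a * omr - b * omi).
Let ti := m2 * (p * a0 - q * b0 + 2 * (a * p0 - b * q0)) - (a * omi + b * omr).
Let Psr := - (omi / m2 ^+ 2).
Let Psi := - (omr / m2 ^+ 2).
Let Kr := e * Psr + ti / m2.
Let Ki := e * Psi - tr / m2.

Hypothesis a1E : a1 = m1 * a0 - m2 * b0 + 2 * (m10 * a - m20 * b).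
Hypothesis b1E : b1 = m1 * b0 + m2 * a0 + 2 * (m10 * b + m20 * a).

Ltac unf := rewrite /H /h11 /h12 /h22 /B11 /B12 /B22
   /Kr /Ki /Psr /Psi /ti /tr /omi /omr /p0 /p1 /q0 /q1 /p /q
   /P11 /P12 /P22 /P110 /P111 /P120 /P121 /P220 /P221 /g11 /g12 /g22
    /g110 /g111 /g120 /g121 /g220 /g221 /dP11 /dP12 /dP22 /dg11 /dg12 /dg22 ?a1E ?b1E.

(** P has determinant 1, so its Lie derivative is trace-free and has only two components, those of
    [Psr] + i [Psi] = - i om^* / m2^2, which measures how far X is from being conformal. *)
Lemma lieP_jets : [/\ B11 = - (Psr * (m1 ^+ 2 - m2 ^+ 2) - 2 * Psi * m1 * m2),
  B12 = Psr * m1 - Psi * m2 & B22 = - Psr].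
Proof. by split; unf; field. Qed.

(** Trace and trace-free parts of the Lie derivative of g, in the same shape as g itself: [H]
    replaces e, and K = [Kr] + i [Ki] replaces Phi. The Cauchy-Riemann equation eliminates d_1 Phi,
    which leaves K = e ([Psr] + i [Psi]) - i t / m2. *)
Lemma lie_jets : [/\ h11 = H / m2 - Kr,
  h12 = H * m1 / m2 - (Kr * m1 - Ki * m2) &
  h22 = H * (m1 ^+ 2 + m2 ^+ 2) / m2 - (Kr * (m1 ^+ 2 - m2 ^+ 2) - 2 * Ki * m1 * m2)].
Proof. by split; unf; field. Qed.

Let F := (h11 * h22 - h12 ^+ 2 - H ^+ 2) / u -
  2^-1 * (B11 * h11 + 2 * (B12 * h12) + B22 * h22).

(** By [lie_jets], h11 h22 - h12^2 = H^2 - m2^2 |K|^2, and the trace-free B pairs only with K, so H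
    cancels. With Q = [Psr] + i [Psi] the left side is m2^2 Re(K^* (u Q - K)); expressing K by om
    and t gives the right side. *)
Lemma second_variation_jets :
  u * F = e * (u - e) * (omr ^+ 2 + omi ^+ 2) / m2 ^+ 2 +
    (u - 2 * e) * (omr * tr - omi * ti) / m2 - (tr ^+ 2 + ti ^+ 2).
Proof.
rewrite /F; have [-> -> ->] := lieP_jets; have [-> -> ->] := lie_jets.
rewrite /Kr /Ki /Psr /Psi; move: H tr ti omr omi => ? ? ? ? ?.
by field; rewrite m2n.
Qed.

End Jets.

(** * Algebraic lower bounds *)

Section Lower.
Variable R : realType.

(* Sum of squares: with rh = m2 r and y = rh om / m2, 2 u rh times the quadratic
   form is (u - e - rh) |t + y^*|^2 + (e - rh) |t - y^*|^2 plus a nonnegative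
   multiple of |om|^2. *)
Lemma quadratic_form_lower (m2 u e r s omr omi tr ti F : R) :
  0 < m2 -> 0 < r -> s <= r ^+ 2 -> m2 * r <= e -> m2 * r <= u - e ->
  u * F = e * (u - e) * (omr ^+ 2 + omi ^+ 2) / m2 ^+ 2 +
    (u - 2 * e) * (omr * tr - omi * ti) / m2 - (tr ^+ 2 + ti ^+ 2) ->
  - (2^-1 * ((tr ^+ 2 + ti ^+ 2 - s * (omr ^+ 2 + omi ^+ 2)) / (m2 * r))) <= F.
Proof.
move=> m0 r0 sr re ru uF.
have rh0 : 0 < m2 * r by rewrite mulr_gt0.
have u0 : 0 < u by rewrite -(subrK e u) addr_gt0// (lt_le_trans rh0).
have u2 : 0 < 2 * u * (m2 * r) by rewrite !mulr_gt0.
rewrite -subr_ge0 opprK -(pmulr_rge0 _ u2).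
have -> : 2 * u * (m2 * r) * (F + 2^-1 * ((tr ^+ 2 + ti ^+ 2 - s * (omr ^+ 2 + omi ^+ 2)) / (m2 * r)))
  = (u - e - m2 * r) * ((tr + r * omr) ^+ 2 + (ti - r * omi) ^+ 2) +
    (e - m2 * r) * ((tr - r * omr) ^+ 2 + (ti + r * omi) ^+ 2) +
    2 * (u - e - m2 * r) * (e - m2 * r) * (r / m2) * (omr ^+ 2 + omi ^+ 2) +
    u * (r ^+ 2 - s) * (omr ^+ 2 + omi ^+ 2).
  rewrite [LHS](_ : _ = 2 * (m2 * r) * (u * F) +
    u * (tr ^+ 2 + ti ^+ 2 - s * (omr ^+ 2 + omi ^+ 2))); last first.
    by field; rewrite !gt_eqF.
  by rewrite uF; field; rewrite !gt_eqF.
have A c (z w : R) : 0 <= c -> 0 <= c * (z ^+ 2 + w ^+ 2).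
  by move=> c0; rewrite mulr_ge0 ?addr_ge0 ?sqr_ge0.
have ue : 0 <= u - e - m2 * r by rewrite subr_ge0.
have ee : 0 <= e - m2 * r by rewrite subr_ge0.
apply: addr_ge0; last first.
  by apply/A/mulr_ge0; [exact: ltW|rewrite subr_ge0].
apply: addr_ge0; last first.
  apply/A/mulr_ge0; last by rewrite divr_ge0 ?ltW.
  by apply: mulr_ge0 => //; apply: mulr_ge0.
by apply: addr_ge0; exact: A.
Qed.

(** A polynomial majorant of the absolute value, so that [defect] becomes a smooth function of the
    point, hence bounded on compact sets. *)
Definition bsq (z : R) := 1 + z ^+ 2.

Lemma norm_le_bsq (z : R) : `|z| <= bsq z.
Proof.
rewrite /bsq -real_normK ?num_real//.
have := sqr_ge0 (`|z| - 2^-1); have := normr_ge0 z; move: `|z| => y.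
by move=> y0 h; nra.
Qed.

Definition defect (a0 a1 b0 b1 m10 m20 i0 i1 nx : R) :=
  2 * (bsq a0 + bsq b0) * bsq i1 + 2 * (bsq a1 + bsq b1) * bsq i0 +
  4 * nx * (bsq a0 + bsq b0) * (bsq m10 + bsq m20).

(** The first two terms contain a factor a or b. For the last, the Cauchy-Riemann equation gives a0
    b1 - a1 b0 = m2 |Phi_0|^2 plus terms containing Phi; the square has the good sign, and
    everything else is bounded by |Phi| times [defect]. This factor |Phi| is what turns eps^2 / r^3
    into [weight]. *)
Lemma defect_lower (m1 m2 a b a0 a1 b0 b1 m10 m20 i0 i1 nx : R) :
  0 < m2 -> 0 <= nx ->
  a1 = m1 * a0 - m2 * b0 + 2 * (m10 * a - m20 * b) ->
  b1 = m1 * b0 + m2 * a0 + 2 * (m10 * b + m20 * a) ->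
  - (Num.sqrt (a ^+ 2 + b ^+ 2) * defect a0 a1 b0 b1 m10 m20 i0 i1 nx) <=
  2 * (a * a0 + b * b0) * i1 - 2 * (a * a1 + b * b1) * i0 + nx * (a0 * b1 - a1 * b0).
Proof.
move=> m0 nx0 a1E b1E; set q := Num.sqrt _.
have q0 : 0 <= q by exact: sqrtr_ge0.
have aq : `|a| <= q by rewrite -sqrtr_sqr ler_wsqrtr// lerDl sqr_ge0.
have bq : `|b| <= q by rewrite -sqrtr_sqr ler_wsqrtr// lerDr sqr_ge0.
have B (z k c d : R) : `|z| <= q -> `|k| <= c ->
    `|z * d * k| <= q * (bsq d * c).
  by move=> zq kc; rewrite !normrM -mulrA ler_pM ?mulr_ge0// ler_pM// norm_le_bsq.
have T1 : - (q * (2 * (bsq a0 + bsq b0) * bsq i1)) <= 2 * (a * a0 + b * b0) * i1.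
  have h1 := B a i1 _ a0 aq (norm_le_bsq i1).
  have h2 := B b i1 _ b0 bq (norm_le_bsq i1).
  by move: h1 h2; rewrite !ler_norml => /andP[h1 _] /andP[h2 _]; lra.
have T2 : - (q * (2 * (bsq a1 + bsq b1) * bsq i0)) <= - (2 * (a * a1 + b * b1) * i0).
  have h1 := B a i0 _ a1 aq (norm_le_bsq i0).
  have h2 := B b i0 _ b1 bq (norm_le_bsq i0).
  by move: h1 h2; rewrite !ler_norml => /andP[_ h1] /andP[_ h2]; lra.
have T3 : - (q * (4 * (bsq a0 + bsq b0) * (bsq m10 + bsq m20))) <= a0 * b1 - a1 * b0.
  have -> : a0 * b1 - a1 * b0 = m2 * (a0 ^+ 2 + b0 ^+ 2) +
      2 * (b * a0 * m10 + a * a0 * m20 - a * b0 * m10 + b * b0 * m20).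
    by rewrite a1E b1E; ring.
  have h0 : 0 <= m2 * (a0 ^+ 2 + b0 ^+ 2) by rewrite mulr_ge0 ?addr_ge0 ?sqr_ge0 ?ltW.
  have h1 := B b m10 _ a0 bq (norm_le_bsq m10).
  have h2 := B a m20 _ a0 aq (norm_le_bsq m20).
  have h3 := B a m10 _ b0 aq (norm_le_bsq m10).
  have h4 := B b m20 _ b0 bq (norm_le_bsq m20).
  have p z w : 0 <= q * (bsq z * bsq w).
    by rewrite !mulr_ge0 // /bsq addr_ge0 ?sqr_ge0.
  have := p a0 m10; have := p a0 m20; have := p b0 m10; have := p b0 m20.
  move: h1 h2 h3 h4; rewrite !ler_norml => /andP[h1 _] /andP[h2 _] /andP[_ h3] /andP[h4 _].
  by move=> ? ? ? ?; lra.
have := ler_wpM2l nx0 T3.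
rewrite /defect; move: T1 T2.
move: (bsq a0) (bsq b0) (bsq a1) (bsq b1) (bsq i0) (bsq i1) (bsq m10) (bsq m20).
move=> *; lra.
Qed.

(* With r^2 = s + eps^2 the first summand of curl accounts for the derivative of
   the regularised weight 1/r. *)
Lemma regularised_lower (s eps r m2 E0 M N : R) : 0 < r -> 0 < m2 ->
  r ^+ 2 = s + eps ^+ 2 -> N = m2 * (E0 + 2 * M) ->
  2^-1 * (N / (m2 * r)) =
  ((1 - s / (2 * r ^+ 2)) * E0 + M) / r - 2^-1 * (eps ^+ 2 / r ^+ 3 * E0).
Proof.
move=> r0 m0 rE ->; have -> : s = r ^+ 2 - eps ^+ 2 by rewrite rE addrK.
by field; rewrite !gt_eqF.
Qed.
End Lower.

Lemma pd_isder (R : realType) (V : normedModType R) (D : set V) (f g : V -> R)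
    v x d d' : open D -> D x -> (forall y, D y -> f y = g y) ->
  isder x v g d -> d = d' -> pd v f x = d'.
Proof. by move=> oD Dx fg [_ <-] <-; exact: pd_eq fg. Qed.

Ltac gen_vals x :=
  gen_pd;
  repeat match goal with |- context [?f x] => is_var f; generalize (f x); intro end.

(** * Pointwise lower bound by a divergence and a curl *)

Section Pointwise.
Context {R : realType}.
Local Notation V2 := 'rV[R]_2.
Variables (D : set V2) (m1 m2 u e a b g11 g12 g22 X1 X2 Y1 Y2 : V2 -> R).
Hypotheses (oD : open D) (sm1 : sm D m1) (sm2 : sm D m2)
  (se : sm D e) (sa : sm D a) (sb : sm D b)
  (sg11 : sm D g11) (sg12 : sm D g12) (sg22 : sm D g22)
  (sX1 : sm D X1) (sX2 : sm D X2) (sY1 : sm D Y1) (sY2 : sm D Y2).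
Hypotheses (m2_gt0 : forall x, D x -> 0 < m2 x).
Hypothesis g11E : forall x, D x -> g11 x = e x / m2 x - a x.
Hypothesis g12E : forall x, D x ->
  g12 x = e x * m1 x / m2 x - (a x * m1 x - b x * m2 x).
Hypothesis g22E : forall x, D x -> g22 x = e x * (m1 x ^+ 2 + m2 x ^+ 2) / m2 x -
  (a x * (m1 x ^+ 2 - m2 x ^+ 2) - 2 * b x * m1 x * m2 x).

(** The inverse of |dx + m dy|^2 times the square root of its determinant: the density P, which
    depends only on the conformal class. *)
Definition conf11 x := (m1 x ^+ 2 + m2 x ^+ 2) / m2 x.
Definition conf12 x := - (m1 x / m2 x).
Definition conf22 x := (m2 x)^-1.

Hypothesis stress : forall x, D x ->
  stress_free g11 g12 g22 conf11 conf12 conf22 x.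

Let m2n x : D x -> m2 x != 0. Proof. by move=> /m2_gt0/gt_eqF->. Qed.

Definition hopf_sq x := a x ^+ 2 + b x ^+ 2.
Definition cx x := X1 x + m1 x * X2 x.
Definition cy x := m2 x * X2 x.
Definition cnorm x := cx x ^+ 2 + cy x ^+ 2.

Definition reg_norm eps x := Num.sqrt (hopf_sq x + eps ^+ 2).

(* The 1-form (s Im(x^* dx) + |x|^2/2 Im(Phi^* dPhi)) / sqrt(s + eps^2), where
   x = cx + i cy, Phi = a + i b and s = |Phi|^2. *)
Definition null_form (d : (V2 -> R) -> V2 -> R) eps y :=
  (hopf_sq y * (cx y * d cy y - cy y * d cx y) +
   2^-1 * (cnorm y * (a y * d b y - b y * d a y))) / reg_norm eps y.

Lemma sm_cx : sm D cx. Proof. by rewrite /cx; sm_solve. Qed.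
Lemma sm_cy : sm D cy. Proof. by rewrite /cy; sm_solve. Qed.

Lemma pd_cx v x : D x -> pd v cx x = pd v X1 x + pd v m1 x * X2 x + m1 x * pd v X2 x.
Proof.
move=> Dx; apply: (pd_isder oD Dx (fun y _ => erefl (cx y))).
  by rewrite /cx; isder_solve.
by rewrite addrA.
Qed.

Lemma pd_cy v x : D x -> pd v cy x = pd v m2 x * X2 x + m2 x * pd v X2 x.
Proof.
move=> Dx; apply: (pd_isder oD Dx (fun y _ => erefl (cy y))).
  by rewrite /cy; isder_solve.
by [].
Qed.

Lemma pd_g11 v x : D x -> pd v g11 x =
  pd v e x / m2 x - e x * pd v m2 x / m2 x ^+ 2 - pd v a x.
Proof.
move=> Dx; have m2x := m2n Dx; apply: (pd_isder oD Dx g11E).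
  by isder_solve.
by revert m2x; gen_vals x; intros; field.
Qed.

Lemma pd_g12 v x : D x -> pd v g12 x =
  (pd v e x * m1 x + e x * pd v m1 x) / m2 x - e x * m1 x * pd v m2 x / m2 x ^+ 2
  - (pd v a x * m1 x + a x * pd v m1 x - pd v b x * m2 x - b x * pd v m2 x).
Proof.
move=> Dx; have m2x := m2n Dx; apply: (pd_isder oD Dx g12E).
  by isder_solve.
by revert m2x; gen_vals x; intros; field.
Qed.

Lemma pd_g22 v x : D x -> pd v g22 x =
  (pd v e x * (m1 x ^+ 2 + m2 x ^+ 2) +
   e x * (2 * m1 x * pd v m1 x + 2 * m2 x * pd v m2 x)) / m2 x
  - e x * (m1 x ^+ 2 + m2 x ^+ 2) * pd v m2 x / m2 x ^+ 2
  - (pd v a x * (m1 x ^+ 2 - m2 x ^+ 2) +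
     a x * (2 * m1 x * pd v m1 x - 2 * m2 x * pd v m2 x)
     - 2 * (pd v b x * m1 x * m2 x + b x * pd v m1 x * m2 x + b x * m1 x * pd v m2 x)).
Proof.
move=> Dx; have m2x := m2n Dx; apply: (pd_isder oD Dx g22E).
  by isder_solve.
by revert m2x; gen_vals x; intros; field.
Qed.

Lemma pd_conf11 v x : D x -> pd v conf11 x =
  (2 * m1 x * pd v m1 x + 2 * m2 x * pd v m2 x) / m2 x
  - (m1 x ^+ 2 + m2 x ^+ 2) * pd v m2 x / m2 x ^+ 2.
Proof.
move=> Dx; have m2x := m2n Dx; apply: (pd_isder oD Dx (fun y _ => erefl (conf11 y))).
  by rewrite /conf11; isder_solve.
by revert m2x; gen_vals x; intros; field.
Qed.

Lemma pd_conf12 v x : D x -> pd v conf12 x =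
  - (pd v m1 x / m2 x) + m1 x * pd v m2 x / m2 x ^+ 2.
Proof.
move=> Dx; have m2x := m2n Dx; apply: (pd_isder oD Dx (fun y _ => erefl (conf12 y))).
  by rewrite /conf12; isder_solve.
by revert m2x; gen_vals x; intros; field.
Qed.

Lemma pd_conf22 v x : D x -> pd v conf22 x = - (pd v m2 x / m2 x ^+ 2).
Proof.
move=> Dx; have m2x := m2n Dx; apply: (pd_isder oD Dx (fun y _ => erefl (conf22 y))).
  by rewrite /conf22; isder_solve.
by [].
Qed.

Lemma hopf_reg_gt0 eps x : 0 < eps -> 0 < hopf_sq x + eps ^+ 2.
Proof. by move=> e0; rewrite ltr_wpDl ?exprn_gt0// /hopf_sq addr_ge0 ?sqr_ge0. Qed.

Lemma reg_norm_gt0 eps x : 0 < eps -> 0 < reg_norm eps x.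
Proof. by move=> e0; rewrite /reg_norm sqrtr_gt0 hopf_reg_gt0. Qed.

Lemma sm_hopf_sq : sm D hopf_sq. Proof. by rewrite /hopf_sq; sm_solve. Qed.

Lemma sm_reg_norm eps : 0 < eps -> sm D (reg_norm eps).
Proof.
move=> e0; apply: sm_sqrt => //; first by move=> x _; exact: hopf_reg_gt0.
by have sh := sm_hopf_sq; sm_solve.
Qed.

Lemma pd_reg_norm eps v x : D x -> 0 < eps ->
  pd v (reg_norm eps) x = (a x * pd v a x + b x * pd v b x) / reg_norm eps x.
Proof.
move=> Dx eps0; have r0 := reg_norm_gt0 x eps0.
have h : isder x v (fun y => hopf_sq y + eps ^+ 2) (2 * (a x * pd v a x + b x * pd v b x)).
  rewrite /hopf_sq; apply: isder_eq; first by isder_solve.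
  by gen_vals x; intros; ring.
have [_ ->] := @isder_sqrt _ _ (fun y => hopf_sq y + eps ^+ 2) _ _ _ (hopf_reg_gt0 x eps0) h.
rewrite -/(reg_norm eps x); move: r0; gen_pd; move: (reg_norm eps x) (a x) (b x).
by move=> r ? ? r0; field; rewrite gt_eqF.
Qed.

(** With s = [hopf_sq] and r = [reg_norm], d(s / r) = (1 - s / (2 r^2)) ds / r. The same coefficient
    appears in front of the Jacobian of Phi, because the wedge of ds with Im(Phi^* dPhi) is 2 s
    times that Jacobian. *)
Lemma null_form_curl eps x : D x -> 0 < eps ->
  d0 (null_form d1 eps) x - d1 (null_form d0 eps) x =
  ((1 - hopf_sq x / (2 * reg_norm eps x ^+ 2)) *
    (2 * (a x * d0 a x + b x * d0 b x) * (cx x * d1 cy x - cy x * d1 cx x)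
     - 2 * (a x * d1 a x + b x * d1 b x) * (cx x * d0 cy x - cy x * d0 cx x)
     + cnorm x * (d0 a x * d1 b x - d1 a x * d0 b x)) +
   (2 * hopf_sq x * (d0 cx x * d1 cy x - d1 cx x * d0 cy x) +
    ((cx x * d0 cx x + cy x * d0 cy x) * (a x * d1 b x - b x * d1 a x) -
     (cx x * d1 cx x + cy x * d1 cy x) * (a x * d0 b x - b x * d0 a x)))) / reg_norm eps x.
Proof.
move=> Dx eps0.
have rn : reg_norm eps x != 0 by apply: lt0r_neq0; exact: reg_norm_gt0.
have srn := sm_reg_norm eps0.
have scx := sm_cx; have scy := sm_cy.
have C f : sm D f -> pd (delta_mx 0 1) (pd (delta_mx 0 0) f) x =
    pd (delta_mx 0 0) (pd (delta_mx 0 1) f) x by exact: pd_comm.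
have C1 := C _ sa; have C2 := C _ sb; have C3 := C _ scx; have C4 := C _ scy.
have R0 := pd_reg_norm (delta_mx 0 0) Dx eps0.
have R1 := pd_reg_norm (delta_mx 0 1) Dx eps0.
have: exists2 d, isder x (delta_mx 0 0) (null_form d1 eps) d &
      exists2 d', isder x (delta_mx 0 1) (null_form d0 eps) d' &
  d - d' = ((1 - hopf_sq x / (2 * reg_norm eps x ^+ 2)) *
    (2 * (a x * d0 a x + b x * d0 b x) * (cx x * d1 cy x - cy x * d1 cx x)
     - 2 * (a x * d1 a x + b x * d1 b x) * (cx x * d0 cy x - cy x * d0 cx x)
     + cnorm x * (d0 a x * d1 b x - d1 a x * d0 b x)) +
   (2 * hopf_sq x * (d0 cx x * d1 cy x - d1 cx x * d0 cy x) +
    ((cx x * d0 cx x + cy x * d0 cy x) * (a x * d1 b x - b x * d1 a x) -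
     (cx x * d1 cx x + cy x * d1 cy x) * (a x * d0 b x - b x * d0 a x)))) / reg_norm eps x.
  eexists.
    by rewrite /null_form /cnorm /hopf_sq /d1; isder_solve.
  eexists.
    by rewrite /null_form /cnorm /hopf_sq /d0; isder_solve.
  rewrite /d0 /d1 /hopf_sq /cnorm; cbv beta.
  subst_lhs C1; subst_lhs C2; subst_lhs C3; subst_lhs C4; subst_lhs R0; subst_lhs R1.
  revert rn; generalize (reg_norm eps x), (cx x), (cy x); gen_vals x; intros.
  by field.
by move=> [d [_ <-] [d' [_ <-] ->]].
Qed.

Notation lie11 := (lie11 g11 g12 X1 X2).
Notation lie12 := (lie12 g11 g12 g22 X1 X2).
Notation lie22 := (lie22 g12 g22 X1 X2).
Notation trace_lie := (trace_lie g11 g12 g22 conf11 conf12 conf22 X1 X2).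
Notation flux1 := (flux1 g11 g12 g22 conf11 conf12 conf22 X1 X2 Y1 Y2).
Notation flux2 := (flux2 g11 g12 g22 conf11 conf12 conf22 X1 X2 Y1 Y2).

(** Second derivative at t = 0 of sqrt(det(G + t L + t^2 / 2 Q)), where L is the first and Q the
    second derivative of the pullback: the first summand comes from Q, the second is quadratic in
    L. *)
Definition second_var x :=
  2^-1 * (conf11 x * pull2_11 g11 g12 g22 X1 X2 Y1 Y2 x
          + 2 * (conf12 x * pull2_12 g11 g12 g22 X1 X2 Y1 Y2 x)
          + conf22 x * pull2_22 g11 g12 g22 X1 X2 Y1 Y2 x) +
  (lie11 x * lie22 x - lie12 x ^+ 2 - trace_lie x ^+ 2) / u x.

Definition defect_fun x :=
  defect (d0 a x) (d1 a x) (d0 b x) (d1 b x) (d0 m1 x) (d0 m2 x)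
    (cx x * d0 cy x - cy x * d0 cx x) (cx x * d1 cy x - cy x * d1 cx x) (cnorm x).

Lemma sm_conf : [/\ sm D conf11, sm D conf12 & sm D conf22].
Proof.
have sV : sm D (fun y => (m2 y)^-1) by apply: smV.
by split; rewrite /conf11 /conf12 /conf22; sm_solve.
Qed.

Ltac subst_jets Dx :=
  subst_by (pd_g11 (delta_mx 0 0) Dx); subst_by (pd_g11 (delta_mx 0 1) Dx);
  subst_by (pd_g12 (delta_mx 0 0) Dx); subst_by (pd_g12 (delta_mx 0 1) Dx);
  subst_by (pd_g22 (delta_mx 0 0) Dx); subst_by (pd_g22 (delta_mx 0 1) Dx);
  subst_by (pd_conf11 (delta_mx 0 0) Dx); subst_by (pd_conf11 (delta_mx 0 1) Dx);
  subst_by (pd_conf12 (delta_mx 0 0) Dx); subst_by (pd_conf12 (delta_mx 0 1) Dx);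
  subst_by (pd_conf22 (delta_mx 0 0) Dx); subst_by (pd_conf22 (delta_mx 0 1) Dx);
  subst_by (g11E Dx); subst_by (g12E Dx); subst_by (g22E Dx).

Lemma holomorphic x : D x ->
  d1 a x = m1 x * d0 a x - m2 x * d0 b x + 2 * (d0 m1 x * a x - d0 m2 x * b x) /\
  d1 b x = m1 x * d0 b x + m2 x * d0 a x + 2 * (d0 m1 x * b x + d0 m2 x * a x).
Proof.
move=> Dx; have := stress Dx; rewrite /stress_free /d0 /d1.
subst_jets Dx; rewrite /conf11 /conf12 /conf22.
by case; apply: stress_free_jets; exact: m2n.
Qed.

Definition omr x := m1 x * d0 cx x - m2 x * d0 cy x - d1 cx x - (d0 m1 x * cx x - d0 m2 x * cy x).
Definition omi x := m1 x * d0 cy x + m2 x * d0 cx x - d1 cy x - (d0 m1 x * cy x + d0 m2 x * cx x).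
Definition tr x := - m2 x * (cx x * d0 b x + cy x * d0 a x + 2 * (a x * d0 cy x + b x * d0 cx x))
  - (a x * omr x - b x * omi x).
Definition ti x := m2 x * (cx x * d0 a x - cy x * d0 b x + 2 * (a x * d0 cx x - b x * d0 cy x))
  - (a x * omi x + b x * omr x).

Lemma second_var_quadratic x : D x -> u x != 0 ->
  u x * ((lie11 x * lie22 x - lie12 x ^+ 2 - trace_lie x ^+ 2) / u x -
    2^-1 * (lieP11 conf11 conf12 X1 X2 x * lie11 x +
       2 * (lieP12 conf11 conf12 conf22 X1 X2 x * lie12 x) +
       lieP22 conf12 conf22 X1 X2 x * lie22 x)) =
  e x * (u x - e x) * (omr x ^+ 2 + omi x ^+ 2) / m2 x ^+ 2 +
    (u x - 2 * e x) * (omr x * tr x - omi x * ti x) / m2 x - (tr x ^+ 2 + ti x ^+ 2).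
Proof.
move=> Dx un; have [a1E b1E] := holomorphic Dx.
rewrite /trace_lie /tr /ti /omr /omi.
rewrite /lie11 /lie12 /lie22 /lieP11 /lieP12 /lieP22 /d0 /d1.
have C00 := pd_cx (delta_mx 0 0) Dx; have C01 := pd_cx (delta_mx 0 1) Dx.
have C10 := pd_cy (delta_mx 0 0) Dx; have C11 := pd_cy (delta_mx 0 1) Dx.
subst_lhs C00; subst_lhs C01; subst_lhs C10; subst_lhs C11.
subst_jets Dx; rewrite /conf11 /conf12 /conf22 /cx /cy.
pose e0 : V2 := delta_mx 0 0; pose e1 : V2 := delta_mx 0 1.
have H := @second_variation_jets R (m1 x) (m2 x) (u x) (e x) (a x) (b x)
  (pd e0 m1 x) (pd e1 m1 x) (pd e0 m2 x) (pd e1 m2 x) (pd e0 e x) (pd e1 e x)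
  (pd e0 a x) (pd e1 a x) (pd e0 b x) (pd e1 b x) (X1 x) (X2 x)
  (pd e0 X1 x) (pd e1 X1 x) (pd e0 X2 x) (pd e1 X2 x) (m2n Dx) un a1E b1E.
cbv zeta in H; exact: H.
Qed.
(** With w = sqrt(Phi) x, holomorphy gives Phi om = sqrt(Phi) (m w_0 - w_1) and t = - sqrt(Phi) (m^*
    w_0 - w_1), so the difference of the squared moduli is 4 m2 |Phi| times the Jacobian of w.
    Written without roots, the identity also covers the zeros of Phi. *)
Lemma null_form_identity x : D x ->
  tr x ^+ 2 + ti x ^+ 2 - hopf_sq x * (omr x ^+ 2 + omi x ^+ 2) =
  m2 x * ((2 * (a x * d0 a x + b x * d0 b x) * (cx x * d1 cy x - cy x * d1 cx x)
     - 2 * (a x * d1 a x + b x * d1 b x) * (cx x * d0 cy x - cy x * d0 cx x)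
     + cnorm x * (d0 a x * d1 b x - d1 a x * d0 b x)) +
   2 * (2 * hopf_sq x * (d0 cx x * d1 cy x - d1 cx x * d0 cy x) +
    ((cx x * d0 cx x + cy x * d0 cy x) * (a x * d1 b x - b x * d1 a x) -
     (cx x * d1 cx x + cy x * d1 cy x) * (a x * d0 b x - b x * d0 a x)))).
Proof.
move=> Dx; have [A B] := holomorphic Dx; subst_lhs A; subst_lhs B.
rewrite /tr /ti /omr /omi /hopf_sq /cnorm /d0 /d1.
by generalize (cx x), (cy x); gen_vals x; intros; ring.
Qed.

(** The last two hypotheses say m2 r <= e and m2 r <= u - e for r = [reg_norm eps x], as
    [quadratic_form_lower] requires. Its bound is minus the curl of [null_form], up to the term
    isolated in [regularised_lower]; [defect_lower] times eps^2 / r^3 controls that term. *)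
Lemma second_var_lower eps x : D x -> 0 < eps -> 0 < e x -> 0 < u x - e x ->
  m2 x ^+ 2 * (hopf_sq x + eps ^+ 2) <= e x ^+ 2 ->
  m2 x ^+ 2 * (hopf_sq x + eps ^+ 2) <= (u x - e x) ^+ 2 ->
  d0 flux1 x + d1 flux2 x - (d0 (null_form d1 eps) x - d1 (null_form d0 eps) x)
  - 2^-1 * (weight eps (hopf_sq x) * defect_fun x) <= second_var x.
Proof.
move=> Dx eps0 ex uex re rue.
have un : u x != 0 by rewrite gt_eqF// -(subrK (e x) (u x)) addr_gt0.
have [sP11 sP12 sP22] := sm_conf.
have m20 := m2_gt0 Dx; have r0 := reg_norm_gt0 x eps0.
have rE : reg_norm eps x ^+ 2 = hopf_sq x + eps ^+ 2.
  by rewrite sqr_sqrtr// ltW// hopf_reg_gt0.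
have mr c : 0 < c -> m2 x ^+ 2 * (hopf_sq x + eps ^+ 2) <= c ^+ 2 ->
    m2 x * reg_norm eps x <= c.
  have p0 : 0 <= m2 x * reg_norm eps x by apply: mulr_ge0; exact: ltW.
  by move=> /ltW c0; rewrite -rE -exprMn ler_sqr ?nnegrE.
have sr : hopf_sq x <= reg_norm eps x ^+ 2 by rewrite rE lerDl sqr_ge0.
have Q := quadratic_form_lower m20 r0 sr (mr _ ex re) (mr _ uex rue)
  (second_var_quadratic Dx un).
have Dl := regularised_lower r0 m20 rE (null_form_identity Dx).
have [A B] := holomorphic Dx.
have Df := defect_lower (cx x * d0 cy x - cy x * d0 cx x)
  (cx x * d1 cy x - cy x * d1 cx x) m20 (addr_ge0 (sqr_ge0 (cx x)) (sqr_ge0 (cy x))) A B.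
rewrite /second_var (half_trace_pull2 oD sg11 sg12 sg22 sP11 sP12 sP22 sX1 sX2 sY1 sY2 Dx (stress Dx)).
rewrite (null_form_curl Dx eps0); move: Q; rewrite Dl.
have W : - (weight eps (hopf_sq x) * defect_fun x) <= eps ^+ 2 / reg_norm eps x ^+ 3 *
    (2 * (a x * d0 a x + b x * d0 b x) * (cx x * d1 cy x - cy x * d1 cx x)
     - 2 * (a x * d1 a x + b x * d1 b x) * (cx x * d0 cy x - cy x * d0 cx x)
     + cnorm x * (d0 a x * d1 b x - d1 a x * d0 b x)).
  have k0 : 0 <= eps ^+ 2 / reg_norm eps x ^+ 3.
    by rewrite divr_ge0 ?sqr_ge0// exprn_ge0// ltW.
  apply: le_trans (ler_wpM2l k0 Df).
  by rewrite mulrN lerN2 /weight mulrA [_ / _ * Num.sqrt _]mulrAC.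
move: W; rewrite -/(reg_norm eps x).
move: (d0 flux1 x) (d1 flux2 x) (weight eps (hopf_sq x) * defect_fun x) => f1 f2 w.
set E0 := (_ * _ - _ * _ + cnorm x * _); move: (eps ^+ 2 / _ * E0) => k.
move: (_ / reg_norm eps x) => c.
set l1 := (_ / u x); set l2 := (2^-1 * (_ + _)).
by move: l1 l2 => l1 l2 W Q; lra.
Qed.
End Pointwise.

(** * Integration over [U] and removal of the regularisation *)

Section Integrated.
Context {R : realType}.
Local Notation V2 := 'rV[R]_2.
Local Notation pp := (@plane_point R).
Local Notation mu := (@lebesgue_measure R).
Local Notation mu2 := (mu \x mu)%E.
Variables (D U : set V2) (m1 m2 u e a b g11 g12 g22 X1 X2 Y1 Y2 : V2 -> R).
Hypotheses (oD : open D) (rU : relatively_compact_open D U)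
  (sm1 : sm D m1) (sm2 : sm D m2) (su : sm D u)
  (se : sm D e) (sa : sm D a) (sb : sm D b)
  (sg11 : sm D g11) (sg12 : sm D g12) (sg22 : sm D g22)
  (sX1 : sm D X1) (sX2 : sm D X2) (sY1 : sm D Y1) (sY2 : sm D Y2).
Hypotheses (m2_gt0 : forall x, D x -> 0 < m2 x).
Hypothesis g11E : forall x, D x -> g11 x = e x / m2 x - a x.
Hypothesis g12E : forall x, D x ->
  g12 x = e x * m1 x / m2 x - (a x * m1 x - b x * m2 x).
Hypothesis g22E : forall x, D x -> g22 x = e x * (m1 x ^+ 2 + m2 x ^+ 2) / m2 x -
  (a x * (m1 x ^+ 2 - m2 x ^+ 2) - 2 * b x * m1 x * m2 x).
Hypothesis stress : forall x, D x ->
  stress_free g11 g12 g22 (conf11 m1 m2) (conf12 m1 m2) (conf22 m2) x.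
Hypotheses (e_gt0 : forall x, D x -> 0 < e x) (ue_gt0 : forall x, D x -> 0 < u x - e x)
  (hopf_e : forall x, D x -> m2 x ^+ 2 * hopf_sq a b x < e x ^+ 2)
  (hopf_ue : forall x, D x -> m2 x ^+ 2 * hopf_sq a b x < (u x - e x) ^+ 2).
Hypotheses (X10 : forall x, D x -> ~ U x -> X1 x = 0)
  (X20 : forall x, D x -> ~ U x -> X2 x = 0)
  (Y10 : forall x, D x -> ~ U x -> Y1 x = 0)
  (Y20 : forall x, D x -> ~ U x -> Y2 x = 0).

Let sc := sm_conf oD sm1 sm2 m2_gt0.
Let sP11 := let: And3 h _ _ := sc in h.
Let sP12 := let: And3 _ h _ := sc in h.
Let sP22 := let: And3 _ _ h := sc in h.

Local Notation F1 := (flux1 g11 g12 g22 (conf11 m1 m2) (conf12 m1 m2) (conf22 m2) X1 X2 Y1 Y2).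
Local Notation F2 := (flux2 g11 g12 g22 (conf11 m1 m2) (conf12 m1 m2) (conf22 m2) X1 X2 Y1 Y2).
Local Notation N0 := (null_form m1 m2 a b X1 X2 d0).
Local Notation N1 := (null_form m1 m2 a b X1 X2 d1).

Lemma sm_flux : sm D F1 /\ sm D F2.
Proof.
by split; rewrite /flux1 /flux2 /Z1 /Z2 /trace_lie /lie11 /lie12 /lie22 /d0 /d1; sm_solve.
Qed.

Lemma flux0 x : D x -> ~ U x -> F1 x = 0 /\ F2 x = 0.
Proof.
move=> Dx Ux; rewrite /flux1 /flux2 /Z1 /Z2 /d0 /d1.
subst_by (X10 Dx Ux); subst_by (X20 Dx Ux); subst_by (Y10 Dx Ux); subst_by (Y20 Dx Ux).
generalize (trace_lie g11 g12 g22 (conf11 m1 m2) (conf12 m1 m2) (conf22 m2) X1 X2 x).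
by gen_pd; intros; split; ring.
Qed.

Lemma sm_null eps : 0 < eps -> sm D (N0 eps) /\ sm D (N1 eps).
Proof.
move=> e0; have sr := sm_reg_norm oD sa sb e0.
have srV : sm D (fun y => (reg_norm a b eps y)^-1).
  by apply: smV => // x _; apply: lt0r_neq0; exact: reg_norm_gt0.
by split; rewrite /null_form /hopf_sq /cnorm /cx /cy /d0 /d1; sm_solve.
Qed.

Lemma null0 eps x : D x -> ~ U x -> N0 eps x = 0 /\ N1 eps x = 0.
Proof.
move=> Dx Ux; rewrite /null_form /cnorm.
have -> : cx m1 X1 X2 x = 0 by rewrite /cx X10// X20// mulr0 addr0.
have -> : cy m2 X2 x = 0 by rewrite /cy X20// mulr0.
rewrite /d0 /d1; generalize (reg_norm a b eps x)^-1; gen_vals x; intros.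
by split; ring.
Qed.

Lemma sm_second_var : sm D (second_var m1 m2 u g11 g12 g22 X1 X2 Y1 Y2).
Proof.
have suV : sm D (fun y => (u y)^-1).
  apply: smV => // x Dx; rewrite gt_eqF// -(subrK (e x) (u x)).
  by rewrite addr_gt0 ?ue_gt0 ?e_gt0.
rewrite /second_var /pull2_11 /pull2_12 /pull2_22 /trace_lie /lie11 /lie12 /lie22 /d0 /d1.
by sm_solve.
Qed.

Lemma sm_defect : sm D (defect_fun m1 m2 a b X1 X2).
Proof.
rewrite /defect_fun /defect /bsq /cnorm /cx /cy /d0 /d1; sm_solve.
Qed.

Lemma sm_int f : sm D f -> mu2.-integrable (pp @^-1` U) (EFin \o (fun z => f (pp z))).
Proof.
move=> sf; apply: (@plane_integrable _ D U f rU) => x Dx.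
exact/differentiable_continuous/(sm_diff sf).
Qed.

Lemma integral_divergence_curl f1 f2 n0 n1 :
  sm D f1 -> sm D f2 -> sm D n0 -> sm D n1 ->
  (forall x, D x -> ~ U x -> f1 x = 0) -> (forall x, D x -> ~ U x -> f2 x = 0) ->
  (forall x, D x -> ~ U x -> n0 x = 0) -> (forall x, D x -> ~ U x -> n1 x = 0) ->
  \int[mu2]_(z in pp @^-1` U)
    (d0 f1 (pp z) + d1 f2 (pp z) - (d0 n1 (pp z) - d1 n0 (pp z))) = 0.
Proof.
move=> s1 s2 s3 s4 z1 z2 z3 z4; have [oU _ _] := rU.
have mU := measurable_plane_open oU.
have ip f i : sm D f -> mu2.-integrable (pp @^-1` U)
    (EFin \o (fun z => pd (delta_mx 0 i) f (pp z))).
  by move=> sf; apply: (@sm_int (pd (delta_mx 0 i) f)); exact: sm_pd.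
have sA : sm D (fun x => d0 f1 x + d1 f2 x) by apply: smD => //; exact: sm_pd.
have sB : sm D (fun x => d0 n1 x - d1 n0 x) by apply: smB => //; exact: sm_pd.
rewrite (@RintegralB _ _ R mu2 _ _ _ mU (sm_int sA) (sm_int sB)).
rewrite (@RintegralD _ _ R mu2 _ _ _ mU (ip _ _ s1) (ip _ _ s2)).
rewrite (@RintegralB _ _ R mu2 _ _ _ mU (ip _ _ s4) (ip _ _ s3)).
rewrite (integral_pd0 0 oD rU s1 z1) (integral_pd0 1 oD rU s2 z2).
by rewrite (integral_pd0 0 oD rU s4 z4) (integral_pd0 1 oD rU s3 z3) !subr0 addr0.
Qed.

(** By compactness of [closure U] the strict inequality leaves uniform room for eps. *)
Lemma margin (c : V2 -> R) : sm D c -> (forall x, D x -> m2 x ^+ 2 * hopf_sq a b x < c x ^+ 2) ->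
  exists2 d : R, 0 < d & forall x, U x -> forall eps, 0 < eps -> eps <= d ->
    m2 x ^+ 2 * (hopf_sq a b x + eps ^+ 2) <= c x ^+ 2.
Proof.
move=> scc hc; have [oU cU UD] := rU.
have pos x : D x -> 0 < c x ^+ 2 - m2 x ^+ 2 * hopf_sq a b x.
  by move=> Dx; rewrite subr_gt0 hc.
have sq : sm D (fun x => m2 x ^+ 2 / (c x ^+ 2 - m2 x ^+ 2 * hopf_sq a b x)).
  have sd : sm D (fun x => c x ^+ 2 - m2 x ^+ 2 * hopf_sq a b x).
    by rewrite /hopf_sq; sm_solve.
  have sV : sm D (fun x => (c x ^+ 2 - m2 x ^+ 2 * hopf_sq a b x)^-1).
    by apply: smV => // x /pos/lt0r_neq0.
  by apply: smM => //; exact: smX.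
have [C C0 HC] := compact_cont_bounded cU (fun x Ux =>
  differentiable_continuous (sm_diff sq (UD x Ux))).
(* [C] bounds m2^2 divided by the gap of the strict inequality; eps <= 1 gives eps^2 <= eps <= 1 /
   C. *)
exists (Num.min 1 C^-1); first by rewrite lt_min ltr01 invr_gt0.
move=> x Ux eps e0; rewrite le_min => /andP[e1 eC].
have Dx : D x by apply/UD/subset_closure.
rewrite mulrDr -lerBrDl.
have := HC x (subset_closure Ux).
rewrite ger0_norm; last by rewrite divr_ge0 ?sqr_ge0 ?ltW// pos.
rewrite ler_pdivrMr ?pos// => h.
apply: (@le_trans _ _ (m2 x ^+ 2 * C^-1)).
  rewrite ler_wpM2l ?sqr_ge0// (le_trans _ eC)// expr2.
  by rewrite ler_piMl// ltW.
by rewrite ler_pdivrMr// mulrC.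
Qed.

(** [second_var_lower] is integrated with eps = 1 / (n + 1). The divergence and the curl integrate
    to 0, which leaves - K W_n / 2 as a lower bound, where K bounds [defect_fun] on [closure U]. The
    integral being estimated does not depend on n, and W_n tends to 0. *)
Lemma integral_second_var_ge0 :
  0 <= \int[mu2]_(z in pp @^-1` U) second_var m1 m2 u g11 g12 g22 X1 X2 Y1 Y2 (pp z).
Proof.
have [oU cU UD] := rU; have mU := measurable_plane_open oU.
set S := (X in 0 <= X).
have sue : sm D (fun x => u x - e x) by sm_solve.
have [de de0 He] := margin se hopf_e; have [du du0 Hu] := margin sue hopf_ue.
have [K K0 HK] := compact_cont_bounded cU (fun x Ux =>
  differentiable_continuous (sm_diff sm_defect (UD x Ux))).
pose W n := \int[mu2]_(z in pp @^-1` U) weight n.+1%:R^-1 (hopf_sq a b (pp z)).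
have sh : sm D (hopf_sq a b) by exact: sm_hopf_sq.
have h0 x : 0 <= hopf_sq a b x by rewrite addr_ge0 ?sqr_ge0.
have W0 : W n @[n --> \oo] --> 0.
  apply: (integral_weight_cvg0 rU) => // x Dx.
  exact/differentiable_continuous/(sm_diff sh).
have [sF1 sF2] := sm_flux.
have main n : n.+1%:R^-1 <= de -> n.+1%:R^-1 <= du -> - (2^-1 * K * W n) <= S.
  move=> nde ndu; set eps := n.+1%:R^-1 : R.
  have e0 : 0 < eps by rewrite invr_gt0.
  have [sN0 sN1] := sm_null e0.
  pose G x := d0 F1 x + d1 F2 x - (d0 (N1 eps) x - d1 (N0 eps) x).
  have sG : sm D G.
    have sA := sm_pd (delta_mx 0 0) sF1; have sB := sm_pd (delta_mx 0 1) sF2.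
    have sC := sm_pd (delta_mx 0 0) sN1; have sE := sm_pd (delta_mx 0 1) sN0.
    exact: (smB oD (smD oD sA sB) (smB oD sC sE)).
  have iw : mu2.-integrable (pp @^-1` U)
      (EFin \o (fun z => weight eps (hopf_sq a b (pp z)))).
    apply: (@plane_integrable _ D U (fun x => weight eps (hopf_sq a b x)) rU) => x Dx.
    apply: weight_continuous => //.
    exact/differentiable_continuous/(sm_diff sh).
  have iwK : mu2.-integrable (pp @^-1` U)
      (EFin \o (fun z => 2^-1 * K * weight eps (hopf_sq a b (pp z)))).
    exact: (@integrableZl _ _ _ mu2 _ mU (2^-1 * K) _ iw).
  have G0 : \int[mu2]_(z in pp @^-1` U) G (pp z) = 0.
    exact: (integral_divergence_curl sF1 sF2 sN0 sN1
      (fun x Dx Ux => (flux0 Dx Ux).1) (fun x Dx Ux => (flux0 Dx Ux).2)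
      (fun x Dx Ux => (null0 eps Dx Ux).1) (fun x Dx Ux => (null0 eps Dx Ux).2)).
  have -> : - (2^-1 * K * W n) = \int[mu2]_(z in pp @^-1` U)
      (G (pp z) - 2^-1 * K * weight eps (hopf_sq a b (pp z))).
    rewrite (@RintegralB _ _ R mu2 _ _ _ mU (sm_int sG) iwK).
    by rewrite G0 sub0r (@RintegralZl _ _ R mu2 _ _ (2^-1 * K) mU iw).
  apply: le_Rintegral => //.
  - exact: (@integrableB _ _ _ mu2 _ mU _ _ (sm_int sG) iwK).
  - exact: sm_int sm_second_var.
  move=> z Uz; have Dz : D (pp z) by apply/UD/(@subset_closure _ U).
  apply: le_trans (second_var_lower oD sm1 sm2 se sa sb sg11 sg12 sg22 sX1 sX2 sY1 sY2
    m2_gt0 g11E g12E g22E stress Dz e0 (e_gt0 Dz) (ue_gt0 Dz) (He _ Uz _ e0 nde) (Hu _ Uz _ e0 ndu)).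
  rewrite /G lerD2l lerN2 -mulrA ler_wpM2l// [K * _]mulrC ler_wpM2l ?weight_ge0//.
  by apply: le_trans (ler_norm _) (HK _ _); exact: (@subset_closure _ U).
rewrite leNgt; apply/negP => S0.
have Sp : 0 < - S / (2^-1 * K) by rewrite divr_gt0 ?oppr_gt0 ?mulr_gt0.
near \oo => n.
have nd d : 0 < d -> (n.+1%:R^-1 : R) <= d -> True by [].
have n1 : (n.+1%:R^-1 : R) <= de.
  near: n; exact: (cvgr_le _ (@cvg_harmonic R)).
have n2 : (n.+1%:R^-1 : R) <= du.
  near: n; exact: (cvgr_le _ (@cvg_harmonic R)).
have Wn : W n < - S / (2^-1 * K) by near: n; exact: (cvgr_lt _ W0).
have := main n n1 n2; rewrite leNgt => /negP; apply.
by rewrite ltrNr mulrC -ltr_pdivlMr// mulr_gt0.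
Unshelve. all: by end_near. Qed.

End Integrated.

(** * Minimal graphs *)

Section Lowered.
Context {R : realType}.

(* Christoffel symbols of the first kind. *)
Definition lowered (n : nat) (g : 'rV[R]_n -> 'M[R]_n) (p : 'rV[R]_n) (i j l : 'I_n) : R :=
  2^-1 * (partial i (fun q => g q j l : R^o) p
     + partial j (fun q => g q i l : R^o) p
     - partial l (fun q => g q i j : R^o) p).

Lemma christoffel_lowered n (g : 'rV[R]_n -> 'M[R]_n) p i j l :
  g p \in unitmx -> (g p)^T = g p ->
  \sum_(k < n) christoffel g p i j k * g p k l = lowered g p i j l.
Proof.
move=> ug sg; rewrite /christoffel /lowered.
have sV : (invmx (g p))^T = invmx (g p) by rewrite trmx_inv sg.
pose L (m : 'I_n) : R := partial i (fun q => g q j m : R^o) p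
  + partial j (fun q => g q i m : R^o) p - partial m (fun q => g q i j : R^o) p.
rewrite -/(L l); under eq_bigr => k _ do rewrite -mulrA mulr_suml.
rewrite -mulr_sumr; congr (_ * _); rewrite exchange_big /=.
rewrite (bigD1 l) //= [X in _ + X]big1 ?addr0 => [|m ml].
  have := congr1 (fun M : 'M[R]_n => M l l) (mulVmx ug); rewrite !mxE eqxx => E.
  rewrite -[RHS]mul1r -[X in _ = X * _]E mulr_suml; apply: eq_bigr => k _.
  by rewrite -[in LHS]sV mxE mulrAC.
have := congr1 (fun M : 'M[R]_n => M m l) (mulVmx ug); rewrite !mxE (negbTE ml) => E.
rewrite -[RHS](mul0r (L m)) -[X in _ = X * _]E mulr_suml; apply: eq_bigr => k _.
by rewrite -[in LHS]sV mxE mulrAC.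
Qed.

(** Minimality says that the trace of the covariant Hessian equals its own tangential projection;
    [T] collects the coefficients of this projection. Lowering the index with g cancels the inverse
    of g inside [christoffel], so that the equation becomes linear in the derivatives of g. *)
Lemma mean_curvature_lowered m n (g : 'rV[R]_n -> 'M[R]_n) (F : 'rV[R]_m -> 'rV[R]_n) x :
  g (F x) \in unitmx -> (g (F x))^T = g (F x) -> mean_curvature g F x = 0 ->
  exists T : 'rV[R]_m, forall l,
    \sum_(i < m) \sum_(j < m) invmx (induced_metric g F x) i j *
      (\sum_(c < n) partial i (partial j F) x 0 c * g (F x) c l +
       \sum_(a < n) \sum_(b < n) lowered g (F x) a b l * partial i F x 0 a * partial j F x 0 b)
    = (T *m 'J F x *m g (F x)) 0 l.
Proof.
move=> ug sg H0; set Gi := invmx _.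
pose C i j := covariant_hessian g F x i j.
pose tau := \sum_(i < m) \sum_(j < m) Gi i j *: C i j.
pose T := tau *m g (F x) *m ('J F x)^T *m Gi.
have tE : tau = T *m 'J F x.
  apply/eqP; rewrite -subr_eq0 -[X in _ == X]H0; apply/eqP.
  rewrite /mean_curvature -/Gi /second_fundamental_form /tangent_part -/Gi.
  rewrite /T /tau !mulmx_suml -sumrB; apply: eq_bigr => i _.
  rewrite !mulmx_suml -sumrB; apply: eq_bigr => j _.
  by rewrite scalerBr -!scalemxAl.
exists T => l; rewrite -tE mxE /tau.
transitivity (\sum_(c < n) \sum_(i < m) \sum_(j < m) Gi i j * (C i j 0 c * g (F x) c l)).
  rewrite [RHS]exchange_big; apply: eq_bigr => i _.
  rewrite [RHS]exchange_big; apply: eq_bigr => j _.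
  rewrite -mulr_sumr; congr (_ * _).
  transitivity (\sum_(c < n) (partial i (partial j F) x 0 c * g (F x) c l +
     \sum_(a < n) \sum_(b < n) (christoffel g (F x) a b c * g (F x) c l) *
        (partial i F x 0 a * partial j F x 0 b))).
    rewrite big_split /=; congr (_ + _); rewrite [RHS]exchange_big; apply: eq_bigr => a _.
    rewrite [RHS]exchange_big; apply: eq_bigr => b _.
    by rewrite -mulr_suml christoffel_lowered// mulrA.
  apply: eq_bigr => c _; rewrite /C /covariant_hessian mxE mulrDl; congr (_ + _).
  rewrite mxE mulr_suml; apply: eq_bigr => a _; rewrite mulr_suml; apply: eq_bigr => b _.
  by rewrite -!mulrA; congr (_ * _); rewrite mulrCA mulrC -!mulrA.
apply: eq_bigr => c _; rewrite summxE mulr_suml; apply: eq_bigr => i _.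
rewrite summxE mulr_suml; apply: eq_bigr => j _.
by rewrite mulrA; congr (_ * _); rewrite [RHS]mxE.
Qed.

Lemma derive_lsub m n (W : normedModType R) (h : 'rV[R]_m -> W) (p v : 'rV[R]_(m + n)) :
  'D_v (fun q => h (lsubmx q)) p = 'D_(lsubmx v) h (lsubmx p).
Proof.
rewrite /derive; under eq_fun do rewrite /= linearP.
by [].
Qed.

Lemma derive_rsub m n (W : normedModType R) (h : 'rV[R]_n -> W) (p v : 'rV[R]_(m + n)) :
  'D_v (fun q => h (rsubmx q)) p = 'D_(rsubmx v) h (rsubmx p).
Proof.
rewrite /derive; under eq_fun do rewrite /= linearP.
by [].
Qed.

Lemma sub_delta m n :
  [/\ forall i : 'I_m, lsubmx (delta_mx 0 (lshift n i) : 'rV[R]_(m + n)) = delta_mx 0 i,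
      forall i : 'I_m, rsubmx (delta_mx 0 (lshift n i) : 'rV[R]_(m + n)) = 0,
      forall i : 'I_n, lsubmx (delta_mx 0 (rshift m i) : 'rV[R]_(m + n)) = 0 &
      forall i : 'I_n, rsubmx (delta_mx 0 (rshift m i) : 'rV[R]_(m + n)) = delta_mx 0 i].
Proof.
split => i; apply/rowP => j; rewrite !mxE ?eqxx /= -?val_eqE /=.
- by [].
- by rewrite gtn_eqF// ltn_addr.
- by rewrite ltn_eqF// ltn_addr.
- by rewrite eqn_add2l.
Qed.

Section Product.
Variables (m n : nat) (g : 'rV[R]_m -> 'M[R]_m) (h : 'rV[R]_n -> 'M[R]_n).
Local Notation P := (product_metric g h).

Lemma partial_product (p : 'rV[R]_(m + n)) :
  [/\ forall i j k, partial (lshift n i) (fun q => P q (lshift n j) (lshift n k) : R^o) p =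
        partial i (fun q => g q j k : R^o) (lsubmx p),
      forall i j k, partial (rshift m i) (fun q => P q (lshift n j) (lshift n k) : R^o) p = 0,
      forall i j k, partial (lshift n i) (fun q => P q (rshift m j) (rshift m k) : R^o) p = 0 &
      forall i j k, partial (rshift m i) (fun q => P q (rshift m j) (rshift m k) : R^o) p =
        partial i (fun q => h q j k : R^o) (rsubmx p)].
Proof.
have [d1 d2 d3 d4] := sub_delta m n.
split => i j k; rewrite /partial /product_metric.
- under eq_fun do rewrite block_mxEul.
  by rewrite (derive_lsub (fun q => g q j k : R^o)) d1.
- under eq_fun do rewrite block_mxEul.
  by rewrite (derive_lsub (fun q => g q j k : R^o)) d3 derive0.
- under eq_fun do rewrite block_mxEdr.
  by rewrite (derive_rsub (fun q => h q j k : R^o)) d2 derive0.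
- under eq_fun do rewrite block_mxEdr.
  by rewrite (derive_rsub (fun q => h q j k : R^o)) d4.
Qed.

Lemma partial_product_mixed (p : 'rV[R]_(m + n)) i j k :
  partial i (fun q => P q (lshift n j) (rshift m k) : R^o) p = 0 /\
  partial i (fun q => P q (rshift m k) (lshift n j) : R^o) p = 0.
Proof.
split; rewrite /partial /product_metric.
  under eq_fun do rewrite block_mxEur mxE.
  exact: derive_cst.
under eq_fun do rewrite block_mxEdl mxE.
exact: derive_cst.
Qed.

Lemma lowered_product (p : 'rV[R]_(m + n)) :
  [/\ forall i j k, lowered P p (lshift n i) (lshift n j) (lshift n k) = lowered g (lsubmx p) i j k,
      forall i j k, lowered P p (rshift m i) (rshift m j) (rshift m k) = lowered h (rsubmx p) i j k &
  [/\ forall i j k, lowered P p (lshift n i) (rshift m j) (lshift n k) = 0,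
      forall i j k, lowered P p (rshift m i) (lshift n j) (lshift n k) = 0 &
      forall i j k, lowered P p (rshift m i) (rshift m j) (lshift n k) = 0] /\
  [/\ forall i j k, lowered P p (lshift n i) (rshift m j) (rshift m k) = 0,
      forall i j k, lowered P p (rshift m i) (lshift n j) (rshift m k) = 0 &
      forall i j k, lowered P p (lshift n i) (lshift n j) (rshift m k) = 0]].
Proof.
have [p1 p2 p3 p4] := partial_product p; have mx := partial_product_mixed p.
have m1 i j k := (mx i j k).1; have m2 i j k := (mx i j k).2.
split=> [i j k|i j k|]; rewrite /lowered ?p1 ?p4//.
by split; split=> i j k; rewrite /lowered ?(p1, p2, p3, p4, m1, m2) ?(addr0, subr0, mulr0).
Qed.
End Product.
End Lowered.

(** * Christoffel symbols of a pulled back metric *)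

Section Pullback.
Context {R : realType}.
Local Notation V2 := 'rV[R]_2.

Lemma ord2E (i : 'I_2) : i = 0 \/ i = 1.
Proof. by case: i => [[|[|//]] ?]; [left|right]; apply: val_inj. Qed.

Lemma big_ord2 (F : 'I_2 -> R) : \sum_(i < 2) F i = F 0 + F 1.
Proof. by rewrite big_ord_recl big_ord1; congr (_ + F _); apply: val_inj. Qed.

Lemma mulmxE2 m n (A : 'M[R]_(m, 2)) (B : 'M[R]_(2, n)) i j :
  (A *m B) i j = A i 0 * B 0 j + A i 1 * B 1 j.
Proof. by rewrite mxE big_ord2. Qed.

Lemma partialE n (D : set 'rV[R]_n) m k (M : 'rV[R]_n -> 'M[R]_(m, k)) i j l x :
  open D -> D x -> smooth_on D M ->
  partial i M x j l = pd (delta_mx 0 i) (fun y => M y j l) x.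
Proof. by move=> oD Dx sM; rewrite (smooth_coordP _ _ _ oD Dx sM). Qed.

Lemma jacobianE n (D : set 'rV[R]_n) m (f : 'rV[R]_n -> 'rV[R]_m) i j x :
  open D -> D x -> smooth_on D f ->
  ('J f x) i j = pd (delta_mx 0 i) (fun y => f y 0 j) x.
Proof.
move=> oD Dx sf; rewrite (smooth_coordP _ _ _ oD Dx sf) deriveE.
  by rewrite /jacobian /lin1_mx mxE.
by move/smooth_onE: sf => [+ _]; apply.
Qed.

(** [p1] and [p2] stand for the first and second derivatives of f, [A] and [dA] for h and its
    derivatives at f(x), and [dg] for the expanded derivative of the pulled back metric. In the
    combination on the left all second derivatives cancel except [p2 i j]. *)
Lemma lowered_pullback_algebra (p1 : 'I_2 -> 'I_2 -> R) (p2 dA : 'I_2 -> 'I_2 -> 'I_2 -> R)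
    (A : 'M[R]_2) i j k :
  let dg m p q := p2 m p 0 * A 0 0 * p1 q 0 +
    (p2 m p 0 * p1 q 1 + p2 m p 1 * p1 q 0) * A 0 1 + p2 m p 1 * A 1 1 * p1 q 1 +
    p1 p 0 * A 0 0 * p2 m q 0 +
    (p1 p 0 * p2 m q 1 + p1 p 1 * p2 m q 0) * A 0 1 + p1 p 1 * A 1 1 * p2 m q 1 +
    (p1 p 0 * (dA 0 0 0 * p1 m 0 + dA 1 0 0 * p1 m 1) * p1 q 0 +
     (p1 p 0 * p1 q 1 + p1 p 1 * p1 q 0) * (dA 0 0 1 * p1 m 0 + dA 1 0 1 * p1 m 1) +
     p1 p 1 * (dA 0 1 1 * p1 m 0 + dA 1 1 1 * p1 m 1) * p1 q 1) in
  A 1 0 = A 0 1 -> (forall v, dA v 1 0 = dA v 0 1) ->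
  (forall a b c, p2 a b c = p2 b a c) ->
  2^-1 * (dg i j k + dg j i k - dg k i j) =
  \sum_(l < 2) (\sum_(c < 2) p2 i j c * A c l +
    \sum_(a < 2) \sum_(b < 2)
      2^-1 * (dA a b l + dA b a l - dA l a b) * p1 i a * p1 j b) * p1 k l.
Proof.
move=> dg A10 dA10 p2C; rewrite !big_ord2 /dg !dA10 A10.
by rewrite (p2C j i 0) (p2C j i 1) (p2C k i 0) (p2C k i 1) (p2C k j 0) (p2C k j 1); field.
Qed.

Variables (D E : set V2) (h : V2 -> 'M[R]_2) (f : V2 -> V2).
Hypotheses (oD : open D) (oE : open E) (sh : smooth_on E h) (sf : smooth_on D f)
  (fDE : forall x, D x -> E (f x)) (hT : forall y, E y -> (h y)^T = h y).

Local Notation e_ i := (delta_mx 0 i).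
Local Notation F a := (fun y => f y 0 a).
Local Notation H a b := (fun y => h y a b).

Lemma sym_entry x : E x -> h x 1 0 = h x 0 1.
Proof. by move=> Ex; rewrite -[in LHS](hT Ex) mxE. Qed.

Lemma induced_metricE x i j : D x -> induced_metric h f x i j =
  pd (e_ i) (F 0) x * h (f x) 0 0 * pd (e_ j) (F 0) x +
  (pd (e_ i) (F 0) x * pd (e_ j) (F 1) x + pd (e_ i) (F 1) x * pd (e_ j) (F 0) x) * h (f x) 0 1 +
  pd (e_ i) (F 1) x * h (f x) 1 1 * pd (e_ j) (F 1) x.
Proof.
move=> Dx; rewrite /induced_metric !mulmxE2 ![(_^T) _ _]mxE.
rewrite !(jacobianE _ _ oD Dx sf) (sym_entry (fDE Dx)).
by generalize (h (f x)) => A; gen_pd; intros; ring.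
Qed.

Lemma lowered_pullback x i j k : D x -> lowered (induced_metric h f) x i j k =
  \sum_(l < 2) (\sum_(c < 2) partial i (partial j f) x 0 c * h (f x) c l +
    \sum_(a < 2) \sum_(b < 2) lowered h (f x) a b l * partial i f x 0 a * partial j f x 0 b)
    * partial k f x 0 l.
Proof.
move=> Dx; have Ex := fDE Dx.
have sF a : sm D (F a) by exact: sm_coord.
have sH a b : sm E (H a b) by exact: sm_coord.
have dH a b v := isder_comp v oD Dx Ex sf (sH a b).
have dg m p q : pd (e_ m) (fun y => induced_metric h f y p q) x =
  pd (e_ m) (pd (e_ p) (F 0)) x * h (f x) 0 0 * pd (e_ q) (F 0) x +
  (pd (e_ m) (pd (e_ p) (F 0)) x * pd (e_ q) (F 1) x +
    pd (e_ m) (pd (e_ p) (F 1)) x * pd (e_ q) (F 0) x) * h (f x) 0 1 +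
  pd (e_ m) (pd (e_ p) (F 1)) x * h (f x) 1 1 * pd (e_ q) (F 1) x +
  pd (e_ p) (F 0) x * h (f x) 0 0 * pd (e_ m) (pd (e_ q) (F 0)) x +
  (pd (e_ p) (F 0) x * pd (e_ m) (pd (e_ q) (F 1)) x +
    pd (e_ p) (F 1) x * pd (e_ m) (pd (e_ q) (F 0)) x) * h (f x) 0 1 +
  pd (e_ p) (F 1) x * h (f x) 1 1 * pd (e_ m) (pd (e_ q) (F 1)) x +
  (pd (e_ p) (F 0) x * (pd (e_ 0) (H 0 0) (f x) * pd (e_ m) (F 0) x +
    pd (e_ 1) (H 0 0) (f x) * pd (e_ m) (F 1) x) * pd (e_ q) (F 0) x +
  (pd (e_ p) (F 0) x * pd (e_ q) (F 1) x + pd (e_ p) (F 1) x * pd (e_ q) (F 0) x) *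
    (pd (e_ 0) (H 0 1) (f x) * pd (e_ m) (F 0) x + pd (e_ 1) (H 0 1) (f x) * pd (e_ m) (F 1) x) +
  pd (e_ p) (F 1) x * (pd (e_ 0) (H 1 1) (f x) * pd (e_ m) (F 0) x +
    pd (e_ 1) (H 1 1) (f x) * pd (e_ m) (F 1) x) * pd (e_ q) (F 1) x).
  apply: (pd_isder oD Dx (fun y Dy => induced_metricE p q Dy)).
    have d00 := dH 0 0 (e_ m); have d01 := dH 0 1 (e_ m); have d11 := dH 1 1 (e_ m).
    move: d00 d01 d11; rewrite !big_ord2 => d00 d01 d11.
    by repeat lazymatch goal with
     | |- isder _ _ (fun y => h _ 0 0) _ => exact: d00
     | |- isder _ _ (fun y => h _ 0 1) _ => exact: d01
     | |- isder _ _ (fun y => h _ 1 1) _ => exact: d11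
     | |- isder _ _ (fun y => _ + _) _ => apply: isderD
     | |- isder _ _ (fun y => _ * _) _ => apply: isderM
     | |- isder _ _ ?G _ => apply: (isder_sm (f := G)); [apply: sm_pd; exact: sF|exact: Dx]
    end.
  by rewrite /= !big_ord2; clear; generalize (h (f x)) => A; gen_pd; intros; ring.
have p2 a b c : partial a (partial b f) x 0 c = pd (e_ a) (pd (e_ b) (F c)) x.
  rewrite (@partialE _ D)//; last by move/smooth_onE: sf => [_]; exact.
  by apply: (pd_eq _ oD Dx) => y Dy; rewrite (@partialE _ D).
have p1 a c : partial a f x 0 c = pd (e_ a) (F c) x by rewrite (@partialE _ D).
have LH a b l : lowered h (f x) a b l = 2^-1 * (pd (e_ a) (H b l) (f x) +
  pd (e_ b) (H a l) (f x) - pd (e_ l) (H a b) (f x)) by [].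
have LG : lowered (induced_metric h f) x i j k =
  2^-1 * (pd (e_ i) (fun y => induced_metric h f y j k) x +
  pd (e_ j) (fun y => induced_metric h f y i k) x -
  pd (e_ k) (fun y => induced_metric h f y i j) x) by [].
have H10 v : pd v (H 1 0) (f x) = pd v (H 0 1) (f x).
  by apply: (pd_eq _ oE Ex) => y Ey; rewrite sym_entry.
have C a b c : pd (e_ a) (pd (e_ b) (F c)) x = pd (e_ b) (pd (e_ a) (F c)) x by exact: (pd_comm _ _ oD Dx (sF c)).
transitivity (\sum_(l < 2) (\sum_(c < 2) pd (e_ i) (pd (e_ j) (F c)) x * h (f x) c l +
    \sum_(a < 2) \sum_(b < 2) 2^-1 * (pd (e_ a) (H b l) (f x) +
      pd (e_ b) (H a l) (f x) - pd (e_ l) (H a b) (f x)) *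
      pd (e_ i) (F a) x * pd (e_ j) (F b) x) * pd (e_ k) (F l) x); last first.
  apply: eq_bigr => l _; congr ((_ + _) * _); last exact/esym/p1.
    by apply: eq_bigr => c _; congr (_ * _); exact/esym/p2.
  apply: eq_bigr => a _; apply: eq_bigr => b _.
  exact: (congr2 *%R (congr2 *%R (esym (LH a b l)) (esym (p1 i a))) (esym (p1 j b))).
rewrite LG (dg i j k) (dg j i k) (dg k i j).
exact: (@lowered_pullback_algebra (fun a b => pd (e_ a) (F b) x)
  (fun a b c => pd (e_ a) (pd (e_ b) (F c)) x)
  (fun a b c => pd (e_ a) (H b c) (f x)) (h (f x)) i j k (sym_entry Ex) (fun v => H10 (e_ v)) C).
Qed.
End Pullback.

(** * The minimality equations of a graph *)

Section Graph.
Context {R : realType}.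
Local Notation V2 := 'rV[R]_2.

Lemma posdef_unit n (A : 'M[R]_n) :
  (forall v : 'rV_n, v != 0 -> 0 < (v *m A *m v^T) 0 0) -> A \in unitmx.
Proof.
move=> A0; rewrite -row_free_unit -kermx_eq0; apply: contraT => /rowV0Pn[v /sub_kermxP vA v0].
by have := A0 v v0; rewrite vA mul0mx mxE ltxx.
Qed.

Lemma smooth_id (V : normedModType R) (D : set V) : open D -> smooth_on D (id : V -> V).
Proof.
move=> oD; apply/class_CP => -[|k]; split => // [v].
apply: (class_C_eq (f := cst v)) => //; last exact: class_C_cst.
by move=> x _; rewrite derive_id.
Qed.

Lemma pd_coord n (i : 'I_n) (v x : 'rV[R]_n) : pd v (fun y : 'rV[R]_n => y 0 i) x = v 0 i.
Proof.
have oT := @openT 'rV[R]_n.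
by rewrite (smooth_coordP 0 i v oT (I : setT x) (smooth_id oT)) derive_id.
Qed.

Variables (D E : set V2) (s1 s2 : V2 -> 'M[R]_2) (f : V2 -> V2).
Hypotheses (oD : open D) (oE : open E) (m1 : riemannian_metric D s1)
  (m2 : riemannian_metric E s2) (sf : smooth_on D f)
  (fDE : forall x, D x -> E (f x)).

Local Notation e_ i := (delta_mx 0 i).
Local Notation P := (product_metric s1 s2).
Local Notation F := (graph_map f).

Lemma graph_map_lshift y i : F y 0 (lshift 2 i) = y 0 i.
Proof. by rewrite /graph_map row_mxEl. Qed.
Lemma graph_map_rshift y i : F y 0 (rshift 2 i) = f y 0 i.
Proof. by rewrite /graph_map row_mxEr. Qed.

Lemma smooth_graph : smooth_on D F.
Proof.
apply: smooth_on_mx => // k i; rewrite {k}ord1; case: (split_ordP i) => j ->.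
  apply: (@sm_eq _ _ _ (fun y : V2 => y 0 j)) => //; last exact: sm_coord (smooth_id oD).
  by move=> y _; rewrite graph_map_lshift.
apply: (@sm_eq _ _ _ (fun y : V2 => f y 0 j)) => //; last exact: sm_coord sf.
by move=> y _; rewrite graph_map_rshift.
Qed.

Lemma jacobian_graph x : D x -> 'J F x = row_mx 1%:M ('J f x).
Proof.
move=> Dx; apply/matrixP => i c; rewrite (jacobianE _ _ oD Dx smooth_graph).
case: (split_ordP c) => j ->.
  have -> : (fun y => F y 0 (lshift 2 j)) = (fun y : V2 => y 0 j).
    by apply/funext => y; rewrite graph_map_lshift.
  by rewrite pd_coord row_mxEl !mxE eqxx eq_sym.
rewrite row_mxEr (jacobianE _ _ oD Dx sf).
have -> // : (fun y => F y 0 (rshift 2 j)) = (fun y => f y 0 j).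
by apply/funext => y; rewrite graph_map_rshift.
Qed.

Lemma induced_graph x : D x -> induced_metric P F x = s1 x + induced_metric s2 f x.
Proof.
move=> Dx; rewrite /induced_metric jacobian_graph// /product_metric /graph_map.
rewrite row_mxKl row_mxKr mul_row_block !mul1mx !mulmx0 addr0 add0r.
by rewrite tr_row_mx mul_row_col trmx1 mulmx1.
Qed.

Lemma partial_graph x i : D x -> partial i F x = row_mx (e_ i) (partial i f x).
Proof.
move=> Dx; apply/rowP => c; rewrite (partialE _ _ _ oD Dx smooth_graph).
rewrite -(jacobianE _ _ oD Dx smooth_graph) jacobian_graph//.
case: (split_ordP c) => j ->.
  by rewrite !row_mxEl !mxE eqxx eq_sym.
by rewrite !row_mxEr (partialE _ _ _ oD Dx sf) (jacobianE _ _ oD Dx sf).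
Qed.

Lemma partial2_graph x i j : D x ->
  partial i (partial j F) x = row_mx 0 (partial i (partial j f) x).
Proof.
move=> Dx; have sv (h : V2 -> 'rV[R]_(2 + 2)) v : smooth_on D h -> smooth_on D ('D_v h).
  by move=> /smooth_onE[_]; exact.
have sv' v : smooth_on D ('D_v f) by move/smooth_onE: sf => [_]; exact.
apply/rowP => c; rewrite (partialE _ _ _ oD Dx (sv _ _ smooth_graph)).
case: (split_ordP c) => l ->.
  rewrite row_mxEl mxE; apply: (pd_isder oD Dx (g := cst (e_ j 0 l)) _ (isder_cst _ _ _)) => //.
  by move=> y Dy; rewrite -[LHS]/(partial j F y 0 (lshift 2 l)) partial_graph// row_mxEl.
rewrite row_mxEr (partialE _ _ _ oD Dx (sv' _)).
apply: (pd_eq _ oD Dx) => y Dy.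
by rewrite -[LHS]/(partial j F y 0 (rshift 2 l)) partial_graph// row_mxEr.
Qed.

(** Both factors of the product give an equation with the same [T]. On the first factor the graph
    map is the identity, without second derivatives, so only the symbols of [s1] survive. The
    equation on the second factor is contracted with the Jacobian of f and rewritten by
    [lowered_pullback]. *)
Lemma minimal_graph_balance x : D x -> mean_curvature P F x = 0 ->
  let Gi := invmx (s1 x + induced_metric s2 f x) in
  exists T : V2, forall k,
    \sum_(i < 2) \sum_(j < 2) Gi i j * lowered s1 x i j k = (T *m s1 x) 0 k /\
    \sum_(i < 2) \sum_(j < 2) Gi i j * lowered (induced_metric s2 f) x i j k =
      (T *m induced_metric s2 f x) 0 k.
Proof.
move=> Dx H0 Gi; have Ex := fDE Dx.
have [ss1 s1T s1P] := m1; have [ss2 s2T s2P] := m2.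
have Fl : lsubmx (F x) = x by rewrite row_mxKl.
have Fr : rsubmx (F x) = f x by rewrite row_mxKr.
have PF : P (F x) = block_mx (s1 x) 0 0 (s2 (f x)) by rewrite /product_metric Fl Fr.
have uP : P (F x) \in unitmx.
  rewrite PF unitmxE det_ublock unitrM -!unitmxE.
  by apply/andP; split; apply: posdef_unit => v; [exact: s1P|exact: s2P].
have PT : (P (F x))^T = P (F x).
  by rewrite PF tr_block_mx s1T// s2T// !trmx0.
have [T HT] := mean_curvature_lowered uP PT H0.
have [lo1 lo2 [[lo3 lo4 lo5] [lo6 lo7 lo8]]] := lowered_product s1 s2 (F x).
rewrite Fl Fr in lo1 lo2.
have JP : 'J F x *m P (F x) = row_mx (s1 x) ('J f x *m s2 (f x)).
  by rewrite jacobian_graph// PF mul_row_block !mul1mx !mulmx0 addr0 add0r.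
exists T => k; split.
  have := HT (lshift 2 k); rewrite -mulmxA JP mul_mx_row row_mxEl => <-.
  rewrite induced_graph// -/Gi; apply: eq_bigr => i _; apply: eq_bigr => j _.
  congr (_ * _); rewrite partial2_graph// !big_split_ord /= !partial_graph// PF.
  generalize (partial i f x) (partial j f x) (partial i (partial j f) x) => fi fj fij.
  rewrite big1 => [|c _]; last by rewrite row_mxEl [X in X * _]mxE mul0r.
  rewrite big1 => [|c _]; last by rewrite block_mxEdl [X in _ * X]mxE mulr0.
  rewrite !add0r [X in _ = _ + X]big1 => [|a _]; last first.
    rewrite big_split_ord /= !big1 ?addr0// => b _; rewrite ?lo4 ?lo5 ?mul0r//.
  rewrite addr0 (bigD1 i)//= [X in _ = _ + X]big1 ?addr0 => [|a ai]; last first.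
    by rewrite big1// => b _; rewrite !row_mxEl !mxE (negbTE ai) andbF mulr0 mul0r.
  rewrite big_split_ord /= [X in _ = _ + X]big1 ?addr0 => [|b _]; last by rewrite lo3 !mul0r.
  rewrite (bigD1 j)//= [X in _ = _ + X]big1 ?addr0 => [|b bj]; last first.
    by rewrite !row_mxEl !mxE (negbTE bj) andbF mulr0.
  by rewrite lo1 !row_mxEl !mxE !eqxx !mulr1.
have HT2 l : (T *m ('J f x *m s2 (f x))) 0 l =
   \sum_(i < 2) \sum_(j < 2) Gi i j * (\sum_(c < 2) partial i (partial j f) x 0 c * s2 (f x) c l +
    \sum_(a < 2) \sum_(b < 2) lowered s2 (f x) a b l * partial i f x 0 a * partial j f x 0 b).
  have := HT (rshift 2 l); rewrite -mulmxA JP mul_mx_row row_mxEr => <-.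
  rewrite induced_graph// -/Gi; apply: eq_bigr => i _; apply: eq_bigr => j _.
  congr (_ * _); rewrite partial2_graph// !big_split_ord /= !partial_graph// PF.
  generalize (partial i f x) (partial j f x) (partial i (partial j f) x) => fi fj fij.
  rewrite big1 ?add0r => [|c _]; last by rewrite row_mxEl [X in X * _]mxE mul0r.
  congr (_ + _); first by apply: eq_bigr => c _; rewrite row_mxEr block_mxEdr.
  rewrite big1 ?add0r => [|a _]; last first.
    by rewrite big_split_ord /= !big1 ?addr0// => b _; rewrite ?lo6 ?lo8 !mul0r.
  apply: eq_bigr => a _; rewrite big_split_ord /= big1 ?add0r => [|b _]; last by rewrite lo7 !mul0r.
  by apply: eq_bigr => b _; rewrite lo2 !row_mxEr.
rewrite /induced_metric !mulmxA -[T *m _ *m _]mulmxA mxE.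
under [RHS]eq_bigr => l _ do rewrite HT2 mulr_suml.
rewrite [RHS]exchange_big; apply: eq_bigr => i _.
under [RHS]eq_bigr => l _ do rewrite mulr_suml.
rewrite [RHS]exchange_big; apply: eq_bigr => j _.
rewrite -/(induced_metric s2 f) (@lowered_pullback _ D E)// mulr_sumr; apply: eq_bigr => l _.
rewrite mulrA; congr (_ * _).
by rewrite [RHS]mxE (jacobianE _ _ oD Dx sf) (partialE _ _ _ oD Dx sf).
Qed.
End Graph.

(** The classical formula d_i(sqrt(det G) G^ij) = - sqrt(det G) G^kl Gamma^j_kl, where the a's and
    b's are the partial derivatives of the entries of G in the two directions. The hypotheses say
    that the contracted Christoffel symbols of G are the components of T. *)
Lemma conf_divergence (R : realType) (G11 G12 G22 u a11 a12 a22 b11 b12 b22 t1 t2 : R) :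
  0 < u -> u ^+ 2 = G11 * G22 - G12 ^+ 2 ->
  G22 * (a11 / 2) - 2 * (G12 * (b11 / 2)) + G11 * (b12 - a22 / 2) =
    u ^+ 2 * (G11 * t1 + G12 * t2) ->
  G22 * (a12 - b11 / 2) - 2 * (G12 * (a22 / 2)) + G11 * (b22 / 2) =
    u ^+ 2 * (G12 * t1 + G22 * t2) ->
  let du d11 d12 d22 := (d11 * G22 + G11 * d22 - 2 * (G12 * d12)) / (2 * u) in
  let u1 := du a11 a12 a22 in let u2 := du b11 b12 b22 in
  (a22 - G22 * u1 / u) / u - (b12 - G12 * u2 / u) / u = - (u * t1) /\
  - ((a12 - G12 * u1 / u) / u) + (b11 - G11 * u2 / u) / u = - (u * t2).
Proof.
move=> u0 uE B1 B2 du u1 u2; have un := lt0r_neq0 u0.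
have u3n : u ^+ 3 != 0 by rewrite expf_neq0.
have E1 : u ^+ 3 * ((a22 - G22 * u1 / u) / u - (b12 - G12 * u2 / u) / u) =
    u ^+ 2 * a22 - G22 * (a11 * G22 + G11 * a22 - 2 * (G12 * a12)) / 2
    - (u ^+ 2 * b12 - G12 * (b11 * G22 + G11 * b22 - 2 * (G12 * b12)) / 2).
  by rewrite /u1 /u2 /du; field.
have E2 : u ^+ 3 * (- ((a12 - G12 * u1 / u) / u) + (b11 - G11 * u2 / u) / u) =
    - (u ^+ 2 * a12 - G12 * (a11 * G22 + G11 * a22 - 2 * (G12 * a12)) / 2)
    + (u ^+ 2 * b11 - G11 * (b11 * G22 + G11 * b22 - 2 * (G12 * b12)) / 2).
  by rewrite /u1 /u2 /du; field.
split; apply: (mulfI u3n).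
- rewrite E1 (_ : u ^+ 3 * - (u * t1) = - (G22 * (u ^+ 2 * (G11 * t1 + G12 * t2)) -
      G12 * (u ^+ 2 * (G12 * t1 + G22 * t2)))).
    by rewrite -B1 -B2 uE; field.
  have -> : u ^+ 3 * - (u * t1) = - (u ^+ 2 * u ^+ 2 * t1) by ring.
  by rewrite uE; ring.
- rewrite E2 (_ : u ^+ 3 * - (u * t2) = - (G11 * (u ^+ 2 * (G12 * t1 + G22 * t2)) -
      G12 * (u ^+ 2 * (G11 * t1 + G12 * t2)))).
    by rewrite -B1 -B2 uE; field.
  have -> : u ^+ 3 * - (u * t2) = - (u ^+ 2 * u ^+ 2 * t2) by ring.
  by rewrite uE; ring.
Qed.

Lemma invmx2 (F : fieldType) (A : 'M[F]_2) (d : F) :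
  d = A 0 0 * A 1 1 - A 0 1 * A 1 0 -> A \in unitmx ->
  [/\ d * invmx A 0 0 = A 1 1, d * invmx A 0 1 = - A 0 1,
      d * invmx A 1 0 = - A 1 0 & d * invmx A 1 1 = A 0 0].
Proof.
move=> -> uA; have E i j : \sum_(k < 2) invmx A i k * A k j = (i == j)%:R.
  by have := congr1 (fun M : 'M[F]_2 => M i j) (mulVmx uA); rewrite !mxE.
have E2 i j : invmx A i 0 * A 0 j + invmx A i 1 * A 1 j = (i == j)%:R.
  by rewrite -E big_ord_recl big_ord1; congr (_ + invmx A i _ * A _ j); apply: val_inj.
have := E2 0 0; have := E2 0 1; have := E2 1 0; have := E2 1 1; rewrite !eqxx /=.
generalize (invmx A) => B e11 e10 e01 e00; split.
- transitivity ((B 0 0 * A 0 0 + B 0 1 * A 1 0) * A 1 1 - (B 0 0 * A 0 1 + B 0 1 * A 1 1) * A 1 0).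
    by ring.
  by rewrite e00 e01; ring.
- transitivity ((B 0 0 * A 0 1 + B 0 1 * A 1 1) * A 0 0 - (B 0 0 * A 0 0 + B 0 1 * A 1 0) * A 0 1).
    by ring.
  by rewrite e00 e01; ring.
- transitivity ((B 1 0 * A 0 0 + B 1 1 * A 1 0) * A 1 1 - (B 1 0 * A 0 1 + B 1 1 * A 1 1) * A 1 0).
    by ring.
  by rewrite e10 e11; ring.
- transitivity ((B 1 0 * A 0 1 + B 1 1 * A 1 1) * A 0 0 - (B 1 0 * A 0 0 + B 1 1 * A 1 0) * A 0 1).
    by ring.
  by rewrite e10 e11; ring.
Qed.

Lemma trace_lowered_algebra (R : realType) (I M : 'M[R]_2) (L dM : 'I_2 -> 'I_2 -> 'I_2 -> R)
    (T : 'rV[R]_2) (G11 G12 G22 d : R) :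
  d * I 0 0 = G22 -> d * I 0 1 = - G12 -> d * I 1 0 = - G12 -> d * I 1 1 = G11 ->
  (forall a b l, L a b l = 2^-1 * (dM a b l + dM b a l - dM l a b)) ->
  (forall v, dM v 1 0 = dM v 0 1) -> M 1 0 = M 0 1 ->
  (forall k, \sum_(i < 2) \sum_(j < 2) I i j * L i j k = (T *m M) 0 k) ->
  G22 * (dM 0 0 0 / 2) - 2 * (G12 * (dM 1 0 0 / 2)) + G11 * (dM 1 0 1 - dM 0 1 1 / 2) =
    d * (M 0 0 * T 0 0 + M 0 1 * T 0 1) /\
  G22 * (dM 0 0 1 - dM 1 0 0 / 2) - 2 * (G12 * (dM 0 1 1 / 2)) + G11 * (dM 1 1 1 / 2) =
    d * (M 0 1 * T 0 0 + M 1 1 * T 0 1).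
Proof.
move=> i00 i01 i10 i11 LE dM10 M10 HT; have := HT 0; have := HT 1.
rewrite !mulmxE2 !big_ord2 M10 !LE !dM10 => HT1 HT0.
rewrite (_ : M 0 0 * T 0 0 + M 0 1 * T 0 1 = T 0 0 * M 0 0 + T 0 1 * M 0 1); last by ring.
rewrite (_ : M 0 1 * T 0 0 + M 1 1 * T 0 1 = T 0 0 * M 0 1 + T 0 1 * M 1 1); last by ring.
rewrite -HT0 -HT1.
rewrite !mulrDr ![d * (_ * _)]mulrA i00 i01 i10 i11.
by split; field.
Qed.

(** The stress equation amounts to (d_i P^ik) g_kl + P^ij Gamma_ijl = 0, with Gamma the symbols of
    the first kind of g. The first term is - u (T g)_l by [conf_divergence], and the second is u (T
    g)_l by the balance of g. *)
Lemma stress_algebra (R : realType) (G11 G12 G22 u h11 h12 h22 q11 q12 r12 q22 t1 t2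
    d11 d12 d22 e11 e12 e22 : R) :
  0 < u -> q11 - q12 = - (u * t1) -> - r12 + q22 = - (u * t2) ->
  G22 * (d11 / 2) - 2 * (G12 * (e11 / 2)) + G11 * (e12 - d22 / 2) =
    u ^+ 2 * (h11 * t1 + h12 * t2) ->
  G22 * (d12 - e11 / 2) - 2 * (G12 * (d22 / 2)) + G11 * (e22 / 2) =
    u ^+ 2 * (h12 * t1 + h22 * t2) ->
  q11 * h11 + G22 / u * d11 + - r12 * h12 + - (G12 / u) * d12 +
    (- q12 * h11 + - (G12 / u) * e11 + q22 * h12 + G11 / u * e12) =
    2^-1 * (G22 / u * d11 + 2 * (- (G12 / u) * d12) + G11 / u * d22) /\
  q11 * h12 + G22 / u * d12 + - r12 * h22 + - (G12 / u) * d22 +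
    (- q12 * h12 + - (G12 / u) * e12 + q22 * h22 + G11 / u * e22) =
    2^-1 * (G22 / u * e11 + 2 * (- (G12 / u) * e12) + G11 / u * e22).
Proof.
move=> u0 C1 C2 g1 g2; have un := lt0r_neq0 u0.
have E1 : h11 * t1 + h12 * t2 =
    (G22 * (d11 / 2) - 2 * (G12 * (e11 / 2)) + G11 * (e12 - d22 / 2)) / u ^+ 2.
  by rewrite g1; field.
have E2 : h12 * t1 + h22 * t2 =
    (G22 * (d12 - e11 / 2) - 2 * (G12 * (d22 / 2)) + G11 * (e22 / 2)) / u ^+ 2.
  by rewrite g2; field.
split.
  transitivity (h11 * (q11 - q12) + h12 * (- r12 + q22) + G22 / u * d11 - G12 / u * d12
    - G12 / u * e11 + G11 / u * e12); first by field.
  rewrite C1 C2 (_ : h11 * - (u * t1) + h12 * - (u * t2) = - u * (h11 * t1 + h12 * t2)); last by ring.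
  by rewrite E1; field.
transitivity (h12 * (q11 - q12) + h22 * (- r12 + q22) + G22 / u * d12 - G12 / u * d22
    - G12 / u * e12 + G11 / u * e22); first by field.
rewrite C1 C2 (_ : h12 * - (u * t1) + h22 * - (u * t2) = - u * (h12 * t1 + h22 * t2)); last by ring.
by rewrite E2; field.
Qed.

Section StressFree.
Context {R : realType}.
Local Notation V2 := 'rV[R]_2.
Variables (D : set V2) (S g : V2 -> 'M[R]_2) (u : V2 -> R).
Hypotheses (oD : open D) (sS : smooth_on D S) (sg : smooth_on D g) (su : sm D u)
  (ST : forall x, D x -> (S x)^T = S x) (gT : forall x, D x -> (g x)^T = g x)
  (u_gt0 : forall x, D x -> 0 < u x)
  (uE : forall x, D x -> u x ^+ 2 = (S x 0 0 + g x 0 0) * (S x 1 1 + g x 1 1) -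
     (S x 0 1 + g x 0 1) ^+ 2).

Local Notation S11 := (fun y => S y 0 0).
Local Notation S12 := (fun y => S y 0 1).
Local Notation S22 := (fun y => S y 1 1).
Local Notation g11 := (fun y => g y 0 0).
Local Notation g12 := (fun y => g y 0 1).
Local Notation g22 := (fun y => g y 1 1).
Local Notation P11 := (fun y => (S y 1 1 + g y 1 1) / u y).
Local Notation P12 := (fun y => - ((S y 0 1 + g y 0 1) / u y)).
Local Notation P22 := (fun y => (S y 0 0 + g y 0 0) / u y).

Lemma trace_lowered (M : V2 -> 'M[R]_2) x (T : V2) : D x -> smooth_on D M ->
  (forall y, D y -> (M y)^T = M y) -> S x + g x \in unitmx ->
  (forall k, \sum_(i < 2) \sum_(j < 2) invmx (S x + g x) i j * lowered M x i j k = (T *m M x) 0 k) ->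
  let m11 := (fun y => M y 0 0) in let m12 := (fun y => M y 0 1) in
  let m22 := (fun y => M y 1 1) in
  (S x 1 1 + g x 1 1) * (d0 m11 x / 2) - 2 * ((S x 0 1 + g x 0 1) * (d1 m11 x / 2)) +
    (S x 0 0 + g x 0 0) * (d1 m12 x - d0 m22 x / 2) = u x ^+ 2 * (M x 0 0 * T 0 0 + M x 0 1 * T 0 1) /\
  (S x 1 1 + g x 1 1) * (d0 m12 x - d1 m11 x / 2) - 2 * ((S x 0 1 + g x 0 1) * (d0 m22 x / 2)) +
    (S x 0 0 + g x 0 0) * (d1 m22 x / 2) = u x ^+ 2 * (M x 0 1 * T 0 0 + M x 1 1 * T 0 1).
Proof.
move=> Dx sM MT uG HT m11 m12 m22.
have S10 y : D y -> S y 1 0 = S y 0 1 by move=> Dy; rewrite -[in LHS](ST Dy) mxE.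
have g10 y : D y -> g y 1 0 = g y 0 1 by move=> Dy; rewrite -[in LHS](gT Dy) mxE.
have M10 y : D y -> M y 1 0 = M y 0 1 by move=> Dy; rewrite -[in LHS](MT _ Dy) mxE.
have aE i j : (S x + g x) i j = S x i j + g x i j by rewrite mxE.
have [] := @invmx2 _ (S x + g x) (u x ^+ 2) _ uG.
  by rewrite uE// !aE S10// g10// expr2.
rewrite !aE S10// g10// => i00 i01 i10 i11.
have H10 v : pd (delta_mx 0 v) (fun y => M y 1 0) x = pd (delta_mx 0 v) (fun y => M y 0 1) x.
  exact: (pd_eq _ oD Dx M10).
exact: (@trace_lowered_algebra R _ (M x) (lowered M x)
  (fun v a b => pd (delta_mx 0 v) (fun y => M y a b) x) T _ _ _ _ i00 i01 i10 i11
  (fun a b l => erefl) H10 (M10 _ Dx) HT).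
Qed.

Lemma stress_free_of_balance x (T : V2) : D x -> S x + g x \in unitmx ->
  (forall k, \sum_(i < 2) \sum_(j < 2) invmx (S x + g x) i j * lowered S x i j k =
    (T *m S x) 0 k) ->
  (forall k, \sum_(i < 2) \sum_(j < 2) invmx (S x + g x) i j * lowered g x i j k =
    (T *m g x) 0 k) ->
  stress_free g11 g12 g22 P11 P12 P22 x.
Proof.
move=> Dx uG HS Hg.
have [S1 S2] := trace_lowered Dx sS ST uG HS.
have [g1 g2] := trace_lowered Dx sg gT uG Hg.
have ux0 := u_gt0 Dx; have uxn := lt0r_neq0 ux0.
have sS11 : sm D S11 by exact: sm_coord.
have sS12 : sm D S12 by exact: sm_coord.
have sS22 : sm D S22 by exact: sm_coord.
have sg11 : sm D g11 by exact: sm_coord.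
have sg12 : sm D g12 by exact: sm_coord.
have sg22 : sm D g22 by exact: sm_coord.
have du v : pd v u x = ((pd v S11 x + pd v g11 x) * (S x 1 1 + g x 1 1) +
    (S x 0 0 + g x 0 0) * (pd v S22 x + pd v g22 x) -
    2 * ((S x 0 1 + g x 0 1) * (pd v S12 x + pd v g12 x))) / (2 * u x).
  have E1 : pd v (fun y => u y ^+ 2) x = 2 * u x * pd v u x.
    by apply: (pd_isder oD Dx (fun y _ => erefl)); [isder_solve|].
  have E2 : pd v (fun y => u y ^+ 2) x = (pd v S11 x + pd v g11 x) * (S x 1 1 + g x 1 1) +
    (S x 0 0 + g x 0 0) * (pd v S22 x + pd v g22 x) -
    2 * ((S x 0 1 + g x 0 1) * (pd v S12 x + pd v g12 x)).
    apply: (pd_isder oD Dx uE); first by isder_solve.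
    by gen_pd; intros; ring.
  by rewrite -E2 E1; field.
have dP (h k : V2 -> R) v : sm D h -> sm D k ->
    isder x v (fun y => (h y + k y) / u y)
      ((pd v h x + pd v k x - (h x + k x) * pd v u x / u x) / u x).
  move=> sh sk; apply: isder_eq; first by isder_solve.
  by gen_pd; intros; field.
(* The balance equations of [S] and [g] add up to that of G = S + g, since they share [T]. *)
have [C1 C2] := @conf_divergence R (S x 0 0 + g x 0 0) (S x 0 1 + g x 0 1) (S x 1 1 + g x 1 1)
  (u x) (d0 S11 x + d0 g11 x) (d0 S12 x + d0 g12 x) (d0 S22 x + d0 g22 x)
  (d1 S11 x + d1 g11 x) (d1 S12 x + d1 g12 x) (d1 S22 x + d1 g22 x) (T 0 0) (T 0 1) ux0 (uE Dx)
  ltac:(move: S1 g1; clear; generalize (S x) (g x); rewrite /d0 /d1; gen_pd; intros; lra)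
  ltac:(move: S2 g2; clear; generalize (S x) (g x); rewrite /d0 /d1; gen_pd; intros; lra).
have [_ p11] := dP S22 g22 (delta_mx 0 0) sS22 sg22.
have [_ p22] := dP S11 g11 (delta_mx 0 1) sS11 sg11.
have [_ p120] := isderN (dP S12 g12 (delta_mx 0 0) sS12 sg12).
have [_ p121] := isderN (dP S12 g12 (delta_mx 0 1) sS12 sg12).
rewrite /stress_free /d0 /d1 p11 p22 p120 p121.
by apply: (stress_algebra ux0 _ _ g1 g2); rewrite !du; [exact: C1|exact: C2].
Qed.
End StressFree.

(** * Positive definite symmetric matrices of size two *)

Section Posdef.
Context {R : realType}.

Lemma det2 (A : 'M[R]_2) : \det A = A 0 0 * A 1 1 - A 0 1 * A 1 0.
Proof.
rewrite (expand_det_row _ 0) big_ord2 /cofactor !det_mx11 !mxE /= expr0 expr1 mul1r mulN1r mulrN.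
by congr (A 0 0 * A _ _ - A 0 1 * A _ _); apply: val_inj.
Qed.

Lemma quadratic_form2 (A : 'M[R]_2) (v : 'rV[R]_2) : A 1 0 = A 0 1 ->
  (v *m A *m v^T) 0 0 =
  v 0 0 ^+ 2 * A 0 0 + 2 * (v 0 0 * v 0 1 * A 0 1) + v 0 1 ^+ 2 * A 1 1.
Proof. by move=> A10; rewrite !mulmxE2 A10 ![_^T _ _]mxE; ring. Qed.

Definition posdef (A : 'M[R]_2) := A^T = A /\
  forall v : 'rV_2, v != 0 -> 0 < (v *m A *m v^T) 0 0.

Lemma posdef_sym A : posdef A -> A 1 0 = A 0 1.
Proof. by move=> [AT _]; rewrite -[in LHS]AT mxE. Qed.

Lemma posdef2P A : posdef A <->
  [/\ A 1 0 = A 0 1, 0 < A 0 0 & 0 < A 0 0 * A 1 1 - A 0 1 ^+ 2].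
Proof.
pose w (a b : R) : 'rV[R]_2 := \row_i if i == 0 then a else b.
have w0 a b : w a b 0 0 = a by rewrite mxE.
have w1 a b : w a b 0 1 = b by rewrite mxE.
split=> [pA|[A10 A0 dA]].
  have A10 := posdef_sym pA; have [_ Ap] := pA.
  have P a b : a != 0 -> 0 < a ^+ 2 * A 0 0 + 2 * (a * b * A 0 1) + b ^+ 2 * A 1 1.
    move=> a0; have := Ap (w a b); rewrite quadratic_form2// w0 w1; apply.
    by apply: contra_neq a0 => wz; rewrite -(w0 a b) wz mxE.
  have Q a b : b != 0 -> 0 < a ^+ 2 * A 0 0 + 2 * (a * b * A 0 1) + b ^+ 2 * A 1 1.
    move=> a0; have := Ap (w a b); rewrite quadratic_form2// w0 w1; apply.
    by apply: contra_neq a0 => wz; rewrite -(w1 a b) wz mxE.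
  have A0 : 0 < A 0 0 by have := P 1 0 (oner_neq0 _); lra.
  (* The test vector (- A01, A00) turns the form into A00 times the determinant. *)
  split => //; have := Q (- A 0 1) (A 0 0) (lt0r_neq0 A0).
  rewrite (_ : _ + _ = A 0 0 * (A 0 0 * A 1 1 - A 0 1 ^+ 2)); last by ring.
  by rewrite pmulr_rgt0.
split.
  apply/matrixP => i j; rewrite mxE.
  by case: (ord2E i) => ->; case: (ord2E j) => ->.
move=> v v0; rewrite quadratic_form2//.
have : 0 < (v 0 0 * A 0 0 + v 0 1 * A 0 1) ^+ 2 + v 0 1 ^+ 2 * (A 0 0 * A 1 1 - A 0 1 ^+ 2).
  have [v10|v1] := eqVneq (v 0 1) 0; last first.
    apply: ltr_wpDl; first exact: sqr_ge0.
    by rewrite mulr_gt0// exprn_even_gt0.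
  rewrite v10 !mul0r addr0 expr0n mul0r addr0 exprn_even_gt0//= mulf_neq0 ?(lt0r_neq0 A0)//.
  apply: contra_neq v0 => v00; apply/rowP => i; rewrite mxE.
  by case: (ord2E i) => ->.
rewrite (_ : _ + _ = A 0 0 * (v 0 0 ^+ 2 * A 0 0 + 2 * (v 0 0 * v 0 1 * A 0 1) + v 0 1 ^+ 2 * A 1 1)).
  by rewrite pmulr_rgt0.
by ring.
Qed.

Lemma posdefD A B : posdef A -> posdef B -> posdef (A + B).
Proof.
move=> [AT Ap] [BT Bp]; split; first by rewrite linearD /= AT BT.
by move=> v v0; rewrite mulmxDr mulmxDl mxE addr_gt0 ?Ap ?Bp.
Qed.

(** Multiplied by [G11 * g11], the mixed trace becomes a combination of the two determinants with
    positive coefficients, plus a square. *)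
Lemma posdef_trace (G11 G12 G22 g11 g12 g22 : R) :
  0 < G11 -> 0 < G11 * G22 - G12 ^+ 2 -> 0 < g11 -> 0 < g11 * g22 - g12 ^+ 2 ->
  0 < G22 * g11 - 2 * (G12 * g12) + G11 * g22.
Proof.
move=> G0 dG g0 dg; rewrite -(pmulr_rgt0 _ (mulr_gt0 G0 g0)).
have -> : G11 * g11 * (G22 * g11 - 2 * (G12 * g12) + G11 * g22) =
  g11 ^+ 2 * (G11 * G22 - G12 ^+ 2) + (G12 * g11 - G11 * g12) ^+ 2 +
  G11 ^+ 2 * (g11 * g22 - g12 ^+ 2) by ring.
by rewrite ltr_wpDr ?mulr_ge0 ?sqr_ge0 ?ltW// ltr_wpDr ?sqr_ge0// mulr_gt0// exprn_gt0.
Qed.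
End Posdef.

Section Chain.
Context {R : realType}.
Local Notation V2 := 'rV[R]_2.

Lemma jacobian_chain (D E : set V2) (h f k : V2 -> V2) x : open D -> open E ->
  smooth_on D h -> smooth_on D f -> (forall x, D x -> E (f x)) -> smooth_on E k ->
  (forall x, D x -> h x = k (f x)) -> D x -> 'J h x = 'J f x *m 'J k (f x).
Proof.
move=> oD oE sh sf fDE sk hE Dx; have Ex := fDE _ Dx; apply/matrixP => i j.
have sk' : sm E (fun y => k y 0 j) by exact: sm_coord.
have [_ E1] := isder_comp (delta_mx 0 i) oD Dx Ex sf sk'.
rewrite (jacobianE i j oD Dx sh) [RHS]mxE.
rewrite (pd_eq _ oD Dx (g := fun y => k (f y) 0 j)); last by move=> y Dy; rewrite hE.
rewrite E1; apply: eq_bigr => l _; rewrite [LHS]mulrC; congr (_ * _).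
  exact: (esym (jacobianE i l oD Dx sf)).
exact: (esym (jacobianE l j oE Ex sk)).
Qed.
End Chain.

Section PullbackMetric.
Context {R : realType}.
Local Notation V2 := 'rV[R]_2.
Variables (D E : set V2) (h : V2 -> 'M[R]_2) (f k : V2 -> V2).
Hypotheses (oD : open D) (oE : open E) (mh : riemannian_metric E h)
  (sf : smooth_on D f) (fDE : forall x, D x -> E (f x))
  (sk : smooth_on E k) (kf : forall x, D x -> k (f x) = x).

Lemma jacobian_comp x : D x -> 'J f x *m 'J k (f x) = 1%:M.
Proof.
move=> Dx; rewrite -(jacobian_chain oD oE (smooth_id oD) sf fDE sk _ Dx).
  apply/matrixP => i j; rewrite (jacobianE _ _ oD Dx (smooth_id oD)) pd_coord.
  by rewrite !mxE eqxx eq_sym.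
by move=> y Dy; rewrite kf.
Qed.

Lemma riemannian_pullback : riemannian_metric D (induced_metric h f).
Proof.
have [sh hT hP] := mh; split.
- apply: smooth_on_mx => // i j.
  apply: (sm_eq oD (fun x Dx => esym (induced_metricE oD sf fDE hT i j Dx))).
  have sF a : sm D (fun y => f y 0 a) by exact: sm_coord.
  have shf a b : sm D (fun y => h (f y) a b).
    by apply: (@sm_comp _ _ D 2 E (fun y => h y a b) f) => //; exact: sm_coord.
  have sp a b := sm_pd (delta_mx 0 a) (sF b).
  repeat lazymatch goal with
    | |- sm _ (fun y => _ + _) => apply: smD; first assumption
    | |- sm _ (fun y => _ * _) => apply: smM; first assumption
    | |- sm _ _ => exact: sp
    end.
  exact: (shf 0 0).
  exact: (shf 0 1).
  exact: (shf 1 1).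
- by move=> x Dx; rewrite /induced_metric !trmx_mul trmxK (hT _ (fDE Dx)) mulmxA.
- move=> x v Dx v0; have := hP (f x) (v *m 'J f x) (fDE Dx).
  rewrite /induced_metric trmx_mul !mulmxA; apply.
  apply: contra_neq v0 => vJ; rewrite -[v]mulmx1 -(jacobian_comp Dx) mulmxA vJ.
  by rewrite mul0mx.
Qed.
End PullbackMetric.

(** * The conformal structure of a minimal graph *)

Section ConformalData.
Context {R : realType}.
Local Notation V2 := 'rV[R]_2.
Local Notation pp := (@plane_point R).
Local Notation mu := (@lebesgue_measure R).
Local Notation mu2 := (mu \x mu)%E.
Variables (S g : V2 -> 'M[R]_2).
Implicit Type y : V2.

Definition G11 y := S y 0 0 + g y 0 0.
Definition G12 y := S y 0 1 + g y 0 1.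
Definition G22 y := S y 1 1 + g y 1 1.
Definition area y := Num.sqrt (G11 y * G22 y - G12 y ^+ 2).
(* S + g is conformal to |dx + (m1 + i m2) dy|^2. *)
Definition m1 y := G12 y / G11 y.
Definition m2 y := area y / G11 y.
(** Half of P^ij g_ij: the energy density of g for the conformal class of G. *)
Definition energy y :=
  (G22 y * g y 0 0 - 2 * (G12 y * g y 0 1) + G11 y * g y 1 1) / (2 * area y).
(** Solved from the entries g11 and g12 of g = (e / m2) |dz|^2 - Re(Phi dz^2) with dz = dx + m dy;
    the entry g22 then follows from the trace. *)
Definition hopf_a y := energy y / m2 y - g y 0 0.
Definition hopf_b y := (g y 0 1 - energy y * m1 y / m2 y + hopf_a y * m1 y) / m2 y.

Variable D : set V2.
Hypotheses (oD : open D) (mS : riemannian_metric D S) (mg : riemannian_metric D g).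

Let posS x : D x -> posdef (S x).
Proof. by move=> Dx; have [_ ST Sp] := mS; split; [exact: ST|move=> v; exact: Sp]. Qed.
Let posg x : D x -> posdef (g x).
Proof. by move=> Dx; have [_ ST Sp] := mg; split; [exact: ST|move=> v; exact: Sp]. Qed.

Lemma det_G x : D x -> [/\ 0 < G11 x, 0 < G11 x * G22 x - G12 x ^+ 2,
  0 < area x & area x ^+ 2 = G11 x * G22 x - G12 x ^+ 2].
Proof.
move=> Dx; have /posdef2P[_] := posdefD (posS Dx) (posg Dx); rewrite !mxE => h1 h2.
by split => //; [rewrite sqrtr_gt0|rewrite sqr_sqrtr// ltW].
Qed.

Let sS i j : sm D (fun y => S y i j). Proof. by case: mS => s _ _; exact: sm_coord. Qed.
Let sg i j : sm D (fun y => g y i j). Proof. by case: mg => s _ _; exact: sm_coord. Qed.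

Lemma smooth_conformal_data :
  [/\ sm D m1, sm D m2, sm D area, sm D energy & sm D hopf_a /\ sm D hopf_b].
Proof.
have s11 : sm D G11 by apply: smD.
have s12 : sm D G12 by apply: smD.
have s22 : sm D G22 by apply: smD.
have sa : sm D area.
  apply: sm_sqrt => //; first by move=> x /det_G[].
  by sm_solve.
have s2a : sm D (fun y => 2 * area y) by sm_solve.
have sG : sm D (fun y => (G11 y)^-1).
  by apply: smV => // x /det_G[/lt0r_neq0].
have sm1 : sm D m1 by rewrite /m1; sm_solve.
have sm2 : sm D m2 by rewrite /m2; sm_solve.
have sm2V : sm D (fun y => (m2 y)^-1).
  apply: smV => // x /det_G[h1 _ h2 _].
  by rewrite lt0r_neq0// divr_gt0.
have saV : sm D (fun y => (2 * area y)^-1).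
  by apply: smV => // x /det_G[_ _ h2 _]; rewrite lt0r_neq0// mulr_gt0.
have se : sm D energy.
  rewrite /energy; have := sg 0 0; have := sg 0 1; have := sg 1 1 => *; sm_solve.
have sha : sm D hopf_a.
  by rewrite /hopf_a; have := sg 0 0 => *; sm_solve.
split => //; split => //.
by rewrite /hopf_b; have := sg 0 1 => *; sm_solve.
Qed.

Lemma m2_gt0 x : D x -> 0 < m2 x.
Proof. by move=> /det_G[h1 _ h2 _]; rewrite divr_gt0. Qed.

Lemma g11_hopf x : D x -> g x 0 0 = energy x / m2 x - hopf_a x.
Proof. by rewrite /hopf_a => _; ring. Qed.

Lemma g12_hopf x : D x ->
  g x 0 1 = energy x * m1 x / m2 x - (hopf_a x * m1 x - hopf_b x * m2 x).
Proof. by move=> /m2_gt0/lt0r_neq0 h; rewrite /hopf_b divfK//; ring. Qed.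

Lemma conf_area x : D x -> [/\ conf11 m1 m2 x = G22 x / area x,
  conf12 m1 m2 x = - (G12 x / area x) & conf22 m2 x = G11 x / area x].
Proof.
move=> /det_G[h1 _ h2 h3]; rewrite /conf11 /conf12 /conf22 /m2 /m1.
have n1 := lt0r_neq0 h1; have n2 := lt0r_neq0 h2; split; last 2 first.
- by field; rewrite n1 n2.
- by field; rewrite n1 n2.
have -> : (G12 x / G11 x) ^+ 2 + (area x / G11 x) ^+ 2 = (G12 x ^+ 2 + area x ^+ 2) / G11 x ^+ 2.
  by field; rewrite n1.
by rewrite h3; field; rewrite n1 n2.
Qed.

Lemma g22_hopf x : D x -> g x 1 1 = energy x * (m1 x ^+ 2 + m2 x ^+ 2) / m2 x -
  (hopf_a x * (m1 x ^+ 2 - m2 x ^+ 2) - 2 * hopf_b x * m1 x * m2 x).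
Proof.
move=> Dx; have [c11 c12 c22] := conf_area Dx; have n2 := lt0r_neq0 (m2_gt0 Dx).
have [_ _ /lt0r_neq0 na _] := det_G Dx.
have eE : 2 * energy x = conf11 m1 m2 x * g x 0 0 + 2 * (conf12 m1 m2 x * g x 0 1) +
    conf22 m2 x * g x 1 1.
  by rewrite c11 c12 c22 /energy; field.
have {eE} : g x 1 1 = m2 x * (2 * energy x - conf11 m1 m2 x * g x 0 0 - 2 * (conf12 m1 m2 x * g x 0 1)).
  by rewrite eE /conf22; field.
rewrite (g11_hopf Dx) (g12_hopf Dx) => ->; rewrite /conf11 /conf12.
by move: n2; generalize (m2 x) (m1 x) (energy x) (hopf_a x) (hopf_b x); intros; field.
Qed.

(** The determinant splits because (e / m2) |dz|^2 is the trace part of g and Re(Phi dz^2) its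
    trace-free part. With det g > 0 this yields the strict inequality that leaves room for eps. *)
Lemma hopf_det x : D x ->
  energy x ^+ 2 - m2 x ^+ 2 * hopf_sq hopf_a hopf_b x = g x 0 0 * g x 1 1 - g x 0 1 ^+ 2.
Proof.
move=> Dx; have n2 := lt0r_neq0 (m2_gt0 Dx).
rewrite (g22_hopf Dx) (g12_hopf Dx) (g11_hopf Dx) /hopf_sq.
by move: n2; generalize (m2 x) (m1 x) (energy x) (hopf_a x) (hopf_b x); intros; field.
Qed.

(** S = G - g has energy [area - energy] and Hopf coefficient - Phi, so this is the formula of
    [hopf_det] for S. *)
Lemma hopf_co_det x : D x ->
  (area x - energy x) ^+ 2 - m2 x ^+ 2 * hopf_sq hopf_a hopf_b x =
  S x 0 0 * S x 1 1 - S x 0 1 ^+ 2.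
Proof.
move=> Dx; have [_ _ /lt0r_neq0 na aE] := det_G Dx.
have -> : (area x - energy x) ^+ 2 = area x ^+ 2 - 2 * (area x * energy x) + energy x ^+ 2 by ring.
rewrite -addrA hopf_det// aE.
have -> : 2 * (area x * energy x) = G22 x * g x 0 0 - 2 * (G12 x * g x 0 1) + G11 x * g x 1 1.
  by rewrite /energy; field.
by rewrite /G11 /G12 /G22; ring.
Qed.

Lemma energy_bounds x : D x -> 0 < energy x /\ 0 < area x - energy x.
Proof.
move=> Dx; have [h1 h2 h3 h4] := det_G Dx.
have /posdef2P[_ S0 S1] := posS Dx; have /posdef2P[_ g0 g1] := posg Dx.
split; first by rewrite divr_gt0 ?mulr_gt0//; exact: posdef_trace.
have -> : area x - energy x =
    (G22 x * S x 0 0 - 2 * (G12 x * S x 0 1) + G11 x * S x 1 1) / (2 * area x).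
  have -> : area x - energy x = (2 * area x ^+ 2 -
      (G22 x * g x 0 0 - 2 * (G12 x * g x 0 1) + G11 x * g x 1 1)) / (2 * area x).
    by rewrite /energy; field; exact: lt0r_neq0.
  by rewrite h4; congr (_ / _); rewrite /G11 /G12 /G22; ring.
by rewrite divr_gt0 ?mulr_gt0//; exact: posdef_trace.
Qed.

Local Notation g11 := (fun y => g y 0 0).
Local Notation g12 := (fun y => g y 0 1).
Local Notation g22 := (fun y => g y 1 1).
Hypothesis balanced : forall x, D x -> stress_free g11 g12 g22
  (fun y => (S y 1 1 + g y 1 1) / area y) (fun y => - ((S y 0 1 + g y 0 1) / area y))
  (fun y => (S y 0 0 + g y 0 0) / area y) x.

Lemma stress_free_conf x : D x ->
  stress_free g11 g12 g22 (conf11 m1 m2) (conf12 m1 m2) (conf22 m2) x.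
Proof.
move=> Dx; have := balanced Dx; have [c11 c12 c22] := conf_area Dx.
rewrite /stress_free /d0 /d1.
have p11 v : pd v (conf11 m1 m2) x = pd v (fun y => (S y 1 1 + g y 1 1) / area y) x.
  by apply: (pd_eq _ oD Dx) => y /conf_area[].
have p12 v : pd v (conf12 m1 m2) x = pd v (fun y => - ((S y 0 1 + g y 0 1) / area y)) x.
  by apply: (pd_eq _ oD Dx) => y /conf_area[].
have p22 v : pd v (conf22 m2) x = pd v (fun y => (S y 0 0 + g y 0 0) / area y) x.
  by apply: (pd_eq _ oD Dx) => y /conf_area[].
by rewrite c11 c12 c22 !p11 !p12 !p22.
Qed.

Variables (U : set V2) (X1 X2 Y1 Y2 : V2 -> R).
Hypotheses (rU : relatively_compact_open D U)
  (sX1 : sm D X1) (sX2 : sm D X2) (sY1 : sm D Y1) (sY2 : sm D Y2).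
Hypotheses (X10 : forall x, D x -> ~ U x -> X1 x = 0)
  (X20 : forall x, D x -> ~ U x -> X2 x = 0)
  (Y10 : forall x, D x -> ~ U x -> Y1 x = 0)
  (Y20 : forall x, D x -> ~ U x -> Y2 x = 0).

Lemma integral_second_var_metric_ge0 :
  0 <= \int[mu2]_(z in pp @^-1` U)
         (second_var m1 m2 area g11 g12 g22 X1 X2 Y1 Y2 (pp z)).
Proof.
have [s1 s2 sa se [sha shb]] := smooth_conformal_data.
apply: (@integral_second_var_ge0 R D U m1 m2 area energy hopf_a hopf_b) => //.
- exact: m2_gt0.
- exact: g11_hopf.
- exact: g12_hopf.
- exact: g22_hopf.
- exact: stress_free_conf.
- by move=> x /energy_bounds[].
- by move=> x /energy_bounds[].
- by move=> x Dx; rewrite -subr_gt0 hopf_det//; have /posdef2P[] := posg Dx.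
- by move=> x Dx; rewrite -subr_gt0 hopf_co_det//; have /posdef2P[] := posS Dx.
Qed.
End ConformalData.

(** * The area along a path of diffeomorphisms *)

Section Slices.
Context {R : realType}.
Local Notation V2 := 'rV[R]_2.
Local Notation V := (R^o * V2)%type.
Variables (e : R) (D : set V2).
Hypothesis oD : open D.

Lemma slice_sm (J : V -> R) t : `|t| < e -> sm (spacetime e D) J -> sm D (fun y => J (t, y)).
Proof.
move=> te /class_CP sJ; apply/class_CP => n; have := sJ n; clear sJ.
elim: n J => [|n ih] J [J0 Jv].
  split=> // x Dx.
  apply: (@differentiable_comp _ _ _ _ (fun y : V2 => (cst (t : R^o) y, id y) : V) J).
    by apply: differentiable_pair; [exact: differentiable_cst|exact: ex_diff].
  exact: J0.
split => [x Dx|v].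
  apply: (@differentiable_comp _ _ _ _ (fun y : V2 => (cst (t : R^o) y, id y) : V) J).
    by apply: differentiable_pair; [exact: differentiable_cst|exact: ex_diff].
  exact: J0.
apply: (@class_C_eq _ _ _ _ _ (fun y => pd (space_dir v) J (t, y) : R^o)) => //.
  by move=> x _; rewrite -pd_slice.
exact: ih (Jv (space_dir v)).
Qed.

Lemma time_constant (J : V -> R) x : D x -> sm (spacetime e D) J ->
  (forall t, `|t| < e -> J (t, x) = J (0, x)) ->
  forall t, `|t| < e -> pd tau J (t, x) = 0.
Proof.
move=> Dx sJ J0 t te; have [_ <-] := slice_is_derive sJ te Dx.
rewrite -(derive_cst (W := R^o) (J (0, x)) (1 : R) t).
apply: near_eq_derive; apply: filterS (near_norm_lt te) => s se.
by rewrite J0.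
Qed.

(** Second-order jets in time: handling a value and its two derivatives as one triple reduces the
    second derivative of [graph_det] to product and chain rules. *)
Definition jet (p : V) (f : V -> R) (a b c : R) :=
  [/\ sm (spacetime e D) f, f p = a, pd tau f p = b & pd tau (pd tau f) p = c].

Let os := @open_spacetime R e D oD.

Lemma jetD p f g a b c a' b' c' : spacetime e D p -> jet p f a b c -> jet p g a' b' c' ->
  jet p (fun q => f q + g q) (a + a') (b + b') (c + c').
Proof.
move=> Dp [sf <- <- <-] [sg <- <- <-]; split => //; first exact: smD.
  by apply: (pd_isder os Dp (fun y _ => erefl)) => //; exact: isderD (isder_sm _ sf Dp) (isder_sm _ sg Dp).
apply: (pd_isder os Dp (g := fun q => pd tau f q + pd tau g q)).
- move=> q Dq; apply: (pd_isder os Dq (fun y _ => erefl)) => //.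
  exact: isderD (isder_sm _ sf Dq) (isder_sm _ sg Dq).
- exact: isderD (isder_sm _ (sm_pd tau sf) Dp) (isder_sm _ (sm_pd tau sg) Dp).
by [].
Qed.

Lemma jetM p f g a b c a' b' c' : spacetime e D p -> jet p f a b c -> jet p g a' b' c' ->
  jet p (fun q => f q * g q) (a * a') (b * a' + a * b') (c * a' + 2 * (b * b') + a * c').
Proof.
move=> Dp [sf <- <- <-] [sg <- <- <-]; split => //; first exact: smM.
  by apply: (pd_isder os Dp (fun y _ => erefl)) => //; exact: isderM (isder_sm _ sf Dp) (isder_sm _ sg Dp).
apply: (pd_isder os Dp (g := fun q => pd tau f q * g q + f q * pd tau g q)).
- move=> q Dq; apply: (pd_isder os Dq (fun y _ => erefl)) => //.
  exact: isderM (isder_sm _ sf Dq) (isder_sm _ sg Dq).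
- apply: isderD; apply: isderM.
  + exact: isder_sm (sm_pd tau sf) Dp.
  + exact: isder_sm sg Dp.
  + exact: isder_sm sf Dp.
  + exact: isder_sm (sm_pd tau sg) Dp.
by gen_pd; intros; ring.
Qed.

Lemma jet_cst p k : jet p (fun=> k) k 0 0.
Proof.
have E q : pd tau (fun=> k) q = 0 by have [] := isder_cst tau q k.
split => //; first exact: sm_cst.
rewrite (_ : pd tau (fun=> k) = fun=> 0) //; last by apply/funext => q; exact: E.
by have [] := isder_cst tau p (0 : R).
Qed.

Lemma jet_sm p f : sm (spacetime e D) f -> jet p f (f p) (pd tau f p) (pd tau (pd tau f) p).
Proof. by []. Qed.

Lemma jet_eq p f a b c a' b' c' : jet p f a b c -> a = a' -> b = b' -> c = c' -> jet p f a' b' c'.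
Proof. by move=> + <- <- <-. Qed.

Lemma smooth_snd (E : set V) : open E -> smooth_on E (snd : V -> V2).
Proof.
move=> oE; have cs : continuous (snd : V -> V2) by move=> p; exact: cvg_snd.
have ds x : differentiable (snd : V -> V2) x.
  exact: (@linear_differentiable _ _ _ (snd : {linear V -> V2})).
apply/class_CP => -[|k]; split => // [v].
apply: (class_C_eq (f := cst v.2)) => //; last exact: class_C_cst.
by move=> x _; rewrite deriveE// (@diff_lin _ _ _ (snd : {linear V -> V2})).
Qed.

Lemma jet_space p (h : V2 -> R) : spacetime e D p -> sm D h ->
  jet p (fun q => h q.2) (h p.2) 0 0.
Proof.
move=> Dp sh; have s2 : sm (spacetime e D) (fun q => h q.2).
  by apply: (@sm_comp _ _ _ 2 D h snd) => //; [move=> q []|exact: smooth_snd].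
have Z q : spacetime e D q -> pd tau (fun q => h q.2) q = 0.
  by move: q => [t x] [te Dx]; apply: (time_constant Dx s2).
split => //; first exact: Z.
by rewrite (pd_eq tau os Dp Z); have [] := isder_cst tau p (0 : R).
Qed.

Lemma jet_comp p (psi : V -> V2) (h : V2 -> R) : spacetime e D p ->
  (forall q, spacetime e D q -> D (psi q)) -> smooth_on (spacetime e D) psi -> sm D h ->
  let X k := pd tau (fun q => psi q 0 k) p in
  let Y k := pd tau (pd tau (fun q => psi q 0 k)) p in
  jet p (fun q => h (psi q)) (h (psi p))
    (d0 h (psi p) * X 0 + d1 h (psi p) * X 1)
    (d0 h (psi p) * Y 0 + d1 h (psi p) * Y 1 +
     (d0 (d0 h) (psi p) * (X 0 * X 0) + 2 * (d0 (d1 h) (psi p) * (X 0 * X 1)) +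
      d1 (d1 h) (psi p) * (X 1 * X 1))).
Proof.
move=> Dp psiD spsi sh X Y.
have C (k : V2 -> R) (sk : sm D k) q : spacetime e D q ->
    isder q tau (fun q => k (psi q)) (d0 k (psi q) * pd tau (fun q => psi q 0 0) q +
      d1 k (psi q) * pd tau (fun q => psi q 0 1) q).
  move=> Dq; have := isder_comp tau os Dq (psiD _ Dq) spsi sk.
  by rewrite big_ord2.
have sp k : sm (spacetime e D) (fun q => psi q 0 k) by exact: sm_coord.
split => //; first by apply: (@sm_comp _ _ _ 2 D h psi).
  by have [_] := C h sh p Dp.
have s0 : sm D (d0 h) by exact: sm_pd.
have s1 : sm D (d1 h) by exact: sm_pd.
apply: (pd_isder os Dp (g := fun q => d0 h (psi q) * pd tau (fun q => psi q 0 0) q +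
      d1 h (psi q) * pd tau (fun q => psi q 0 1) q)).
- by move=> q Dq; have [_] := C h sh q Dq.
- apply: isderD; apply: isderM.
  + exact: C.
  + exact: isder_sm (sm_pd tau (sp 0)) Dp.
  + exact: C.
  + exact: isder_sm (sm_pd tau (sp 1)) Dp.
have -> : d1 (d0 h) (psi p) = d0 (d1 h) (psi p) by exact: (pd_comm _ _ oD (psiD _ Dp) sh).
by rewrite /X /Y; generalize (d0 h (psi p)) (d1 h (psi p)) (d0 (d0 h) (psi p))
  (d0 (d1 h) (psi p)) (d1 (d1 h) (psi p)); gen_pd; intros; ring.
Qed.

(** The product rule for jets, applied to sqrt(f) sqrt(f) = f, is solved for the derivatives of the
    root. *)
Lemma jet_sqrt p f a b c : spacetime e D p -> (forall q, spacetime e D q -> 0 < f q) ->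
  jet p f a b c ->
  jet p (fun q => Num.sqrt (f q)) (Num.sqrt a) (b / (2 * Num.sqrt a))
    (c / (2 * Num.sqrt a) - (b / (2 * Num.sqrt a)) ^+ 2 / Num.sqrt a).
Proof.
move=> Dp f0 [sf fa fb fc].
have sr : sm (spacetime e D) (fun q => Num.sqrt (f q)) by exact: sm_sqrt.
have s0 : 0 < Num.sqrt a by rewrite sqrtr_gt0 -fa; exact: f0.
have sn := lt0r_neq0 s0.
have [_ _ E1 E2] := jetM Dp (jet_sm p sr) (jet_sm p sr).
have fE q : spacetime e D q -> Num.sqrt (f q) * Num.sqrt (f q) = f q.
  by move=> Dq; rewrite -expr2 sqr_sqrtr// ltW// f0.
rewrite (pd_eq tau os Dp fE) fb fa in E1.
have fE1 q : spacetime e D q -> pd tau (fun q => Num.sqrt (f q) * Num.sqrt (f q)) q = pd tau f q.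
  by move=> Dq; exact: (pd_eq tau os Dq fE).
rewrite (pd_eq tau os Dp fE1) fc fa in E2.
have P1 : pd tau (fun q => Num.sqrt (f q)) p = b / (2 * Num.sqrt a).
  by rewrite E1; field.
split => //; first by rewrite fa.
by rewrite E2 P1; field.
Qed.
End Slices.

Section AreaVariation.
Context {R : realType}.
Local Notation V2 := 'rV[R]_2.
Local Notation V := (R^o * V2)%type.
Local Notation e_ i := (delta_mx 0 i).
Variables (e : R) (D : set V2) (S g : V2 -> 'M[R]_2) (psi : V -> V2).
Hypotheses (e0 : 0 < e) (oD : open D) (mS : riemannian_metric D S)
  (mg : riemannian_metric D g) (spsi : smooth_on (spacetime e D) psi)
  (psiD : forall q, spacetime e D q -> D (psi q))
  (psi0 : forall x, D x -> psi (0, x) = x).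

Definition dpsi i k := pd (space_dir (e_ i)) (fun q => psi q 0 k).

Definition pulled i j q :=
  dpsi i 0 q * g (psi q) 0 0 * dpsi j 0 q +
  (dpsi i 0 q * dpsi j 1 q + dpsi i 1 q * dpsi j 0 q) * g (psi q) 0 1 +
  dpsi i 1 q * g (psi q) 1 1 * dpsi j 1 q.

(* Written without subtraction so that jetD and jetM apply. *)
Definition graph_det q := (S q.2 0 0 + pulled 0 0 q) * (S q.2 1 1 + pulled 1 1 q) +
  -1 * ((S q.2 0 1 + pulled 0 1 q) * (S q.2 0 1 + pulled 0 1 q)).

(** The fields X and Y of the second variation. The acceleration of an arbitrary path is arbitrary,
    and [Z1], [Z2] absorb it. *)
Definition speed k y := pd tau (fun q => psi q 0 k) (0, y).
Definition accel k y := pd tau (pd tau (fun q => psi q 0 k)) (0, y).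

Let os := @open_spacetime R e D oD.
Let sp k : sm (spacetime e D) (fun q => psi q 0 k). Proof. exact: sm_coord. Qed.
Let e00 : `|0 : R| < e. Proof. by rewrite normr0. Qed.
Let sS i j : sm D (fun y => S y i j). Proof. by case: mS => s _ _; exact: sm_coord. Qed.
Let sg i j : sm D (fun y => g y i j). Proof. by case: mg => s _ _; exact: sm_coord. Qed.

Lemma sm_speed k : sm D (speed k).
Proof. exact: (slice_sm oD e00 (sm_pd tau (sp k))). Qed.

Lemma sm_accel k : sm D (accel k).
Proof. exact: (slice_sm oD e00 (sm_pd tau (sm_pd tau (sp k)))). Qed.

Section At.
Variable x : V2.
Hypothesis Dx : D x.
Let p : V := (0, x).
Let Dp : spacetime e D p. Proof. by split. Qed.

(** At time 0 [psi] is the identity, whence the Kronecker symbol; time and space derivatives are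
    then exchanged. *)
Lemma jet_dpsi i k : jet e D p (dpsi i k) ((k == i)%:R)
  (pd (e_ i) (speed k) x) (pd (e_ i) (accel k) x).
Proof.
have C q : spacetime e D q -> pd tau (dpsi i k) q =
    pd (space_dir (e_ i)) (pd tau (fun q => psi q 0 k)) q.
  by move=> Dq; exact: (pd_comm _ _ os Dq (sp k)).
split; first exact: sm_pd.
- apply: etrans (esym (pd_slice (fun q => psi q 0 k) 0 x (e_ i))) _.
  rewrite (pd_eq _ oD Dx (g := fun y : V2 => y 0 k)); last by move=> y Dy; rewrite psi0.
  by rewrite pd_coord mxE eqxx.
- rewrite (C p Dp).
  exact: (esym (pd_slice (pd tau (fun q => psi q 0 k)) 0 x (e_ i))).
- rewrite (pd_eq tau os Dp C) (pd_comm _ _ os Dp (sm_pd tau (sp k))).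
  exact: (esym (pd_slice (pd tau (pd tau (fun q => psi q 0 k))) 0 x (e_ i))).
Qed.

Lemma jet_metric a b : jet e D p (fun q => g (psi q) a b) (g x a b)
  (d0 (fun y => g y a b) x * speed 0 x + d1 (fun y => g y a b) x * speed 1 x)
  (d0 (fun y => g y a b) x * accel 0 x + d1 (fun y => g y a b) x * accel 1 x +
     (d0 (d0 (fun y => g y a b)) x * (speed 0 x * speed 0 x) +
      2 * (d0 (d1 (fun y => g y a b)) x * (speed 0 x * speed 1 x)) +
      d1 (d1 (fun y => g y a b)) x * (speed 1 x * speed 1 x))).
Proof.
have := jet_comp oD Dp psiD spsi (sg a b).
by rewrite /p psi0.
Qed.

Local Notation g11 := (fun y => g y 0 0).
Local Notation g12 := (fun y => g y 0 1).
Local Notation g22 := (fun y => g y 1 1).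
Local Notation X1 := (speed 0).
Local Notation X2 := (speed 1).
Local Notation Y1 := (accel 0).
Local Notation Y2 := (accel 1).

Ltac jet_solve :=
  repeat lazymatch goal with
    | |- jet _ _ _ (fun y => _ + _) _ _ _ => apply: (jetD oD Dp)
    | |- jet _ _ _ (fun y => _ * _) _ _ _ => apply: (jetM oD Dp)
    | |- jet _ _ _ (fun y => dpsi ?i ?k y) _ _ _ => exact: (jet_dpsi i k)
    | |- jet _ _ _ (dpsi ?i ?k) _ _ _ => exact: (jet_dpsi i k)
    | |- jet _ _ _ _ _ _ _ => exact: jet_metric
    end.

Ltac jet_ring :=
  rewrite /pull2_11 /pull2_12 /pull2_22 /lie11 /lie12 /lie22 /d0 /d1 /=;
  generalize (g x) (speed 0 x) (speed 1 x) (accel 0 x) (accel 1 x);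
  gen_pd; intros; ring.

Lemma jet_pulled11 : jet e D p (pulled 0 0) (g x 0 0) (lie11 g11 g12 X1 X2 x)
  (pull2_11 g11 g12 g22 X1 X2 Y1 Y2 x).
Proof. by apply: jet_eq; first (by rewrite /pulled; jet_solve); jet_ring. Qed.

Lemma jet_pulled12 : jet e D p (pulled 0 1) (g x 0 1) (lie12 g11 g12 g22 X1 X2 x)
  (pull2_12 g11 g12 g22 X1 X2 Y1 Y2 x).
Proof. by apply: jet_eq; first (by rewrite /pulled; jet_solve); jet_ring. Qed.

Lemma jet_pulled22 : jet e D p (pulled 1 1) (g x 1 1) (lie22 g12 g22 X1 X2 x)
  (pull2_22 g11 g12 g22 X1 X2 Y1 Y2 x).
Proof. by apply: jet_eq; first (by rewrite /pulled; jet_solve); jet_ring. Qed.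

Lemma jet_graph_det :
  let l11 := lie11 g11 g12 X1 X2 x in let l12 := lie12 g11 g12 g22 X1 X2 x in
  let l22 := lie22 g12 g22 X1 X2 x in
  jet e D p graph_det (G11 S g x * G22 S g x - G12 S g x ^+ 2)
    (l11 * G22 S g x + G11 S g x * l22 - 2 * (G12 S g x * l12))
    (pull2_11 g11 g12 g22 X1 X2 Y1 Y2 x * G22 S g x + 2 * (l11 * l22) +
     G11 S g x * pull2_22 g11 g12 g22 X1 X2 Y1 Y2 x -
     2 * (G12 S g x * pull2_12 g11 g12 g22 X1 X2 Y1 Y2 x + l12 ^+ 2)).
Proof.
move=> l11 l12 l22; rewrite {}/l11 {}/l12 {}/l22.
have H11 := jetD oD Dp (jet_space oD Dp (sS 0 0)) jet_pulled11.
have H12 := jetD oD Dp (jet_space oD Dp (sS 0 1)) jet_pulled12.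
have H22 := jetD oD Dp (jet_space oD Dp (sS 1 1)) jet_pulled22.
have H := jetD oD Dp (jetM oD Dp H11 H22) (jetM oD Dp (jet_cst e D p (-1)) (jetM oD Dp H12 H12)).
by apply: (jet_eq H); rewrite /G11 /G12 /G22 /=;
  generalize (pull2_11 g11 g12 g22 X1 X2 Y1 Y2 x) (pull2_12 g11 g12 g22 X1 X2 Y1 Y2 x)
    (pull2_22 g11 g12 g22 X1 X2 Y1 Y2 x) (lie11 g11 g12 X1 X2 x)
    (lie12 g11 g12 g22 X1 X2 x) (lie22 g12 g22 X1 X2 x) (S x) (g x); intros; ring.
Qed.
End At.

Hypothesis det_gt0 : forall q, spacetime e D q -> 0 < graph_det q.

(** For the determinant d and its root u, [jet_sqrt] gives d'' / (2 u) - (d' / (2 u))^2 / u. Here d'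
    / (2 u) is [trace_lie], since the [conf] coefficients form the adjugate of G divided by u. *)
Lemma pd2_graph_area x : D x ->
  pd tau (pd tau (fun q => Num.sqrt (graph_det q))) (0, x) =
  second_var (m1 S g) (m2 S g) (area S g) (fun y => g y 0 0) (fun y => g y 0 1)
    (fun y => g y 1 1) (speed 0) (speed 1) (accel 0) (accel 1) x.
Proof.
move=> Dx; have Dp : spacetime e D (0, x) by split.
have [_ _ _ ->] := jet_sqrt oD Dp det_gt0 (jet_graph_det Dx).
have [_ _ h3 _] := det_G mS mg Dx; have n3 := lt0r_neq0 h3.
have [c11 c12 c22] := conf_area mS mg Dx.
rewrite -/(area S g x) /second_var /trace_lie c11 c12 c22.
move: n3; generalize (area S g x) (G11 S g x) (G12 S g x) (G22 S g x).
generalize (lie11 (fun y => g y 0 0) (fun y => g y 0 1) (speed 0) (speed 1) x)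
  (lie12 (fun y => g y 0 0) (fun y => g y 0 1) (fun y => g y 1 1) (speed 0) (speed 1) x)
  (lie22 (fun y => g y 0 1) (fun y => g y 1 1) (speed 0) (speed 1) x).
generalize (pull2_11 (fun y => g y 0 0) (fun y => g y 0 1) (fun y => g y 1 1)
     (speed 0) (speed 1) (accel 0) (accel 1) x)
  (pull2_12 (fun y => g y 0 0) (fun y => g y 0 1) (fun y => g y 1 1)
     (speed 0) (speed 1) (accel 0) (accel 1) x)
  (pull2_22 (fun y => g y 0 0) (fun y => g y 0 1) (fun y => g y 1 1)
     (speed 0) (speed 1) (accel 0) (accel 1) x).
by intros; field.
Qed.

Lemma sm_graph_det : sm (spacetime e D) graph_det.
Proof.
have sS' i j : sm (spacetime e D) (fun q => S q.2 i j).
  apply: (@sm_comp _ _ _ 2 D (fun y => S y i j) snd) => //; first by move=> q [].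
  exact: smooth_snd.
have sg' i j : sm (spacetime e D) (fun q => g (psi q) i j).
  by apply: (@sm_comp _ _ _ 2 D (fun y => g y i j) psi).
have sd i k : sm (spacetime e D) (dpsi i k) by exact: sm_pd.
have g00 := sg' 0 0; have g01 := sg' 0 1; have g11 := sg' 1 1.
have sp' i j : sm (spacetime e D) (pulled i j).
  have i0 := sd i 0; have i1 := sd i 1; have j0 := sd j 0; have j1 := sd j 1.
  by move: os => os'; rewrite /pulled; sm_solve.
have p00 := sp' 0 0; have p01 := sp' 0 1; have p11 := sp' 1 1.
have s00 := sS' 0 0; have s01 := sS' 0 1; have s11 := sS' 1 1.
by move: os => os'; rewrite /graph_det; sm_solve.
Qed.
End AreaVariation.

(** * Competitors as variations of the identity of the disk *)

Section Disk.
Context {R : realType}.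
Local Notation V2 := 'rV[R]_2.
Local Notation V := (R^o * V2)%type.
Local Notation D := (@disk R).

Lemma open_disk : open D.
Proof.
have oT := @openT V2.
have s i : sm [set: V2] (fun y => y 0 i) by exact: sm_coord (smooth_id oT).
have sq : sm [set: V2] (fun y : V2 => y 0 0 ^+ 2 + y 0 1 ^+ 2).
  by apply: smD => //; exact: smX.
have cq : continuous (fun y : V2 => y 0 0 ^+ 2 + y 0 1 ^+ 2).
  by move=> y; exact: (differentiable_continuous (sm_diff sq (I : setT y))).
rewrite (_ : D = (fun y : V2 => y 0 0 ^+ 2 + y 0 1 ^+ 2) @^-1` [set r | r < 1])//.
by apply: open_comp; [move=> y _; exact: cq|exact: open_lt].
Qed.

(** Since h = f o psi_t, the chain rule identifies the pullback of s2 by h with the pullback of f^*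
    s2 by psi_t. *)
Lemma graph_det_induced (s1 s2 : V2 -> 'M[R]_2) (f h : V2 -> V2) (psi : V -> V2) t x :
  riemannian_metric D s1 -> riemannian_metric D s2 -> smooth_on D f ->
  (forall x, D x -> D (f x)) -> smooth_on D h -> (forall x, D x -> D (h x)) ->
  smooth_on D (fun y => psi (t, y)) -> (forall x, D x -> D (psi (t, x))) ->
  (forall x, D x -> h x = f (psi (t, x))) -> D x ->
  let M := s1 x + induced_metric s2 h x in
  graph_det s1 (induced_metric s2 f) psi (t, x) = M 0 0 * M 1 1 - M 0 1 ^+ 2.
Proof.
move=> mS1 mS2 sf fD sh hD sp pD hE Dx M; have oD := open_disk.
have [_ s2T _] := mS2.
have gT y : D y -> (induced_metric s2 f y)^T = induced_metric s2 f y.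
  by move=> Dy; rewrite /induced_metric !trmx_mul trmxK (s2T _ (fD _ Dy)) mulmxA.
have E : induced_metric s2 h x = induced_metric (induced_metric s2 f) (fun y => psi (t, y)) x.
  rewrite {1 2}/induced_metric (jacobian_chain oD oD sh sp pD sf hE Dx) (hE _ Dx).
  by rewrite /induced_metric trmx_mul !mulmxA.
have dE a b : pd (delta_mx 0 a) (fun y => psi (t, y) 0 b) x = dpsi psi a b (t, x).
  exact: (pd_slice (fun q => psi q 0 b) t x (delta_mx 0 a)).
have pE i j : induced_metric s2 h x i j = pulled (induced_metric s2 f) psi i j (t, x).
  by rewrite E; apply: etrans (induced_metricE oD sp pD gT i j Dx) _; rewrite !dE.
have aE i j : M i j = s1 x i j + pulled (induced_metric s2 f) psi i j (t, x).
  by rewrite -pE /M [LHS]mxE.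
rewrite !aE /graph_det /=; generalize (pulled (induced_metric s2 f) psi) (s1 x) => P N.
by ring.
Qed.
End Disk.

Theorem theoremA (R : realType) (s1 s2 : 'rV[R]_2 -> 'M[R]_2)
    (f : 'rV[R]_2 -> 'rV[R]_2) :
  riemannian_metric (@disk R) s1 ->
  riemannian_metric (@disk R) s2 ->
  minimal_diffeomorphism s1 s2 f ->
  stable s1 s2 f.
Proof.
move=> mS1 mS2 [[sf fD [k [sk kD kf fk]]] minimal] U e ft rU e0 [fts sft] ft0 ftU A.
have oD := @open_disk R; have os := @open_spacetime R e _ oD.
pose g := induced_metric s2 f.
have mg : riemannian_metric (@disk R) g := riemannian_pullback oD oD mS2 sf fD sk kf.
(* [k] is the inverse of [f], so that [ft t] is [f] after psi_t on the disk, and psi starts at the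
   identity. *)
pose psi (q : R^o * 'rV[R]_2) := k (ft q.1 q.2).
have ftD t x : `|t| < e -> disk x -> disk (ft t x).
  by move=> te Dx; have [_ h _] := fts t te; exact: h.
have psiD q : spacetime e (@disk R) q -> disk (psi q).
  by move=> [te Dx]; apply: kD; exact: ftD.
have spsi : smooth_on (spacetime e (@disk R)) psi.
  apply: smooth_on_mx => // i j.
  apply: (@sm_comp _ _ _ 2 (@disk R) (fun y => k y i j)
    (fun q : R^o * 'rV[R]_2 => ft q.1 q.2)) => //.
    by move=> q [te Dx]; exact: ftD.
  exact: sm_coord.
have psi0 x : disk x -> psi (0, x) = x by move=> Dx; rewrite /psi /= ft0// kf.
have det_induced t x : `|t| < e -> disk x ->
    posdef (s1 x + induced_metric s2 (ft t) x) /\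
    graph_det s1 g psi (t, x) =
    \det (induced_metric (product_metric s1 s2) (graph_map (ft t)) x).
  move=> te Dx; have [sh hD [k' [sk' _ kh _]]] := fts t te.
  have pM : posdef (s1 x + induced_metric s2 (ft t) x).
    apply: posdefD.
      by have [_ sT sP] := mS1; split; [exact: sT|move=> v; exact: sP].
    have [_ sT sP] := riemannian_pullback oD oD mS2 sh hD sk' kh.
    by split; [exact: sT|move=> v; exact: sP].
  split => //.
  have sp : smooth_on (@disk R) (fun y => psi (t, y)).
    apply: smooth_on_mx => // i j.
    by apply: (@sm_comp _ _ _ 2 (@disk R) (fun y => k y i j) (ft t)) => //; exact: sm_coord.
  rewrite (induced_graph s1 s2 oD sh Dx) det2 (posdef_sym pM) -expr2.
  apply: (@graph_det_induced R s1 s2 f (ft t) psi t x) => //.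
    by move=> y Dy; apply: psiD.
  by move=> y Dy; rewrite /psi fk//; exact: ftD.
have det_gt0 q : spacetime e (@disk R) q -> 0 < graph_det s1 g psi q.
  move: q => [t x] [te Dx]; have [pM ->] := det_induced t x te Dx.
  have [sh _ _] := fts t te.
  by rewrite (induced_graph s1 s2 oD sh Dx) det2 (posdef_sym pM) -expr2; have /posdef2P[] := pM.
have sJ : sm (spacetime e (@disk R)) (fun q => Num.sqrt (graph_det s1 g psi q)).
  by apply: sm_sqrt => //; exact: sm_graph_det.
have [_ _ UD] := rU.
have UD' x : U x -> disk x by move=> Ux; apply: UD; exact: subset_closure.
have AE t : `|t| < e -> A t =
    \int[(lebesgue_measure \x lebesgue_measure)%E]_(z in @plane_point R @^-1` U)
      Num.sqrt (graph_det s1 g psi (t, plane_point z)).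
  move=> te; rewrite /A /graph_area; apply: eq_Rintegral => z /set_mem Uz.
  by have [_ ->] := det_induced t _ te (UD' _ Uz).
have [A1 A2 A3] := derive2_integral e0 rU sJ AE.
split => //; rewrite A3.
have sspeed := sm_speed e0 oD spsi; have saccel := sm_accel e0 oD spsi.
(* Off [U] the path [psi] is constant in time, so X and Y vanish there, as the integrations by parts
   require. *)
have fixed x : disk x -> ~ U x -> forall t, `|t| < e -> psi (t, x) = x.
  by move=> Dx Ux t te; rewrite /psi /= ftU// kf.
have sp i : sm (spacetime e (@disk R)) (fun q => psi q 0 i) := sm_coord 0 i os spsi.
have speed0 i x t : disk x -> ~ U x -> `|t| < e ->
    pd tau (fun q => psi q 0 i) (t, x) = 0.
  move=> Dx Ux; apply: (time_constant Dx (sp i)).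
  by move=> s se; rewrite !fixed// normr0.
have accel0 i x : disk x -> ~ U x -> accel psi i x = 0.
  move=> Dx Ux; apply: (time_constant Dx (sm_pd tau (sp i))); last by rewrite normr0.
  by move=> s se; rewrite !speed0// normr0.
have speed00 i x : disk x -> ~ U x -> speed psi i x = 0.
  by move=> Dx Ux; apply: speed0; rewrite ?normr0.
(* Minimality enters here, through the vector [T] common to the two factors. *)
have balanced x : disk x -> stress_free (fun y => g y 0 0) (fun y => g y 0 1) (fun y => g y 1 1)
  (fun y => (s1 y 1 1 + g y 1 1) / area s1 g y) (fun y => - ((s1 y 0 1 + g y 0 1) / area s1 g y))
  (fun y => (s1 y 0 0 + g y 0 0) / area s1 g y) x.
  move=> Dx; have [T HT] := minimal_graph_balance oD oD mS1 mS2 sf fD Dx (minimal _ Dx).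
  have [ss1 s1T _] := mS1; have [sg gT _] := mg.
  apply: (@stress_free_of_balance R (@disk R) s1 g (area s1 g) oD ss1 sg _ s1T gT _ _ x T Dx).
  - by have [] := smooth_conformal_data oD mS1 mg.
  - by move=> y Dy; have [] := det_G mS1 mg Dy.
  - by move=> y Dy; have [] := det_G mS1 mg Dy.
  - apply: posdef_unit => v v0; have [_ _ sP] := mS1; have [_ _ gP] := mg.
    by rewrite mulmxDr mulmxDl mxE addr_gt0 ?sP ?gP.
  - by move=> l; have [] := HT l.
  - by move=> l; have [] := HT l.
have := @integral_second_var_metric_ge0 R s1 g (@disk R) oD mS1 mg balanced U
  (speed psi 0) (speed psi 1) (accel psi 0) (accel psi 1) rU (sspeed 0) (sspeed 1)
  (saccel 0) (saccel 1) (speed00 0) (speed00 1) (accel0 0) (accel0 1).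
congr (_ <= _); apply: eq_Rintegral => z /set_mem Uz; apply/esym.
exact: (pd2_graph_area e0 oD mS1 mg spsi psiD psi0 det_gt0 (UD' _ Uz)).
Qed.
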